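(* There is a randomized algorithm which, given an instance $J=(X,k,\mathcal{R})$ of Binary Constrained Clustering with $X\subseteq\{0,1\}^m$, $|X|=n$, and a real $\epsilon>0$, runs in time $2^{\mathcal{O}\left(\frac{k^4}{\epsilon^2}\log\frac{1}{\epsilon}\right)}\cdot\left(\frac{1}{\epsilon}\right)^{\mathcal{O}\left(\frac{k}{\epsilon^2}\log\frac{1}{\epsilon}\right)}\cdot n\cdot m$ and outputs a solution $C$ (a $k$-tuple of vectors of $\{0,1\}^m$ satisfying $\mathcal{R}$) such that, with probability at least $1-\frac{1}{e}$, $\mathrm{cost}(X,C)\le(1+\epsilon)\,\mathrm{OPT}(J)$.
   Context: A $k$-ary relation is a set $R\subseteq\{0,1\}^k$. For a family $\mathcal{R}=(R_1,\ldots,R_m)$ of $k$-ary relations, an ordered $k$-tuple $C=(\mathbf{c}_1,\ldots,\mathbf{c}_k)$ of vectors $\mathbf{c}_j\in\{0,1\}^m$ satisfies $\mathcal{R}$ if $(\mathbf{c}_1[i],\ldots,\mathbf{c}_k[i])\in R_i$ for every $i\in\{1,\ldots,m\}$. $d_H$ is Hamming distance; $d_H(\mathbf{x},Y)=\min_{\mathbf{y}\in Y}d_H(\mathbf{x},\mathbf{y})$ and $\mathrm{cost}(X,Y)=\sum_{\mathbf{x}\in X}d_H(\mathbf{x},Y)$ (a tuple is identified with the set of its entries). Binary Constrained Clustering: given a set $X\subseteq\{0,1\}^m$ of $n$ vectors, a positive integer $k$ and a family $\mathcal{R}=(R_1,\ldots,R_m)$ of $k$-ary relations, find a $k$-tuple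 $C$ satisfying $\mathcal{R}$ minimizing $\mathrm{cost}(X,C)$; $\mathrm{OPT}(J)$ is this minimum.
   Formalization: For ε > 1/2 the running-time bound is taken at ε = 1/2, since the stated bound fails near and above ε = 1, where log(1/ε) ≤ 0; n and m count as at least 1 in the bound, and a solution is required only if some k-tuple satisfies R. *)

(* Defs.v *)
From HB Require Import structures.
From mathcomp Require Import all_boot all_order all_algebra.
From mathcomp Require Import reals sequences exp.

Set Implicit Arguments.
Unset Strict Implicit.
Unset Printing Implicit Defensive.

Import Order.TTheory GRing.Theory Num.Theory.

Local Open Scope nat_scope.

(** * Binary Constrained Clustering *)

Section Clustering.

Variables m k : nat.

Definition hdist (x y : m.-tuple bool) : nat :=
  #|[set i : 'I_m | tnth x i != tnth y i]|.

(* Distances are at most m, so the default value m is harmless as soon as Y is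
   nonempty. *)
Definition hdist_set (x : m.-tuple bool) (Y : {set m.-tuple bool}) : nat :=
  \big[minn/m]_(y in Y) hdist x y.

Definition cost (X Y : {set m.-tuple bool}) : nat :=
  \sum_(x in X) hdist_set x Y.

Definition entries (C : k.-tuple (m.-tuple bool)) : {set m.-tuple bool} :=
  [set c in C].

Definition satisfies (Rs : m.-tuple {set k.-tuple bool})
    (C : k.-tuple (m.-tuple bool)) : bool :=
  [forall i : 'I_m, [tuple tnth (tnth C j) i | j < k] \in tnth Rs i].

(* Every cost is at most #|X| * m, so this is the minimum as soon as some tuple
   satisfies Rs. *)
Definition OPT (X : {set m.-tuple bool}) (Rs : m.-tuple {set k.-tuple bool})
    : nat :=
  \big[minn/#|X| * m]_(C : k.-tuple (m.-tuple bool) | satisfies Rs C)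
    cost X (entries C).

End Clustering.

(** * Randomized random-access machines

   Programs of a structured language over finitely many registers and an
   unbounded memory with indirect addressing, both holding natural numbers.
   Arithmetic is restricted to addition and truncated subtraction: with
   unit-cost multiplication, unbounded integers would make the model
   unreasonably powerful.  The real input eps is available only through its
   comparisons with rational numbers. *)

Inductive expr :=
| Const of nat
| Reg of nat
| Mem of expr
| Add of expr & expr
| Sub of expr & expr.

Inductive test :=
| Leq of expr & expr
| LeqEps of expr & expr.

Inductive cmd :=
| Skip
| Assign of nat & expr
| Store of expr & expr
| Rand of nat & expr
| Seq of cmd & cmd
| If of test & cmd & cmd
| While of test & cmd.

Record state := State { regs : nat -> nat; mem : nat -> nat }.

Definition upd (f : nat -> nat) (a v : nat) : nat -> nat :=
  fun b => if b == a then v else f b.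

Definition set_reg (s : state) (r v : nat) : state :=
  State (upd (regs s) r v) (mem s).

Definition set_mem (s : state) (a v : nat) : state :=
  State (regs s) (upd (mem s) a v).

(* The control stack (the commands still to be executed) and the store; the
   machine halts when the stack is empty. *)
Definition config : Type := seq cmd * state.

Fixpoint eval (s : state) (e : expr) : nat :=
  match e with
  | Const v => v
  | Reg r => regs s r
  | Mem e1 => mem s (eval s e1)
  | Add e1 e2 => eval s e1 + eval s e2
  | Sub e1 e2 => eval s e1 - eval s e2
  end.

Section Semantics.

Variables (R : realType) (eps : R).

(* [LeqEps e1 e2] tests whether e1 <= e2 * eps. *)
Definition holds (s : state) (b : test) : bool :=
  match b with
  | Leq e1 e2 => eval s e1 <= eval s e2
  | LeqEps e1 e2 => ((eval s e1)%:R <= (eval s e2)%:R * eps)%R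
  end.

(* The equally likely successors of a configuration.  [Rand r e] stores in
   register r a uniformly random element of {0, ..., v - 1}, where v is the
   value of e (and 0 if v = 0); all other commands are deterministic.  One
   step is one unit of time: the expressions of a program are fixed
   independently of its input, so a step performs boundedly many elementary
   operations. *)
Definition succs (cf : config) : seq config :=
  let: (K, s) := cf in
  if K is c :: K' then
    match c with
    | Skip => [:: (K', s)]
    | Assign r e => [:: (K', set_reg s r (eval s e))]
    | Store a e => [:: (K', set_mem s (eval s a) (eval s e))]
    | Rand r e =>
        [seq (K', set_reg s r v) | v <- iota 0 (maxn 1 (eval s e))]
    | Seq c1 c2 => [:: (c1 :: c2 :: K', s)]
    | If b c1 c2 => [:: ((if holds s b then c1 else c2) :: K', s)]
    | While b c1 => [:: (if holds s b then c1 :: c :: K' else K', s)]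
    end
  else [::].

(* For all random choices, the machine halts within t steps, in a state
   satisfying Q. *)
Fixpoint always (Q : state -> Prop) (t : nat) (cf : config) : Prop :=
  match cf.1, t with
  | [::], _ => Q cf.2
  | _ :: _, 0 => False
  | _ :: _, t'.+1 =>
      forall i, i < size (succs cf) -> always Q t' (nth cf (succs cf) i)
  end.

(* The probability that the machine halts within t steps, in a state
   satisfying Q. *)
Fixpoint prob (Q : state -> bool) (t : nat) (cf : config) : R :=
  match cf.1, t with
  | [::], _ => (Q cf.2)%:R
  | _ :: _, 0 => 0
  | _ :: _, t'.+1 =>
      (\sum_(cf' <- succs cf) prob Q t' cf') / (size (succs cf))%:R
  end%R.

End Semantics.

(** * Input, output and running time *)

(* Row-major bits of the listed points, followed by the truth tables of the
   relations, each of length 2 ^ k.  In a truth table, entry v stands for the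
   k-tuple whose component j is bit j of v. *)
Definition encode (m k : nat) (xs : seq (m.-tuple bool))
    (Rs : m.-tuple {set k.-tuple bool}) : seq nat :=
  [seq nat_of_bool b | x <- xs, b <- tval x] ++
  [seq nat_of_bool ([tuple odd (v %/ 2 ^ j) | j < k] \in A)
     | A : {set k.-tuple bool} <- tval Rs, v : nat <- iota 0 (2 ^ k)].

Definition init (m k : nat) (xs : seq (m.-tuple bool))
    (Rs : m.-tuple {set k.-tuple bool}) : state :=
  State (nth 0 [:: size xs; m; k]) (nth 0 (encode xs Rs)).

(* The k * m output bits are read from the memory block whose address is in
   register 0; component i of center j is at offset j * m + i. *)
Definition output (m k : nat) (s : state) : k.-tuple (m.-tuple bool) :=
  [tuple [tuple mem s (regs s 0 + j * m + i) != 0 | i < m] | j < k].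

(* 2^(c1 k^4/eps^2 log(1/eps)) (1/eps)^(c2 k/eps^2 log(1/eps)) n m.  The
   expression only makes sense for small eps (its exponents vanish at eps = 1),
   so for eps > 1/2 its value at 1/2 is taken; also, an empty point set or
   dimension 0 counts as 1. *)
Definition time_bound (R : realType) (c1 c2 : nat) (eps : R) (k n m : nat) : R :=
  (let e := Num.min eps 2^-1 in
   2 `^ (c1%:R * (k%:R ^+ 4 / e ^+ 2 * ln e^-1)) *
   e^-1 `^ (c2%:R * (k%:R / e ^+ 2 * ln e^-1)) *
   (maxn 1 n)%:R * (maxn 1 m)%:R)%R.

(* Main.v *)
Require Import Defs.
From mathcomp Require Import all_boot all_order all_algebra.
From mathcomp Require Import reals sequences exp.
From mathcomp Require Import zify ring lra.

Import Order.TTheory GRing.Theory Num.Theory.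

Local Open Scope ring_scope.

(** The algorithm repeats a trial [Q ^ O(k^3 Q^2)] times, with [Q = O(1/eps)], and
    keeps the best solution found.  Every quantity that would require knowledge
    of the optimum is guessed with [Rand], so that a trial only has to succeed
    with probability [Q ^ - O(k^3 Q^2)].

    A trial first draws [k] anchors after an arbitrary first one, each with
    probability proportional to the distance to the previous anchors; with
    probability at least [6 ^ - k] the points are within total distance [18 OPT]
    of the anchors.  Let the cell of an anchor be the set of points nearest to
    it, and fix an optimal solution.  In each cell, the points of a cluster that
    owns less than a [1 / (Q k^2)] fraction of the cell are moved to the center
    that dominates the cell.  This is expensive only for a minor point [x] far
    from its anchor, namely for [2 d(x, A) >= d(c_j, A)]; such points stay in
    their cluster [j] when they are numerous, and they then make up a
    non-negligible fraction of [{x | thr_j <= 6 Q d(x, A)}] for a threshold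
    [thr_j] which is read off a point drawn proportionally to [d(x, A)].  The
    clustering that results costs at most [(1 + 21 / Q) OPT], and it consists of
    [k (k + 2)] groups, each a fraction at least [Q ^ - 4k] of a set from which
    the machine can sample.

    From every group take [r = 2 Q^2] samples, each weighted by a guess of the
    group size.  Conditioned on all samples falling in their groups they are
    independent and uniform, and a second moment bound shows that choosing, in
    every coordinate, the tuple of the relation that minimizes the weighted
    disagreement with the samples loses, with probability at least 1/2, only
    another factor [1 + O(1 / Q)]. *)

Set Implicit Arguments.
Unset Strict Implicit.
Unset Printing Implicit Defensive.

(** * Expected values of randomized programs *)

(** The time bound is linear in [n * m], so no guess may range over a set that grows with [n] or
    [m]. A group size is therefore guessed only relative to the set sampled from, whose exact size
    the sampler computes on the way: the weight is [t] times that size with [t <= M], and rounding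
    costs a relative error of at most [1 / Q] once the group is a [1 / BI] fraction and
    [Q * BI <= M]. For the same reason the distance scale of the far points is read off a sample.

    Each of the [k (k + 2) r] samples succeeds with probability at least
    [1 / ((M + 1) BI) = Q ^ - O(k)], and [r = O(Q ^ 2)]; this gives the exponent [O(k ^ 3 Q ^ 2)].
    The precision is [Q = 64 E], with [E] the least integer above 1 such that [E eps >= 1]; the 64
    leaves room for the losses [(Q + 21) / Q] of the reassignment and [(Q + 3) / (Q - 2)] of the
    sampling.

    Lower bounds on probabilities are propagated backwards through the program as real functions of
    the state, next to an invariant and a time bound that hold on all runs. *)

Notation smem := Defs.mem.
Notation Mem := Defs.Mem.
Notation Sub := Defs.Sub.

Section Logic.

Variables (R : realType) (eps : R).

(** With a real function in place of the event of [prob], the value after one command can itself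
    serve as the function for the preceding command, as in a weakest pre-expectation calculus. *)
Fixpoint expct (f : state -> R) (t : nat) (cf : config) : R :=
  match cf.1, t with
  | [::], _ => f cf.2
  | _ :: _, 0%N => 0
  | _ :: _, t'.+1 =>
      (\sum_(cf' <- succs eps cf) expct f t' cf') / (size (succs eps cf))%:R
  end.

Lemma probE Q t cf : prob eps Q t cf = expct (fun s => (Q s)%:R) t cf.
Proof.
elim: t cf => [|t IH] [[|c K] s] //=; congr (_ / _).
by apply: eq_bigr => cf' _; exact: IH.
Qed.

Lemma size_succs_gt0 c K s : (0 < size (succs eps (c :: K, s)))%N.
Proof. by case: c => //= r e; rewrite size_map size_iota leq_max. Qed.

(** A step looks only at the head of the control stack, so the pending commands below it are carried
    along unchanged. The sequencing rules rest on this locality. *)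
Lemma succs_cat c K1 K2 s :
  succs eps (c :: K1 ++ K2, s) =
  [seq (cf.1 ++ K2, cf.2) | cf <- succs eps (c :: K1, s)].
Proof.
case: c => //= [r e|b c].
  by rewrite -map_comp; apply: eq_map.
by case: ifP.
Qed.

#[local] Arguments succs : simpl never.

Lemma ler_avg (T : Type) (x0 : T) (l : seq T) (F G : T -> R) :
  (forall i, (i < size l)%N -> F (nth x0 l i) <= G (nth x0 l i)) ->
  (\sum_(x <- l) F x) / (size l)%:R <= (\sum_(x <- l) G x) / (size l)%:R.
Proof.
move=> H; rewrite ler_wpM2r ?invr_ge0 ?ler0n //.
rewrite !(big_nth x0) !big_mkord; apply: ler_sum => i _; exact: H.
Qed.

Lemma avg_affine (T : Type) (l : seq T) (F : T -> R) a b :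
  (0 < size l)%N ->
  (\sum_(x <- l) (a + b * F x)) / (size l)%:R =
  a + b * ((\sum_(x <- l) F x) / (size l)%:R).
Proof.
move=> H; rewrite big_split /= -mulr_sumr.
rewrite big_const_seq count_predT iter_addr_0 -[a *+ _]mulr_natr.
field; by rewrite pnatr_eq0 -lt0n.
Qed.

Lemma expct_ge0 f t cf : (forall s, 0 <= f s) -> 0 <= expct f t cf.
Proof.
move=> f0; elim: t cf => [|t IH] [[|c K] s] //=.
by rewrite divr_ge0 ?ler0n // sumr_ge0.
Qed.

Lemma expct_time f t t' cf : (forall s, 0 <= f s) -> (t <= t')%N ->
  expct f t cf <= expct f t' cf.
Proof.
move=> f0; elim: t t' cf => [|t IH] [|t'] [[|c K] s] // tt'.
  exact: expct_ge0.
by apply: (ler_avg (x0 := ([::], s))) => i _; apply: IH.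
Qed.

Lemma always_weaken Q Q' t t' cf : (forall s, Q s -> Q' s) -> (t <= t')%N ->
  always eps Q t cf -> always eps Q' t' cf.
Proof.
move=> QQ; elim: t t' cf => [|t IH] [|t'] [[|c K] s] //= tt'; try exact: QQ.
by move=> H i hi; apply: IH (H i hi).
Qed.

Lemma always_cat I Q t t' K1 K2 s :
  always eps I t (K1, s) ->
  (forall s', I s' -> always eps Q t' (K2, s')) ->
  always eps Q (t + t') (K1 ++ K2, s).
Proof.
move=> H1 H2; elim: t K1 s H1 => [|t IH] [|c K1] s //.
- exact: H2.
- by move=> /H2; apply: always_weaken => //; lia.
move=> /= H i.
rewrite succs_cat size_map => hi.
rewrite (nth_map (c :: K1, s)) //.
by case: (nth _ _ _) (H i hi) => K s'; apply: IH.
Qed.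

Lemma expct_cat I f g t t' K1 K2 s : (forall s, 0 <= f s) ->
  always eps I t (K1, s) ->
  (forall s', I s' -> g s' <= expct f t' (K2, s')) ->
  expct g t (K1, s) <= expct f (t + t') (K1 ++ K2, s).
Proof.
move=> f0 H1 H2; elim: t K1 s H1 => [|t IH] [|c K1] s //.
- exact: H2.
- move=> /H2 /le_trans; apply; apply: expct_time => //; lia.
move=> /= H.
rewrite succs_cat size_map big_map.
apply: (ler_avg (x0 := (c :: K1, s))) => i hi.
by case: (nth _ _ _) (H i hi) => K s'; apply: IH.
Qed.

(** Averages commute with affine maps as long as no run is cut off: [always] makes every run halt in
    time, so the constant [a] is not lost to runs of value 0. *)
Lemma expct_affine (I : state -> Prop) a b f g t cf :
  (forall s, I s -> a + b * f s <= g s) ->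
  always eps I t cf -> a + b * expct f t cf <= expct g t cf.
Proof.
move=> fg; elim: t cf => [|t IH] [[|c K] s] //=; try exact: fg.
move=> H; rewrite -avg_affine; last exact: size_succs_gt0.
by apply: (ler_avg (x0 := (c :: K, s))) => i hi; apply: IH; apply: H.
Qed.

(* Runs that do not halt within [t] steps contribute 0 to [expct], so the rules
   below need [f] to be nonnegative. *)
Definition JK K s t (I : state -> Prop) (f : state -> R) v :=
  always eps I t (K, s) /\ v <= expct f t (K, s).
Definition J c := JK [:: c].

Definition tri c s t I := always eps I t ([:: c], s).

Lemma J_tri c s t I f v : J c s t I f v -> tri c s t I.
Proof. by case. Qed.

Lemma tri_J c s t I f v : tri c s t I -> (forall s', I s' -> v <= f s') ->
  J c s t I f v.
Proof.
move=> H Hf; split=> //.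
have := @expct_affine I v 0 f f t ([:: c], s) _ H.
rewrite !mul0r addr0; apply => s' /Hf; by rewrite mul0r addr0.
Qed.

Lemma tri_J_and c s t (I : state -> Prop) f v :
  tri c s t (fun s' => I s' /\ v <= f s') -> J c s t I f v.
Proof.
move=> H; have [_ hv] := tri_J (f := f) H (fun s' h => proj2 h); split=> //.
by apply: always_weaken H => // s' [].
Qed.

Lemma tri_J0 c s t I : tri c s t I <-> J c s t I (fun=> 0) 0.
Proof. by split=> [H|[]//]; apply: tri_J. Qed.

Lemma JK_cat K1 K2 s t1 t2 I1 I2 f1 f2 v : (forall s, 0 <= f2 s) ->
  JK K1 s t1 I1 f1 v -> (forall s', I1 s' -> JK K2 s' t2 I2 f2 (f1 s')) ->
  JK (K1 ++ K2) s (t1 + t2) I2 f2 v.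
Proof.
move=> f0 [H1 v1] H2; split.
  by apply: always_cat H1 _ => s' /H2 [].
by apply: le_trans v1 _; apply: expct_cat H1 _ => // s' /H2 [].
Qed.

Lemma J_conseq c s t t' (I I' : state -> Prop) f f' v v' :
  J c s t I f v ->
  (t <= t')%N -> (forall s, 0 <= f' s) ->
  (forall s', I s' -> I' s' /\ f s' <= f' s') -> v' <= v ->
  J c s t' I' f' v'.
Proof.
move=> [H hv] tt f0 IH vv; split.
  by apply: always_weaken H => // s' /IH [].
apply: le_trans vv (le_trans hv _); apply: le_trans (expct_time _ f0 tt).
have := @expct_affine I 0 1 f f' t ([:: c], s) _ H.
by rewrite !mul1r add0r; apply => s' /IH []; rewrite mul1r add0r.
Qed.

Lemma J_affine c s t I f v a b (g : state -> R) : 0 <= b ->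
  J c s t I f v -> (forall s', I s' -> a + b * f s' <= g s') ->
  J c s t I g (a + b * v).
Proof.
move=> b0 [H hv] fg; split=> //; apply: le_trans (expct_affine fg H).
by rewrite lerD2l ler_wpM2l.
Qed.

Lemma JK_step c K K' s s' t I f v :
  succs eps (c :: K, s) = [:: (K', s')] ->
  JK K' s' t I f v -> JK (c :: K) s t.+1 I f v.
Proof.
move=> E [H hv]; split => /=; rewrite E //=; first by case.
by rewrite big_seq1 divr1.
Qed.

Lemma J_skip s (I : state -> Prop) f v : I s -> v <= f s -> J Skip s 1 I f v.
Proof. by move=> *; apply: JK_step; [by rewrite /succs|split]. Qed.

Lemma J_assign r e s (I : state -> Prop) f v :
  I (set_reg s r (eval s e)) -> v <= f (set_reg s r (eval s e)) ->
  J (Assign r e) s 1 I f v.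
Proof. by move=> *; apply: JK_step; [by rewrite /succs|split]. Qed.

Lemma J_store a e s (I : state -> Prop) f v :
  I (set_mem s (eval s a) (eval s e)) ->
  v <= f (set_mem s (eval s a) (eval s e)) ->
  J (Store a e) s 1 I f v.
Proof. by move=> *; apply: JK_step; [by rewrite /succs|split]. Qed.

Lemma J_seq c1 c2 s t1 t2 I1 I2 f1 f2 v : (forall s, 0 <= f2 s) ->
  J c1 s t1 I1 f1 v -> (forall s', I1 s' -> J c2 s' t2 I2 f2 (f1 s')) ->
  J (Seq c1 c2) s (t1 + t2).+1 I2 f2 v.
Proof.
move=> f0 H1 H2; apply: JK_step; first by rewrite /succs.
exact: (JK_cat (K1 := [:: c1])) f0 H1 H2.
Qed.

Lemma J_if b c1 c2 s t I f v : (forall s, 0 <= f s) ->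
  (holds eps s b -> J c1 s t I f v) -> (~~ holds eps s b -> J c2 s t I f v) ->
  J (If b c1 c2) s t.+1 I f v.
Proof.
move=> f0 H1 H2; apply: JK_step; first by rewrite /succs.
by case: (boolP (holds _ _ _)); [exact: H1|exact: H2].
Qed.

Lemma J_rand r e s (I : state -> Prop) (f : state -> R) v :
  (forall x, (x < maxn 1 (eval s e))%N -> I (set_reg s r x)) ->
  v <= (\sum_(x < maxn 1 (eval s e)) f (set_reg s r x)) / (maxn 1 (eval s e))%:R ->
  J (Rand r e) s 1 I f v.
Proof.
move=> HI Hv; split; rewrite /= /succs.
  move=> i; rewrite size_map size_iota => hi.
  by rewrite (nth_map 0%N) ?size_iota // nth_iota //; exact: HI.
apply: le_trans Hv _; rewrite size_map size_iota big_map.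
by rewrite -[X in iota 0 X]subn0 -/(index_iota _ _) big_mkord.
Qed.

(** The family [f] is a submartingale along the loop: it never drops in expectation over one turn.
    The number of turns is the same on all runs, which makes the time bound a product. *)
Lemma J_while b c n s t (I : nat -> state -> Prop) (f : nat -> state -> R) i :
  (forall i s, 0 <= f i s) ->
  (forall i s, (i < n)%N -> I i s -> holds eps s b) ->
  (forall s, I n s -> ~~ holds eps s b) ->
  (forall i s, (i < n)%N -> I i s -> J c s t (I i.+1) (f i.+1) (f i s)) ->
  (i <= n)%N -> I i s ->
  J (While b c) s ((n - i) * t.+1).+1 (I n) (f n) (f i s).
Proof.
move=> f0 Hb Hn Hc; move: {2}(n - i)%N (erefl (n - i)%N) => d.
elim: d i s => [|d IH] i s di i_le Ii.
  have -> : i = n by lia.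
  rewrite subnn mul0n.
  have En : i = n by lia.
  rewrite En in Ii *; apply: (JK_step (K' := [::]) (s' := s)).
    by rewrite /succs (negbTE (Hn _ Ii)).
  by split.
have i_lt : (i < n)%N by lia.
apply: (JK_step (K' := [:: c; While b c]) (s' := s)).
  by rewrite /succs (Hb _ _ i_lt Ii).
have -> : ((n - i) * t.+1)%N = (t + ((n - i.+1) * t.+1).+1)%N.
  by rewrite -(subnSK i_lt) mulSn addSn addnS.
apply: (JK_cat (K1 := [:: c])); [exact: f0|exact: Hc|].
by move=> s' Is'; apply: IH => //; lia.
Qed.

Lemma J_while_le b c n s t (I : nat -> state -> Prop) (f : nat -> state -> R) :
  (forall i s, 0 <= f i s) ->
  (forall i s, (i < n)%N -> I i s -> holds eps s b) ->
  (forall s, I n s -> ~~ holds eps s b) ->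
  (forall i s, (i < n)%N -> I i s -> J c s t (I i.+1) (f i.+1) (f i s)) ->
  I 0%N s ->
  J (While b c) s (n * t.+1).+1 (I n) (f n) (f 0%N s).
Proof.
by move=> *; rewrite -[X in (X * _)%N]subn0; apply: J_while.
Qed.

Definition For r e body :=
  Seq (Assign r (Const 0))
    (While (Leq (Add (Reg r) (Const 1)) e)
       (Seq body (Assign r (Add (Reg r) (Const 1))))).

Definition t_for n t := (n * (t + 3) + 3)%N.

Local Notation incr s r := (set_reg s r (regs s r).+1).

Lemma J_for r e body n s t (I : nat -> state -> Prop) (f : nat -> state -> R) :
  (forall i s, 0 <= f i s) ->
  (forall i s, (i <= n)%N -> I i s -> regs s r = i /\ eval s e = n) ->
  (forall i s, (i < n)%N -> I i s ->
     J body s t (fun s' => I i.+1 (incr s' r))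
       (fun s' => f i.+1 (incr s' r)) (f i s)) ->
  I 0%N (set_reg s r 0) ->
  J (For r e body) s (t_for n t) (I n) (f n) (f 0%N (set_reg s r 0)).
Proof.
move=> f0 Hr Hb H0; set s0 := set_reg s r 0 in H0 *.
have -> : t_for n t = (1 + (n * (t + 1).+2).+1).+1 by rewrite /t_for; lia.
apply: (@J_seq _ _ _ _ _ (fun s' => s' = s0) _ (f 0%N)).
- exact: f0.
- exact: J_assign.
move=> _ ->; apply: J_while_le => //.
- by move=> i s1 hi /(Hr _ _ (ltnW hi)) [/= -> ->]; rewrite addn1.
- by move=> s1 /(Hr _ _ (leqnn n)) [/= -> ->]; rewrite addn1 ltnn.
move=> i s1 hi Is1; apply: J_seq (Hb _ _ hi Is1) _; first exact: f0.
by move=> s2 H2; apply: J_assign => /=; rewrite addn1.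
Qed.

Lemma tri_weaken c s t t' (I I' : state -> Prop) :
  tri c s t I -> (t <= t')%N -> (forall s', I s' -> I' s') -> tri c s t' I'.
Proof. by move=> H tt II; apply: always_weaken H. Qed.

Lemma tri_time c s t t' I : (t <= t')%N -> tri c s t I -> tri c s t' I.
Proof. by move=> tt H; apply: tri_weaken H tt _. Qed.

Lemma tri_skip s (I : state -> Prop) : I s -> tri Skip s 1 I.
Proof. by move=> H; apply/tri_J0; apply: J_skip. Qed.

Lemma tri_assign r e s (I : state -> Prop) :
  I (set_reg s r (eval s e)) -> tri (Assign r e) s 1 I.
Proof. by move=> H; apply/tri_J0; apply: J_assign. Qed.

Lemma tri_store a e s (I : state -> Prop) :
  I (set_mem s (eval s a) (eval s e)) -> tri (Store a e) s 1 I.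
Proof. by move=> H; apply/tri_J0; apply: J_store. Qed.

Lemma tri_seq c1 c2 s t1 t2 I2 :
  tri c1 s t1 (fun s' => tri c2 s' t2 I2) -> tri (Seq c1 c2) s (t1 + t2).+1 I2.
Proof.
move=> /tri_J0 H; apply/tri_J0; apply: J_seq H _ => // s' H; exact/tri_J0.
Qed.

Lemma tri_if b c1 c2 s t I :
  (holds eps s b -> tri c1 s t I) -> (~~ holds eps s b -> tri c2 s t I) ->
  tri (If b c1 c2) s t.+1 I.
Proof.
by move=> H1 H2; apply/tri_J0; apply: J_if => // /[dup] h; [move/H1|move/H2];
  move/tri_J0.
Qed.

Lemma tri_for r e body n s t (I : nat -> state -> Prop) :
  (forall i s, (i <= n)%N -> I i s -> regs s r = i /\ eval s e = n) ->
  (forall i s, (i < n)%N -> I i s ->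
     tri body s t (fun s' => I i.+1 (incr s' r))) ->
  I 0%N (set_reg s r 0) ->
  tri (For r e body) s (t_for n t) (I n).
Proof.
move=> Hr Hb H0; apply/tri_J0.
apply: (@J_for _ _ _ _ _ _ I (fun _ _ => 0)) => // i s' hi Ii.
by apply/tri_J0; exact: Hb.
Qed.

Lemma tri_while b c n s t (I : nat -> state -> Prop) :
  (forall i s, (i < n)%N -> I i s -> holds eps s b) ->
  (forall s, I n s -> ~~ holds eps s b) ->
  (forall i s, (i < n)%N -> I i s -> tri c s t (I i.+1)) ->
  I 0%N s -> tri (While b c) s (n * t.+1).+1 (I n).
Proof.
move=> H1 H2 H3 H4; apply/tri_J0.
apply: (@J_while_le _ _ _ _ _ I (fun _ _ => 0)) => // i s' hi Ii.
by apply/tri_J0; exact: H3.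
Qed.

End Logic.

Lemma regs_same s r v : regs (set_reg s r v) r = v.
Proof. by rewrite /= /upd eqxx. Qed.

Lemma regs_other s r v r' : r' != r -> regs (set_reg s r v) r' = regs s r'.
Proof. by rewrite /= /upd => /negbTE ->. Qed.

(** Frames go by register number: globals occupy the lowest registers and a subroutine mostly writes
    higher registers than its callers, whose data survive below the bound [b]. *)
Definition keep b (s s' : state) := forall r, (r < b)%N -> regs s' r = regs s r.

Lemma keep_trans b s1 s2 s3 : keep b s1 s2 -> keep b s2 s3 -> keep b s1 s3.
Proof. by move=> H1 H2 r hr; rewrite H2 // H1. Qed.

Lemma keep_le b b' s s' : (b' <= b)%N -> keep b s s' -> keep b' s s'.
Proof. by move=> bb H r hr; apply: H; apply: leq_trans bb. Qed.

Lemma keep_set b s s' r v : (b <= r)%N -> keep b s s' -> keep b s (set_reg s' r v).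
Proof.
move=> br H r' hr; rewrite regs_other ?H // neq_ltn.
by rewrite (leq_trans hr br).
Qed.

Lemma keep_mem b s s' a v : keep b s s' -> keep b s (set_mem s' a v).
Proof. by []. Qed.

Local Open Scope nat_scope.

(** * Arithmetic and distance computations *)

Definition hamn (mu : nat -> nat) m p q := \sum_(i < m) (mu (p + i) != mu (q + i)).

(** This mirrors the loop of [Mindist]: the comparison is strict, so ties go to the smallest index,
    and index 0 stays when no value lies below the cap [b]. *)
Fixpoint amin (D : nat -> nat) b n : nat * nat :=
  if n is n'.+1 then
    let a := amin D b n' in if D n' < a.1 then (D n', n') else a
  else (b, 0).

Lemma eq_amin D D' b n : (forall l, l < n -> D l = D' l) -> amin D b n = amin D' b n.
Proof.
elim: n => //= n IH H; rewrite IH ?H // => l hl; apply: H; exact: ltnW.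
Qed.

(** Repeated addition, at a cost linear in the value of [e1]. Inside a trial the first factor is
    therefore always one bounded in terms of [k] and [eps] alone. *)
Definition Mul d e1 e2 :=
  Seq (Assign d (Const 0)) (For 60 e1 (Assign d (Add (Reg d) e2))).

Definition t_mul a := t_for a 1 + 2.

Definition Pow d b e :=
  Seq (Assign d (Const 1))
    (For 61 e (Seq (Mul 62 b (Reg d)) (Assign d (Reg 62)))).

Definition t_pow b e := t_for e (t_mul b + 2) + 2.

Definition Ham :=
  let P := Mem (Add (Reg 31) (Reg 50)) in
  let Q := Mem (Add (Reg 43) (Reg 50)) in
  let Inc := Assign 51 (Add (Reg 51) (Const 1)) in
  Seq (Assign 51 (Const 0))
    (For 50 (Reg 1) (If (Leq P Q) (If (Leq Q P) Skip Inc) Inc)).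

Definition t_ham m := t_for m 3 + 2.

Definition Mindist :=
  Seq (Assign 41 (Reg 1)) (Seq (Assign 42 (Const 0))
    (For 40 (Reg 17)
      (Seq (Assign 43 (Mem (Add (Reg 13) (Reg 40))))
      (Seq Ham
        (If (Leq (Add (Reg 51) (Const 1)) (Reg 41))
           (Seq (Assign 41 (Reg 51)) (Assign 42 (Reg 40)))
           Skip))))).

Definition t_mindist m na := t_for na (1 + (t_ham m + 4).+1).+1 + 4.

Local Notation incr s r := (set_reg s r (regs s r).+1).

Section Programs.

Variables (R : realType) (eps : R).

Local Notation tri := (tri eps).

Lemma tri_mul d e1 e2 s a b (I : state -> Prop) : d != 60 ->
  (forall s', (forall r, r != 60 -> r != d -> regs s' r = regs s r) ->
     smem s' = smem s -> eval s' e1 = a /\ eval s' e2 = b) ->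
  (forall s', (forall r, r != 60 -> r != d -> regs s' r = regs s r) ->
     smem s' = smem s -> regs s' d = a * b -> I s') ->
  tri (Mul d e1 e2) s (t_mul a) I.
Proof.
move=> dn He HI.
have -> : t_mul a = (1 + t_for a 1).+1 by rewrite /t_mul; lia.
apply: tri_seq; apply: tri_assign.
set s0 := set_reg _ _ _.
pose Inv i s' := [/\ regs s' 60 = i, regs s' d = i * b, smem s' = smem s &
  forall r, r != 60 -> r != d -> regs s' r = regs s r].
apply: (@tri_weaken _ _ _ _ (t_for a 1) _ (Inv a)) => //; last first.
  by move=> s' [_ h2 h3 h4]; apply: HI.
apply: tri_for => [i s' hi [h1 h2 h3 h4]|i s' hi [h1 h2 h3 h4]|].
- by rewrite h1; have [-> _] := He _ h4 h3.
- apply: tri_assign; have [_ Eb] := He _ h4 h3; split => //.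
  + by rewrite regs_same regs_other 1?eq_sym // h1.
  + by rewrite regs_other // regs_same /= h2 Eb mulSn addnC.
  + by move=> r r1 r2; rewrite !regs_other // h4.
- split => //.
  + by rewrite regs_other // regs_same.
  + by move=> r r1 r2; rewrite !regs_other.
Qed.

Lemma tri_pow d b e s vb ve (I : state -> Prop) : d < 60 ->
  (forall s', (forall r, r < 60 -> r != d -> regs s' r = regs s r) ->
     smem s' = smem s -> eval s' b = vb /\ eval s' e = ve) ->
  (forall s', (forall r, r < 60 -> r != d -> regs s' r = regs s r) ->
     smem s' = smem s -> regs s' d = vb ^ ve -> I s') ->
  tri (Pow d b e) s (t_pow vb ve) I.
Proof.
move=> dlt He HI.
have -> : t_pow vb ve = (1 + t_for ve (t_mul vb + 1).+1).+1 by rewrite /t_pow addn1 addn2 [t_mul vb + 2]addn2.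
have lt60 r x : r < 60 -> 60 <= x -> r != x by lia.
apply: tri_seq; apply: tri_assign.
set s0 := set_reg _ _ _.
pose Inv i s' := [/\ regs s' 61 = i, regs s' d = vb ^ i, smem s' = smem s &
  forall r, r < 60 -> r != d -> regs s' r = regs s r].
apply: (@tri_weaken _ _ _ _ (t_for ve (t_mul vb + 1).+1) _ (Inv ve)) => //; last first.
  by move=> s' [_ h2 h3 h4]; apply: HI.
apply: tri_for => [i s' hi [h1 h2 h3 h4]|i s' hi [h1 h2 h3 h4]|].
- by rewrite h1; have [_ ->] := He _ h4 h3.
- apply: tri_seq; apply: (@tri_mul _ _ _ _ vb (vb ^ i)) => //.
    move=> s1 k1 m1; have [|-> _] := He s1 _ (etrans m1 h3).
      by move=> r r1 r2; rewrite k1 ?lt60 // h4.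
    by split=> //=; rewrite k1 ?lt60.
  move=> s1 k1 m1 E1; apply: tri_assign; split.
  + by rewrite regs_same regs_other ?(lt60 d) 1?eq_sym ?lt60 // k1 // h1.
  + by rewrite regs_other ?lt60 // regs_same /= E1 -expnS.
  + by rewrite /= m1.
  + by move=> r r1 r2; rewrite regs_other ?lt60 // regs_other // k1 ?lt60 // h4.
- split => //.
  + by rewrite regs_other ?lt60 // regs_same.
  + by move=> r r1 r2; rewrite regs_other ?lt60 // regs_other.
Qed.

Lemma tri_ham s (I : state -> Prop) :
  (forall s', keep 50 s s' -> smem s' = smem s ->
    regs s' 51 = hamn (smem s) (regs s 1) (regs s 31) (regs s 43) -> I s') ->
  tri Ham s (t_ham (regs s 1)) I.
Proof.
move=> HI; set m := regs s 1.
have -> : t_ham m = (1 + t_for m 3).+1 by rewrite /t_ham; lia.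
apply: tri_seq; apply: tri_assign.
pose Inv i s' := [/\ regs s' 50 = i,
  regs s' 51 = hamn (smem s) i (regs s 31) (regs s 43), smem s' = smem s &
  keep 50 s s'].
apply: (@tri_weaken _ _ _ _ (t_for m 3) _ (Inv m)) => //; last first.
  by move=> s' [_ h2 h3 h4]; apply: HI.
apply: tri_for => [i s' hi [h1 h2 h3 h4]|i s' hi [h1 h2 h3 h4]|].
- by rewrite h1 /= h4.
- have hS : hamn (smem s) i.+1 (regs s 31) (regs s 43) =
    hamn (smem s) i (regs s 31) (regs s 43) +
    (smem s (regs s 31 + i) != smem s (regs s 43 + i)).
    by rewrite /hamn big_ord_recr.
  have keepi s1 : keep 50 s' s1 -> keep 50 s (incr s1 50).
    by move=> k1; apply: keep_set => //; apply: keep_trans h4 k1.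
  have E31 := h4 31 isT; have E43 := h4 43 isT.
  apply: tri_if => /=; rewrite h1 h3 E31 E43 => c1.
    apply: tri_if => /=; rewrite h1 h3 E31 E43 => c2.
      apply: tri_skip; split => //; last exact: keepi.
        by rewrite regs_same h1.
      rewrite regs_other // h2 hS (_ : _ == _) ?addn0 //.
      by rewrite eqn_leq c1.
    apply: tri_assign; split => //; last by apply: keepi; apply: keep_set.
      by rewrite regs_same regs_other // h1.
    by rewrite regs_other // regs_same /= h2 hS eqn_leq (negbTE c2) andbF addn1.
  apply: (@tri_time _ _ _ _ 1) => //.
  apply: tri_assign; split => //; last by apply: keepi; apply: keep_set.
    by rewrite regs_same regs_other // h1.
  by rewrite regs_other // regs_same /= h2 hS eqn_leq (negbTE c1) addn1.
- split => //; first by rewrite /hamn big_ord0.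
  by apply: keep_set => //; apply: keep_set.
Qed.

Lemma tri_mindist s (I : state -> Prop) :
  (forall s', keep 40 s s' -> smem s' = smem s ->
    (regs s' 41, regs s' 42) =
      amin (fun l => hamn (smem s) (regs s 1) (regs s 31)
             (smem s (regs s 13 + l))) (regs s 1) (regs s 17) -> I s') ->
  tri Mindist s (t_mindist (regs s 1) (regs s 17)) I.
Proof.
set D := fun l => _.
move=> HI; set m := regs s 1; set na := regs s 17.
have -> : t_mindist m na = (1 + (1 + t_for na (1 + (t_ham m + 4).+1).+1).+1).+1.
  rewrite /t_mindist; lia.
apply: tri_seq; apply: tri_assign; apply: tri_seq; apply: tri_assign.
pose Inv i s' := [/\ regs s' 40 = i,
  (regs s' 41, regs s' 42) = amin D m i, smem s' = smem s & keep 40 s s'].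
apply: (@tri_weaken _ _ _ _ (t_for na (1 + (t_ham m + 4).+1).+1) _ (Inv na)) => //; last first.
  by move=> s' [_ h2 h3 h4]; apply: HI.
apply: tri_for => [i s' hi [h1 h2 h3 h4]|i s' hi [h1 h2 h3 h4]|].
- by rewrite h1 /= h4.
- apply: tri_seq; apply: tri_assign.
  set s1 := set_reg _ _ _.
  have k1 : keep 40 s s1 by apply: keep_set.
  have Em : m = regs s1 1 by rewrite k1.
  apply: tri_seq; rewrite Em; apply: tri_ham => s2 k2 m2.
  rewrite k1 // k1 // regs_same /= h1 h3 h4 // -/(D i) => E51.
  have k02 : keep 40 s s2 by apply: keep_trans k1 (keep_le _ k2).
  have E4 r : 40 <= r -> r < 43 -> regs s2 r = regs s' r.
    by move=> r1 r2; rewrite k2 ?regs_other //; lia.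
  case Ea: (amin D m i) h2 => [b a] [E41 E42].
  apply: tri_if => /= [|/negbTE]; rewrite E51 !E4 // E41 addn1 => c1.
    apply: (@tri_time _ _ _ _ (1 + 1).+1) => //.
    apply: tri_seq; apply: tri_assign; apply: tri_assign; split.
    + by rewrite regs_same !regs_other // E4 // h1.
    + rewrite regs_other // regs_other // regs_same regs_other // regs_same /=.
      by rewrite Ea /= c1 E51 /upd /= E4 // h1.
    + by rewrite /= m2.
    + by apply: keep_set => //; do 2 apply: keep_set => //.
  apply: (@tri_time _ _ _ _ 1); first by lia.
  apply: tri_skip; split => //.
  + by rewrite regs_same E4 // h1.
  + by rewrite regs_other // regs_other // !E4 // E41 E42 /= Ea /= c1.
  + by rewrite /= m2.
  + exact: keep_set.
- by split => //; do 3 apply: keep_set => //.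
Qed.

End Programs.

(** * Weighted sampling of input points *)

(* Weights of the three sampling distributions, on pairs (distance to the nearest
   anchor, index of that anchor): uniform on cell [mode <= k], uniform on the far
   points ([mode = k + 1]), proportional to the distance ([mode > k + 1]). *)
Definition wt k Q mode thr (da : nat * nat) : nat :=
  if mode <= k then nat_of_bool (da.2 == mode) else
  if mode <= k + 1 then nat_of_bool (thr <= 6 * (Q * da.1)) else da.1.

Definition Weight :=
  let x2 := Add (Reg 38) (Reg 38) in
  let One := Assign 37 (Const 1) in
  let Zero := Assign 37 (Const 0) in
  Seq (Mul 38 (Reg 4) (Reg 41))
  (If (Leq (Reg 18) (Reg 2))
     (If (Leq (Reg 42) (Reg 18)) (If (Leq (Reg 18) (Reg 42)) One Zero) Zero)
     (If (Leq (Reg 18) (Add (Reg 2) (Const 1)))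
        (If (Leq (Reg 19) (Add x2 (Add x2 x2))) One Zero)
        (Assign 37 (Reg 41)))).

Definition PtWeight := Seq Mindist Weight.

Definition t_pt m na Q := t_mindist m na + t_mul Q + 6.

Definition NextPt := Assign 31 (Add (Reg 31) (Reg 1)).

Definition Total :=
  Seq (Assign 33 (Const 0)) (Seq (Assign 31 (Const 0))
    (For 30 (Reg 0)
       (Seq PtWeight (Seq (Assign 33 (Add (Reg 33) (Reg 37))) NextPt)))).

Definition t_total n m na Q := t_for n (t_pt m na Q + 4) + 4.

Definition Scan :=
  Seq (Assign 32 (Const 0)) (Seq (Assign 31 (Const 0))
  (Seq (Assign 35 (Const 0)) (Seq (Assign 36 (Const 0))
    (For 30 (Reg 0)
       (Seq PtWeight
       (Seq (If (Leq (Reg 32) (Reg 34))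
               (If (Leq (Add (Reg 34) (Const 1)) (Add (Reg 32) (Reg 37)))
                  (Seq (Assign 35 (Reg 31)) (Assign 36 (Reg 41))) Skip) Skip)
       (Seq (Assign 32 (Add (Reg 32) (Reg 37))) NextPt))))))).

Definition t_scan n m na Q := t_for n (t_pt m na Q + 10) + 8.

(** Sampling by inversion: a uniform number below the total weight selects the point whose interval
    of prefix sums contains it. The second pass recomputes the distances instead of storing them. *)
Definition Sampler := Seq Total (Seq (Rand 34 (Reg 33)) Scan).

Definition t_sampler n m na Q := t_total n m na Q + t_scan n m na Q + 3.

Definition dist_s s p : nat * nat :=
  amin (fun l => hamn (smem s) (regs s 1) p (smem s (regs s 13 + l)))
    (regs s 1) (regs s 17).

Definition wgt s p := wt (regs s 2) (regs s 4) (regs s 18) (regs s 19) (dist_s s p).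

Lemma dist_s_keep b s s' p : 18 <= b -> keep b s s' -> smem s' = smem s ->
  dist_s s' p = dist_s s p.
Proof.
move=> bb k1 m1; rewrite /dist_s m1 !k1 //; apply: leq_trans bb; by [].
Qed.

Lemma wgt_keep b s s' p : 20 <= b -> keep b s s' -> smem s' = smem s ->
  wgt s' p = wgt s p.
Proof.
move=> bb k1 m1; rewrite /wgt (@dist_s_keep b s) // ?k1 //; lia.
Qed.

Fixpoint pick (W : nat -> nat) rho n : option nat :=
  if n is n'.+1 then
    let a := \sum_(x < n') W x in
    if a <= rho < a + W n' then Some n' else pick W rho n'
  else None.

Lemma pickP W rho n x : pick W rho n = Some x -> x < n /\ 0 < W x.
Proof.
elim: n => //= n IH; case: ifP => [/andP [h1 h2] [<-]|_ /IH []]; first lia.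
by move=> h1 h2; split => //; apply: ltnW.
Qed.

Lemma eq_pick W W' rho n : W =1 W' -> pick W rho n = pick W' rho n.
Proof.
by move=> E; elim: n => //= n ->; rewrite E; under eq_bigr do rewrite E.
Qed.

Lemma pick_total W rho n : (exists x, pick W rho n = Some x) <-> rho < \sum_(x < n) W x.
Proof.
elim: n => [|n IH] /=; first by rewrite big_ord0; split=> [[]|].
rewrite big_ord_recr /=; move: IH; set a := \sum_(i < n) _ => IH.
case: ifP => h; first by split=> [_|_]; [case/andP: h|exists n].
by rewrite IH; split; lia.
Qed.

(** Each [x] owns an interval of exactly [W x] values of [rho], so a uniform [rho] realizes the
    weights exactly. *)
Lemma sum_pick (R : realType) (W : nat -> nat) n (F : nat -> R) (d : R) :
  (\sum_(rho < \sum_(x < n) W x) oapp F d (pick W rho n) =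
   \sum_(x < n) (W x)%:R * F x)%R.
Proof.
elim: n => [|n IH]; first by rewrite !big_ord0.
rewrite [RHS]big_ord_recr /= -IH.
pose G rho := oapp F d (pick W rho n.+1); rewrite -[LHS]/(\sum_(rho < _) G rho)%R.
have -> : \sum_(x < n.+1) W x = \sum_(x < n) W x + W n by rewrite big_ord_recr.
rewrite big_split_ord /= /G /=; congr (_ + _)%R.
  apply: eq_bigr => i _; case: ifP => // /andP [h1 _].
  by have := ltn_ord i; lia.
rewrite (eq_bigr (fun=> F n)) => [|i _].
  by rewrite sumr_const card_ord mulr_natl.
by rewrite leq_addr ltn_add2l ltn_ord.
Qed.

Section Programs.

Variables (R : realType) (eps : R).

Local Notation tri := (tri eps).
Local Notation J := (J eps).

Lemma tri_weight s (I : state -> Prop) :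
  (forall s', keep 37 s s' -> smem s' = smem s -> regs s' 41 = regs s 41 ->
     regs s' 37 = wt (regs s 2) (regs s 4) (regs s 18) (regs s 19)
                    (regs s 41, regs s 42) -> I s') ->
  tri Weight s (t_mul (regs s 4) + 5) I.
Proof.
move=> HI.
rewrite addnS.
apply: tri_seq; apply: (@tri_mul _ _ _ _ _ _ _ (regs s 41)) => //.
  by move=> s' k1 m1 /=; rewrite !k1.
move=> s1 k1 m1 E1.
have HI' v : v = wt (regs s 2) (regs s 4) (regs s 18) (regs s 19)
                    (regs s 41, regs s 42) -> I (set_reg s1 37 v).
  move=> Ev; apply: HI => //=; last by rewrite /upd /= k1.
  apply: keep_set => // r hr; apply: k1; lia.
rewrite /wt /= in HI'.
apply: tri_if => /=; rewrite !k1 // => c1.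
  rewrite c1 in HI'; apply: tri_if => /=; rewrite !k1 // => c2.
    by apply: tri_if => /=; rewrite !k1 // => c3; apply: tri_assign; apply: HI' => /=;
      rewrite eqn_leq c2 ?c3 ?(negbTE c3).
  apply: (@tri_time _ _ _ _ 1) => //; apply: tri_assign; apply: HI' => /=.
  by rewrite eqn_leq (negbTE c2).
rewrite (negbTE c1) in HI'; apply: tri_if => /=; rewrite !k1 // => c2.
  rewrite c2 in HI'.
  have E6 x : x + x + (x + x + (x + x)) = 6 * x by lia.
  apply: tri_if => /=; rewrite E1 E6 !k1 // => c3;
    by apply: tri_assign; apply: HI'; rewrite ?c3 ?(negbTE c3).
rewrite (negbTE c2) in HI'.
apply: (@tri_time _ _ _ _ 1) => //; apply: tri_assign; apply: HI' => /=.
by rewrite k1.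
Qed.

Lemma tri_pt s (I : state -> Prop) :
  (forall s', keep 37 s s' -> smem s' = smem s ->
     regs s' 41 = (dist_s s (regs s 31)).1 ->
     regs s' 37 = wgt s (regs s 31) -> I s') ->
  tri PtWeight s (t_pt (regs s 1) (regs s 17) (regs s 4)) I.
Proof.
move=> HI.
have -> : t_pt (regs s 1) (regs s 17) (regs s 4) =
  (t_mindist (regs s 1) (regs s 17) + (t_mul (regs s 4) + 5)).+1.
  by rewrite /t_pt; lia.
apply: tri_seq; apply: tri_mindist => s1 k1 m1 E1.
rewrite -(k1 4) //; apply: tri_weight => s2 k2 m2 E41 E37.
have k02 : keep 37 s s2 by apply: keep_trans k2; apply: keep_le k1.
apply: HI => //.
- by rewrite m2.
- by rewrite E41 /dist_s -E1.
- by rewrite E37 E1 !k1.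
Qed.

Lemma tri_total s (I : state -> Prop) :
  (forall s', keep 30 s s' -> smem s' = smem s ->
     regs s' 33 = \sum_(x < regs s 0) wgt s (x * regs s 1) -> I s') ->
  tri Total s (t_total (regs s 0) (regs s 1) (regs s 17) (regs s 4)) I.
Proof.
set n := regs s 0; set m := regs s 1; set na := regs s 17; set Q := regs s 4.
move=> HI.
have -> : t_total n m na Q = (1 + (1 + t_for n (t_pt m na Q + 4)).+1).+1.
  by rewrite /t_total; lia.
apply: tri_seq; apply: tri_assign; apply: tri_seq; apply: tri_assign.
pose Inv i s' := [/\ regs s' 30 = i, regs s' 31 = i * m,
  regs s' 33 = \sum_(x < i) wgt s (x * m), smem s' = smem s & keep 30 s s'].
apply: (@tri_weaken _ _ _ _ (t_for n (t_pt m na Q + 4)) _ (Inv n)) => //; last first.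
  by move=> s' [_ _ h3 h4 h5]; apply: HI.
apply: tri_for => [i s' hi [h1 h2 h3 h4 h5]|i s' hi [h1 h2 h3 h4 h5]|].
- by rewrite h1 /= h5.
- have -> : t_pt m na Q + 4 = (t_pt m na Q + 3).+1 by lia.
  apply: tri_seq; rewrite /m /na /Q -!(h5 1, h5 17, h5 4) //; apply: tri_pt => s1 k1 m1 E41 E37.
  apply: (@tri_seq _ _ _ _ _ 1 1); apply: tri_assign; apply: tri_assign; split.
  + by rewrite /= /upd /= k1 // h1.
  + by rewrite /= /upd /= !k1 // h2 (h5 1) // mulSn addnC.
  + rewrite /= /upd /= k1 // E37 h3 h2 big_ord_recr /=.
    by rewrite (@wgt_keep 30 s).
  + by rewrite /= m1.
  + do 3 apply: keep_set => //; apply: keep_trans h5 _; exact: keep_le k1.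
- by split => //; [rewrite big_ord0|do 3 apply: keep_set => //].
Qed.

Lemma tri_scan s (I : state -> Prop) :
  let pk := pick (fun x => wgt s (x * regs s 1)) (regs s 34) (regs s 0) in
  (forall s', keep 30 s s' -> smem s' = smem s -> regs s' 33 = regs s 33 ->
     regs s' 35 = oapp (muln^~ (regs s 1)) 0 pk ->
     regs s' 36 = oapp (fun x => (dist_s s (x * regs s 1)).1) 0 pk -> I s') ->
  tri Scan s (t_scan (regs s 0) (regs s 1) (regs s 17) (regs s 4)) I.
Proof.
set n := regs s 0; set m := regs s 1; set na := regs s 17; set Q := regs s 4.
set W := fun x => _; set rho := regs s 34; move=> pk HI.
have -> : t_scan n m na Q =
  (1 + (1 + (1 + (1 + t_for n (t_pt m na Q + 10)).+1).+1).+1).+1.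
  by rewrite /t_scan; lia.
do 4 (apply: tri_seq; apply: tri_assign).
pose Inv i s' := [/\ [/\ regs s' 30 = i, regs s' 31 = i * m,
  regs s' 32 = \sum_(x < i) W x, regs s' 33 = regs s 33 &
  regs s' 34 = rho],
  regs s' 35 = oapp (muln^~ m) 0 (pick W rho i),
  regs s' 36 = oapp (fun x => (dist_s s (x * m)).1) 0 (pick W rho i),
  smem s' = smem s & keep 30 s s'].
apply: (@tri_weaken _ _ _ _ (t_for n (t_pt m na Q + 10)) _ (Inv n)) => //; last first.
  by move=> s' [[_ _ _ h1 _] h2 h3 h4 h5]; apply: HI.
apply: tri_for => [i s' hi [[h1 _ _ _ _] _ _ _ h5]||].
- by rewrite h1 /= h5.
- move=> i s' hi [[h30 h31 h32 h33 h34] h35 h36 h4 h5].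
  have -> : t_pt m na Q + 10 = (t_pt m na Q + 9).+1 by lia.
  apply: tri_seq; rewrite /m /na /Q -!(h5 1, h5 17, h5 4) //; apply: tri_pt => s1 k1 m1 E41 E37.
  have EW : regs s1 37 = W i by rewrite E37 h31 (@wgt_keep 30 s).
  have ED : regs s1 41 = (dist_s s (i * m)).1.
    by rewrite E41 h31 (@dist_s_keep 30 s).
  have k30 : keep 30 s s1 by apply: keep_trans h5 (keep_le _ k1).
  apply: (@tri_time _ _ _ _ (5 + (1 + 1).+1).+1) => //.
  pose upds s2 := [/\ [/\ regs s2 30 = i, regs s2 31 = i * m,
    regs s2 32 = \sum_(x < i) W x, regs s2 33 = regs s 33 &
    regs s2 34 = rho], regs s2 37 = W i,
    regs s2 35 = oapp (muln^~ m) 0 (pick W rho i.+1) /\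
    regs s2 36 = oapp (fun x => (dist_s s (x * m)).1) 0 (pick W rho i.+1),
    smem s2 = smem s & keep 30 s s2].
  apply: tri_seq; apply: (@tri_weaken _ _ _ _ 5 _ upds) => // [|s2].
    apply: tri_if => /=; rewrite !k1 // h32 h34 => c1.
      apply: tri_if => /=; rewrite EW !k1 // h32 h34 addn1 => c2.
        apply: (@tri_time _ _ _ _ (1 + 1).+1) => //.
        apply: tri_seq; apply: tri_assign; apply: tri_assign.
        split; rewrite /= ?m1 //.
        - by split; rewrite /upd /= k1.
        - by rewrite c1 c2 /upd /= k1 // h31 ED.
        - by do 2 apply: keep_set => //.
      apply: (@tri_time _ _ _ _ 1) => //; apply: tri_skip.
      split; rewrite /= ?m1 //; first by split; rewrite k1.
      by rewrite c1 (negbTE c2) !k1.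
    apply: (@tri_time _ _ _ _ 1) => //; apply: tri_skip.
    split; rewrite /= ?m1 //; first by split; rewrite k1.
    by rewrite (negbTE c1) !k1.
  move=> [[g30 g31 g32 g33 g34] g37 [g35 g36] g4 g5].
  apply: tri_seq; apply: tri_assign; apply: tri_assign.
  split => //; first split; rewrite /= /upd /= ?g30 ?g31 ?g32 ?g33 ?g34 ?g37 ?(g5 1) //.
  + by rewrite mulSn addnC.
  + by rewrite big_ord_recr.
  + by do 3 apply: keep_set => //.
- split => //; first split => //; first by rewrite big_ord0.
  by do 5 apply: keep_set => //.
Qed.

(** If all weights vanish, [Rand] yields 0, no interval contains it and the result is the default
    address 0; hence the case distinction in the expected value. *)
Lemma J_sampler s (I : state -> Prop) (f : state -> R) (g : nat -> R) :
  let n := regs s 0 in let m := regs s 1 in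
  let tot := \sum_(x < n) wgt s (x * m) in
  (forall s, 0 <= f s)%R ->
  (forall s', keep 30 s s' -> smem s' = smem s -> regs s' 33 = tot ->
     (tot = 0 /\ regs s' 35 = 0 /\ regs s' 36 = 0) \/
     (exists2 x, x < n & [/\ 0 < wgt s (x * m), regs s' 35 = x * m &
        regs s' 36 = (dist_s s (x * m)).1]) ->
     I s' /\ (g (regs s' 35) <= f s')%R) ->
  J Sampler s (t_sampler n m (regs s 17) (regs s 4)) I f
    (if tot == 0 then g 0 else
      (\sum_(x < n) (wgt s (x * m))%:R * g (x * m)%N) / tot%:R)%R.
Proof.
move=> n m tot f0 HI.
set na := regs s 17; set Q := regs s 4; set v := (if _ then _ else _).
have -> : t_sampler n m na Q = (t_total n m na Q + (1 + t_scan n m na Q).+1).+1.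
  by rewrite /t_sampler; lia.
set I1 := fun s' => [/\ keep 30 s s', smem s' = smem s & regs s' 33 = tot].
apply: (@J_seq _ _ _ _ _ _ _ I1 _ (fun=> v)) => //.
  by apply: tri_J => //; apply: tri_total => s1 k1 m1 E33.
move=> s1 [k1 m1 E33].
set W := fun x => wgt s (x * m).
pose I2 s' := exists2 rho, s' = set_reg s1 34 rho & rho < maxn 1 tot.
apply: (@J_seq _ _ _ _ _ _ _ I2 _
  (fun s' => oapp (fun x => g (x * m)%N) (g 0) (pick W (regs s' 34) n))) => //.
  apply: J_rand => [x|/=]; first by rewrite /= E33; exists x.
  rewrite E33 /v; have [E|tn0] := eqVneq tot 0.
    have -> : maxn 1 tot = 1 by rewrite E.
    rewrite big_ord1 /= /upd /= divr1.
    case Ep: (pick W 0 n) => [x|//].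
    have := pick_total W 0 n; rewrite -/tot E => -[h _].
    by have : 0 < 0 by apply: h; exists x.
  have -> : maxn 1 tot = tot by rewrite (maxn_idPr _) // lt0n.
  by rewrite -(sum_pick W n (fun x => g (x * m)%N) (g 0)).
move=> _ [rho -> rho_lt].
have kk : keep 30 s (set_reg s1 34 rho) by apply: keep_set.
have EW : forall p, wgt (set_reg s1 34 rho) p = wgt s p.
  by move=> p; apply: (@wgt_keep 30).
have ED : forall p, dist_s (set_reg s1 34 rho) p = dist_s s p.
  by move=> p; apply: (@dist_s_keep 30).
have Epk : pick (fun x => wgt (set_reg s1 34 rho) (x * m)) rho n = pick W rho n.
  by apply: eq_pick => x; rewrite EW.
suff HI2 : forall s', keep 30 s s' -> smem s' = smem s -> regs s' 33 = tot ->
   regs s' 35 = oapp (muln^~ m) 0 (pick W rho n) ->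
   regs s' 36 = oapp (fun x => (dist_s s (x * m)).1) 0 (pick W rho n) ->
   I s' /\ (oapp (fun x => g (x * m)%N) (g 0) (pick W rho n) <= f s')%R.
  suff H : tri Scan (set_reg s1 34 rho) (t_scan n m na Q)
     (fun s' => I s' /\ (oapp (fun x => g (x * m)%N) (g 0) (pick W rho n) <= f s')%R).
    have HJ := tri_J H (fun s' (h : _ /\ (_ <= f s')%R) => h.2).
    by rewrite regs_same; apply: (J_conseq HJ) => // s' [].
  rewrite /n /m /na /Q -!(kk 0, kk 1, kk 4, kk 17) //.
  apply: tri_scan => s2 k2 m2; rewrite !(kk 0, kk 1) // -/m -/n regs_same Epk.
  rewrite /= {1}/upd /= E33 => E33' E35 E36.
  apply: HI2 => //; first exact: keep_trans k2.
  - by rewrite m2.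
  - by rewrite E36; case: (pick _ _ _) => //= x; rewrite ED.
move=> s' k' m' E33' E35 E36.
have [|Is] := HI s' k' m' E33'; last first.
  by move=> h; split => //; apply: le_trans h; rewrite E35; case: (pick _ _ _).
case Epp: (pick W rho n) E35 E36 => [x|] /= E35 E36.
  by right; have [hx wx] := pickP Epp; exists x.
left; split => //.
have [//|t0] := posnP tot.
have := pick_total W rho n; rewrite -/tot Epp => -[_ []] //.
by move: rho_lt; lia.
Qed.

End Programs.

(** * Metric structure of a near-optimal clustering *)

Section Metric.

Variables (T : finType) (X : {set T}) (d : T -> T -> nat).
Hypothesis dC : forall x y, d x y = d y x.
Hypothesis d_tri : forall x y z, d x z <= d x y + d y z.

Variables (k : nat) (c : 'I_k -> T) (jx : T -> 'I_k).

Let cst x := d x (c (jx x)).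
Let opt := \sum_(x in X) cst x.

Lemma sum_cluster (F : T -> nat) :
  \sum_(x in X) F x = \sum_j \sum_(x in X | jx x == j) F x.
Proof. exact: (partition_big jx predT). Qed.

(** * Seeding by distance-proportional sampling *)

Section Seeding.

(** The uncovered clusters in the sense of the analysis of k-means++. *)
Definition badj (dA : T -> nat) : {set 'I_k} :=
  [set j | 9 * \sum_(x in X | jx x == j) cst x < \sum_(x in X | jx x == j) dA x].

Lemma badj_sub dA dA' : (forall x, x \in X -> dA' x <= dA x) ->
  badj dA' \subset badj dA.
Proof.
move=> le; apply/subsetP => j; rewrite !inE => /leq_trans; apply.
by apply: leq_sum => x /andP [? _]; apply: le.
Qed.

(** Covered clusters account for at most [9 opt], less than half of the total distance, so uncovered
    ones carry at least half of it. Within an uncovered cluster the points near the center carry at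
    least a third, and each of them as an anchor covers the cluster; this gives [1 / 6]. *)
Lemma seeding_step (dA : T -> nat) :
  (forall x y, dA x <= d x y + dA y) ->
  18 * opt < \sum_(x in X) dA x ->
  exists2 Z : {set T}, \sum_(x in X) dA x <= 6 * \sum_(z in X | z \in Z) dA z &
    forall z dA', z \in X -> z \in Z ->
      (forall x, x \in X -> dA' x <= dA x /\ dA' x <= d x z) ->
      #|badj dA'| < #|badj dA|.
Proof.
move=> lip hW.
pose S j := \sum_(x in X | jx x == j) cst x.
pose nn j := \sum_(x in X | jx x == j) 1.
pose Td j := \sum_(x in X | jx x == j) dA x.
(* Points within twice the average cost of their cluster: by Markov at least half of it, and such an
   anchor leaves its cluster at distance at most [S + 2 S]. *)
pose core x := nn (jx x) * cst x <= 2 * S (jx x).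
exists [set z | (jx z \in badj dA) && core z]; last first.
  move=> z dA' zX; rewrite inE => /andP [bz cz] le.
  apply: proper_card; apply/properP; split.
    by apply: badj_sub => x /le [].
  exists (jx z) => //; rewrite inE -leqNgt -/(S _).
  apply: (@leq_trans (3 * S (jx z))); last by rewrite leq_mul2r orbT.
  apply: (@leq_trans (\sum_(x in X | jx x == jx z) (cst x + cst z))).
    apply: leq_sum => x /andP [xX /eqP E]; have [_ h] := le x xX.
    apply: leq_trans h _; apply: leq_trans (d_tri x (c (jx x)) z) _.
    by rewrite leq_add2l E dC.
  rewrite big_split /= -/(S _).
  have -> : \sum_(x in X | jx x == jx z) cst z = nn (jx z) * cst z.
    by rewrite /nn big_distrl /=; apply: eq_bigr => x _; rewrite mul1n.
  by move: cz; rewrite /core; lia.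
have EW : \sum_(x in X) dA x = \sum_j Td j by exact: sum_cluster.
have EO : opt = \sum_j S j by exact: sum_cluster.
have good_le : \sum_(j | j \notin badj dA) Td j <= 9 * opt.
  rewrite EO big_distrr /= [X in _ <= X](bigID (fun j => j \in badj dA)) /=.
  apply: leq_trans (leq_addl _ _); apply: leq_sum => j.
  by rewrite inE -leqNgt.
have half : \sum_j Td j <= 2 * \sum_(j in badj dA) Td j.
  rewrite (bigID (fun j => j \in badj dA)) /=.
  move: hW; rewrite EW (bigID (fun j => j \in badj dA)) /=.
  move: good_le; set a := \sum_(j | j \notin _) _; set b := \sum_(j in _) _.
  by lia.
rewrite EW; apply: leq_trans half _.
have -> : \sum_(z in X | z \in [set z | (jx z \in badj dA) && core z]) dA z =
    \sum_(j in badj dA) \sum_(z in X | (jx z == j) && core z) dA z.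
  under eq_bigl do rewrite inE.
  rewrite (partition_big jx (fun j => j \in badj dA)) => [|z /and3P []//].
  apply: eq_bigr => j jb; apply: eq_bigl => z.
  case: eqP => [->|]; last by rewrite !andbF.
  by rewrite jb andbT.
rewrite -[6]/(2 * 3) -mulnA leq_mul2l /= big_distrr /=.
apply: leq_sum => j; rewrite inE -/(S j) -/(Td j) => jb.
set De := dA (c j).
have T_le : Td j <= nn j * De + S j.
  rewrite /Td /nn /S big_distrl /= -big_split /=.
  apply: leq_sum => x /andP [_ /eqP E]; rewrite mul1n addnC /cst E; exact: lip.
have lo : 8 * S j < nn j * De by lia.
have n0 : 0 < nn j by case: (nn j) lo.
set cN := \sum_(z in X | (jx z == j) && core z) 1.
have cN_ge : nn j <= 2 * cN.
  pose f := \sum_(z in X | (jx z == j) && ~~ core z) 1.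
  have En : nn j = cN + f.
    rewrite /nn (bigID core) /=; congr (_ + _);
    by apply: eq_bigl => x; rewrite andbA.
  have : f * (2 * S j).+1 <= nn j * S j.
    have -> : nn j * S j = \sum_(x in X | jx x == j) nn j * cst x.
      by rewrite /S big_distrr.
    rewrite /f big_distrl /= [X in _ <= X](bigID core) /=; apply: leq_trans (leq_addl _ _).
    rewrite [X in _ <= X](eq_bigl (fun z => (z \in X) && ((jx z == j) && ~~ core z))).
      apply: leq_sum => x /and3P [_ /eqP E]; rewrite /core E mul1n -ltnNge.
      by [].
    by move=> x; rewrite andbA.
  by nia.
have core_ge : cN * (nn j * De - 2 * S j) <=
    nn j * \sum_(z in X | (jx z == j) && core z) dA z.
  rewrite /cN [X in X <= _]big_distrl [X in _ <= X]big_distrr /=; apply: leq_sum => z /and3P [_ /eqP E].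
  rewrite /core E mul1n => h.
  have := lip (c j) z; rewrite -/De dC => h1.
  have h2 : nn j * De <= nn j * (d z (c j) + dA z) by rewrite leq_mul2l h1 orbT.
  by move: h2 h; rewrite mulnDr /cst E; lia.
set sc := \sum_(z in X | _) dA z in core_ge *.
have h3 : nn j * (nn j * De - 2 * S j) <= 2 * (nn j * sc).
  apply: (@leq_trans (2 * cN * (nn j * De - 2 * S j))).
    by rewrite leq_mul2r cN_ge orbT.
  by rewrite -mulnA leq_mul2l.
have h4 : nn j * De - 2 * S j <= 2 * sc.
  by rewrite -(leq_pmul2l n0) mulnCA.
(* With [T_le] the claim [Td <= 3 sc] follows from [nn De + S <= 3 / 2 (nn De - 2 S)], that is from
   [8 S <= nn De]: this is the origin of the 9 in [badj]. *)
lia.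
Qed.

End Seeding.

(** * Reassignment of minor points within the cells of the anchors *)

Section Structure.

Variables (q Q : nat) (a : 'I_q.+1 -> T) (cell : T -> 'I_q.+1) (j0 : 'I_k).
Let dA x := d x (a (cell x)).
Hypothesis dA_min : forall x l, x \in X -> dA x <= d x (a l).
Hypothesis Q0 : 0 < Q.
Let W := \sum_(x in X) dA x.
Hypothesis W_le : W <= 18 * opt.

Let k0 : 0 < k. Proof. by case: j0 => i; apply: leq_ltn_trans. Qed.

Definition dcA j := d (c j) (a [arg min_(l < ord0) d (c j) (a l)]).

Lemma dcA_le j l : dcA j <= d (c j) (a l).
Proof. by rewrite /dcA; case: arg_minnP => // i _; apply. Qed.

Definition cellsz l := \sum_(x in X | cell x == l) 1.
Definition piece l j := \sum_(x in X | (cell x == l) && (jx x == j)) 1.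
Definition major l j := cellsz l <= Q * k ^ 2 * piece l j.
Definition dom l := [arg max_(j > j0) piece l j].
(** A minor point outside has [2 dA x < dcA j <= cst x + dA x], hence [dA x < cst x]: going to its
    anchor costs no more than going to its center, so it can be moved freely. *)
Definition farset j x := [&& jx x == j, ~~ major (cell x) j & dcA j <= 2 * dA x].
Definition farsz j := \sum_(x in X | farset j x) 1.
(** Moving a far point costs up to [dcA j] extra. The points stay when this would total more than a
    [1 / Q] fraction of [opt / k] plus their own cost; otherwise the loss, summed over the [k]
    clusters, is at most [2 opt / Q]. *)
Definition kept j :=
  opt + k * \sum_(x in X | farset j x) cst x < k * Q * (dcA j * farsz j).
Definition far x := farset (jx x) x && kept (jx x).
Definition newj x := if far x || major (cell x) (jx x) then jx x else dom (cell x).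

Lemma cellsz_sum l : cellsz l = \sum_j piece l j.
Proof.
rewrite /cellsz (partition_big jx predT) //=; apply: eq_bigr => j _.
by apply: eq_bigl => x; rewrite andbA.
Qed.

Lemma cellsz_dom l : cellsz l <= k * piece l (dom l).
Proof.
rewrite cellsz_sum /dom; case: arg_maxnP => // i _ hi.
rewrite -[k in k * _]card_ord -sum_nat_const; apply: leq_sum => j _; exact: hi.
Qed.

Lemma major_dom l : major l (dom l).
Proof.
rewrite /major; apply: leq_trans (cellsz_dom l) _.
rewrite leq_mul2r; apply/orP; right.
by rewrite -mulnn mulnA; apply: leq_pmull; rewrite muln_gt0 Q0 k0.
Qed.

Let moved x := ~~ (far x || major (cell x) (jx x)).
Let e l := d (a l) (c (dom l)).
Let extra x := if farset (jx x) x && ~~ kept (jx x) then dcA (jx x) else 0.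

(** A moved point travels via its anchor to the dominating center, at cost [dA x + e]. Here
    [dA x <= cst x] for a point outside [farset], and otherwise [dA x <= cst x + dcA] by the route
    through its own center. *)
Lemma newj_dist x : x \in X ->
  d x (c (newj x)) <= cst x + (if moved x then e (cell x) + extra x else 0).
Proof.
move=> xX; rewrite /newj /moved; case: ifP => [_|/negbT hm] /=; first by rewrite addn0.
have h1 := d_tri x (a (cell x)) (c (dom (cell x))).
have h2 := d_tri (c (jx x)) x (a (cell x)).
have h3 := d_tri x (c (jx x)) (a [arg min_(l < ord0) d (c (jx x)) (a l)]).
have h4 := dA_min [arg min_(l < ord0) d (c (jx x)) (a l)] xX.
have h5 := dcA_le (jx x) (cell x).
rewrite -/(dA x) in h1 h2; rewrite -/(dcA _) in h3; rewrite -/(cst x) in h3.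
rewrite (dC _ x) -/(cst x) in h2.
apply: leq_trans h1 _; rewrite -/(e _) addnA [cst x + _]addnC -addnA [dA x + _]addnC leq_add2l.
move: hm; rewrite negb_or /far /extra => /andP [hf hm].
case hfs: (farset _ x) hf => /= hk; rewrite ?hk.
  exact: leq_trans h4 h3.
move: hfs; rewrite /farset eqxx hm /= => /negbT; rewrite -ltnNge addn0; lia.
Qed.

(** The at most [k] minor clusters of a cell make up at most a [1 / (Q k)] fraction of it, the
    dominating piece at least [1 / k]. So [Q] times the moved points are no more than that piece,
    and each point [x] of the piece can be charged [e l <= dA x + cst x]. *)
Lemma moved_sum : Q * \sum_(x in X | moved x) e (cell x) <= W + opt.
Proof.
rewrite (partition_big cell predT) //= big_distrr /=.
pose pc l := \sum_(x in X | (cell x == l) && (jx x == dom l)) (dA x + cst x).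
apply: (@leq_trans (\sum_l pc l)).
  apply: leq_sum => l _.
  set mv := \sum_(x in X | moved x && (cell x == l)) 1.
  have -> : \sum_(x | (x \in X) && moved x && (cell x == l)) e (cell x) = mv * e l.
    rewrite /mv big_distrl /=; apply: eq_big => [x|x /andP [_ /eqP ->]].
      by rewrite andbA.
    by rewrite mul1n.
  have mv_le : mv <= \sum_(j | ~~ major l j) piece l j.
    rewrite /mv (partition_big jx (fun j => ~~ major l j)); last first.
      by move=> x /and3P [_ + /eqP <-]; rewrite /moved negb_or => /andP [].
    apply: leq_sum => j _; rewrite /piece [X in _ <= X](bigID moved) /=.
    apply: leq_trans (leq_addr _ _).
    rewrite [X in _ <= X](eq_bigl (fun x => (x \in X) && (moved x && (cell x == l)) && (jx x == j))) //.
    by move=> x; case: (x \in X); case: (cell x == l); case: (jx x == j); case: (moved x).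
  have mv_le2 : Q * k ^ 2 * mv <= k * cellsz l.
    apply: (@leq_trans (\sum_(j | ~~ major l j) cellsz l)).
      apply: leq_trans (leq_mul (leqnn _) mv_le) _.
      rewrite big_distrr /=; apply: leq_sum => j; rewrite /major -ltnNge.
      exact: ltnW.
    rewrite sum_nat_const leq_mul2r; apply/orP; right.
    by rewrite -[k in _ <= k]card_ord max_card.
  have mv_le3 : Q * mv <= piece l (dom l).
    have k2 : 0 < k ^ 2 by rewrite expn_gt0 k0.
    rewrite -(leq_pmul2l k2); apply: leq_trans (_ : k * (k * piece l (dom l)) <= _).
      rewrite mulnA [k ^ 2 * Q]mulnC; apply: leq_trans mv_le2 _.
      by rewrite leq_mul2l cellsz_dom orbT.
    by rewrite mulnA.
  rewrite mulnA; apply: leq_trans (leq_mul mv_le3 (leqnn _)) _.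
  rewrite /piece /pc big_distrl /=; apply: leq_sum => x /and3P [_ /eqP El /eqP Ej].
  by have := d_tri (a l) x (c (dom l)); rewrite (dC (a l) x) mul1n /e /cst /dA El Ej.
rewrite /W /opt -big_split /= [X in _ <= X](partition_big cell predT) //=.
apply: leq_sum => l _; rewrite /pc [X in _ <= X](bigID (fun x => jx x == dom l)) /=.
apply: leq_trans (leq_addr _ _); rewrite [X in _ <= X](eq_bigl (fun x =>
  (x \in X) && ((cell x == l) && (jx x == dom l)))) // => x.
by rewrite andbA.
Qed.

Lemma extra_sum : Q * \sum_(x in X) extra x <= 2 * opt.
Proof.
have h j : k * (Q * \sum_(x in X | jx x == j) extra x) <=
    opt + k * \sum_(x in X | jx x == j) cst x.
  have -> : \sum_(x in X | jx x == j) extra x = if kept j then 0 else dcA j * farsz j.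
    case hk: (kept j).
      by rewrite big1 // => x /andP [_ /eqP E]; rewrite /extra E hk andbF.
    rewrite /farsz big_distrr /= [LHS](bigID (farset j)) /= [X in _ + X]big1 ?addn0.
      apply: eq_big => [x|x /andP [/andP [_ /eqP E] hf]].
        by rewrite /farset; case: (x \in X); case: (jx x == j).
      by rewrite /extra E hf hk muln1.
    by move=> x /andP [/andP [_ /eqP E] /negbTE hf]; rewrite /extra E hf.
  case: ifP => [_|/negbT]; first by rewrite !muln0.
  rewrite /kept -leqNgt => hk; rewrite mulnA; apply: leq_trans hk _.
  rewrite leq_add2l leq_mul2l; apply/orP; right.
  rewrite [X in _ <= X](bigID (farset j)) /=; apply: leq_trans (leq_addr _ _).
  rewrite [X in _ <= X](eq_bigl (fun x => (x \in X) && farset j x)) // => x.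
  by rewrite /farset; case: (x \in X); case: (jx x == j).
rewrite -(leq_pmul2l k0) sum_cluster.
rewrite [Q * _]big_distrr [X in X <= _]big_distrr /=.
apply: (@leq_trans (\sum_j (opt + k * \sum_(x in X | jx x == j) cst x))).
  by apply: leq_sum => j _; exact: h.
rewrite big_split /= -big_distrr /= -sum_cluster sum_nat_const card_ord -/opt.
by rewrite mul2n addnn mulnC; lia.
Qed.

Lemma newj_cost : Q * \sum_(x in X) d x (c (newj x)) <= (Q + 21) * opt.
Proof.
(* The constant is [21 = 18 + 1 + 2]: [W <= 18 opt], one more [opt] from [moved_sum], two from
   [extra_sum]. *)
apply: (@leq_trans (Q * opt + (W + opt) + 2 * opt)); last by lia.
apply: leq_trans (leq_add (leq_add (leqnn (Q * opt)) moved_sum) extra_sum).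
rewrite -!mulnDr leq_mul2l; apply/orP; right.
rewrite [X in _ + X + _]big_mkcondr /= /opt -!big_split /=; apply: leq_sum => x xX.
apply: leq_trans (newj_dist xX) _; rewrite -addnA leq_add2l.
by case: (moved x).
Qed.

(** Points of a major piece are never far and never moved, so the group contains the whole piece of
    a major cluster; the dominating cluster is itself major. *)
Lemma near_group x : x \in X -> ~~ far x ->
  cellsz (cell x) <= Q * k ^ 2 *
    \sum_(y in X | [&& ~~ far y, cell y == cell x & newj y == newj x]) 1.
Proof.
move=> xX hx.
have key l j : major l j -> cellsz l <= Q * k ^ 2 *
    \sum_(y in X | [&& ~~ far y, cell y == l & newj y == j]) 1.
  move=> mj; apply: leq_trans (mj) _; rewrite leq_mul2l; apply/orP; right.
  rewrite /piece [X in _ <= X](bigID (fun y => jx y == j)) /=.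
  apply: leq_trans (leq_addr _ _).
  rewrite [X in _ <= X](eq_bigl (fun x => (x \in X) && ((cell x == l) && (jx x == j)))) // => y.
  case: (y \in X) => //=; case: (cell y =P l) => [El|]; rewrite ?andbF //=.
  case: (jx y =P j) => [Ej|]; rewrite ?andbF //= ?andbT.
  have mj' : major (cell y) (jx y) by rewrite El Ej.
  have fy : far y = false by rewrite /far /farset mj' /= andbF.
  by rewrite /newj fy mj' /= Ej eqxx.
rewrite {2}/newj (negbTE hx) /=; case: ifP => [mj|_]; first exact: key.
exact: key (major_dom _).
Qed.

Lemma far_gt0 x : far x -> 0 < dA x.
Proof.
case/andP => /and3P [_ _ h]; rewrite /kept => h2.
have : 0 < dcA (jx x) by case: (dcA _) h2 => //; rewrite mul0n muln0.
by move: h; case: (dA x) => //; rewrite muln0; case: (dcA _).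
Qed.

(** Write [D = dcA j], [h = farsz j]. Being kept gives [opt < k Q D h]. A threshold comparable to
    [D] defines a set that contains the far points and, by Markov, is not much larger; and the
    points at such a distance carry a fair share of [W], since they include half of the far
    points. *)
Lemma far_group j : (exists2 x, x \in X & far x && (newj x == j)) ->
  exists2 Z : {set T}, W <= 72 * Q * k * \sum_(z in X | z \in Z) dA z &
  forall z, z \in X -> z \in Z ->
    (forall x, x \in X -> far x && (newj x == j) -> dA z <= 6 * (Q * dA x)) /\
    \sum_(x in X | dA z <= 6 * (Q * dA x)) 1 <=
      216 * Q ^ 2 * k * \sum_(x in X | far x && (newj x == j)) 1.
Proof.
move=> [x0 x0X /andP [f0 /eqP n0]].
have Ej0 : jx x0 = j by rewrite -n0 /newj f0.
have kj : kept j by move: f0; rewrite /far Ej0 => /andP [].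
have farE x : far x && (newj x == j) = farset j x.
  apply/andP/idP => [[fx /eqP nx]|fx].
    have Ejx : jx x = j by rewrite -nx /newj fx.
    by move: fx; rewrite /far Ejx => /andP [].
  have Ejx : jx x = j by move: fx => /and3P [/eqP].
  have fx' : far x by rewrite /far Ejx fx.
  by rewrite fx' /newj fx' Ejx.
have hs : \sum_(x in X | far x && (newj x == j)) 1 = farsz j.
  by apply: eq_bigl => x; rewrite farE.
rewrite hs; set D := dcA j; set h := farsz j.
have kj' : opt + k * \sum_(x in X | farset j x) cst x < k * Q * (D * h) by [].
have D0 : 0 < D by case: D kj' => // ; rewrite mul0n muln0.
(* The upper end keeps every far point, as [D <= 2 dA x], in the set cut out by [z]. The lower end
   bounds that set: its size [b] satisfies [b D <= 2 b dA z <= 12 Q W <= 216 Q opt]. *)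
exists [set z | (D <= 2 * dA z) && (dA z <= 3 * Q * D)]; last first.
  move=> z zX; rewrite inE => /andP [z1 z2]; split.
    move=> x xX; rewrite farE => /and3P [_ _ fx].
    apply: leq_trans z2 _; rewrite -/D in fx.
    by rewrite -[6]/(3 * 2) -!mulnA leq_mul2l /= mulnCA leq_mul2l fx orbT.
  set b := \sum_(x in X | _) 1.
  have hb : b * dA z <= 6 * (Q * W).
    rewrite /b /W big_distrl !big_distrr /= [X in _ <= X](bigID (fun x => dA z <= 6 * (Q * dA x))) /=.
    apply: leq_trans (leq_addr _ _); apply: leq_sum => x /andP [_]; by rewrite mul1n.
  rewrite -(leq_pmul2r D0).
  apply: (@leq_trans (b * (2 * dA z))); first by rewrite leq_mul2l z1 orbT.
  apply: (@leq_trans (216 * Q * opt)).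
    rewrite mulnCA; apply: leq_trans (leq_mul (leqnn 2) hb) _.
    apply: (@leq_trans (2 * (6 * (Q * (18 * opt))))); last by lia.
    by rewrite !leq_mul2l W_le !orbT.
  apply: (@leq_trans (216 * Q * (k * Q * (D * h)))).
    by rewrite leq_mul2l; apply/orP; right; lia.
  by rewrite (_ : _ * _ = 216 * Q ^ 2 * k * h * D) //; ring.
pose nr := \sum_(x in X | farset j x && (dA x <= 3 * Q * D)) 1.
pose fr := \sum_(x in X | farset j x && ~~ (dA x <= 3 * Q * D)) 1.
have Eh : h = nr + fr.
  by rewrite /h /farsz (bigID (fun x => dA x <= 3 * Q * D)) /=; congr (_ + _);
     apply: eq_bigl => x; rewrite andbA.
have fr_le : fr * ((3 * Q - 1) * D) <= \sum_(x in X | farset j x) cst x.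
  rewrite [X in _ <= X](bigID (fun x => ~~ (dA x <= 3 * Q * D))) /=.
  apply: leq_trans (leq_addr _ _); rewrite /fr big_distrl /=.
  rewrite [X in _ <= X](eq_bigl (fun x => (x \in X) && (farset j x && ~~ (dA x <= 3 * Q * D)))).
    apply: leq_sum => x /and3P [xX fx]; rewrite -ltnNge mul1n => hx.
    have Ejx : jx x = j by move: fx => /and3P [/eqP].
    have h3 := d_tri x (c (jx x)) (a [arg min_(l < ord0) d (c (jx x)) (a l)]).
    have h4 := dA_min [arg min_(l < ord0) d (c (jx x)) (a l)] xX.
    rewrite -/(dcA _) -/(cst x) Ejx -/D in h3; rewrite Ejx in h4.
    by rewrite mulnBl mul1n; lia.
  by move=> x; rewrite andbA.
(* Beyond distance [3 Q D] a far point costs at least [(3 Q - 1) D >= 2 Q D] in its own cluster, so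
   the condition in [kept] allows fewer than half of them there. *)
have nr_ge : h <= 2 * nr.
  rewrite Eh; have : k * (fr * ((3 * Q - 1) * D)) < k * (Q * (D * h)).
    apply: leq_ltn_trans (leq_mul (leqnn k) fr_le) _.
    by rewrite mulnA; apply: leq_ltn_trans kj'; rewrite leq_addl.
  rewrite ltn_mul2l k0 /= mulnA [Q * _]mulnCA [X in _ < X]mulnC ltn_mul2r D0 /= Eh.
  have : fr * Q * 2 <= fr * (3 * Q - 1) by rewrite -mulnA leq_mul2l; apply/orP; right; lia.
  move: Q0; nia.
have nr_sum : nr * D <= 2 * \sum_(z in X | z \in [set z | (D <= 2 * dA z) && (dA z <= 3 * Q * D)]) dA z.
  rewrite /nr big_distrl big_distrr /=.
  rewrite [X in _ <= X](bigID (farset j)) /=; apply: leq_trans (leq_addr _ _).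
  rewrite [X in _ <= X](eq_bigl (fun x => (x \in X) && (farset j x && (dA x <= 3 * Q * D)))).
    by apply: leq_sum => x /and3P [_ /and3P [_ _ fx] _]; rewrite mul1n.
  move=> x; rewrite inE; case fx: (farset j x); rewrite ?andbF ?andbT //=.
  by move: fx => /and3P [_ _ ->].
set sz := \sum_(z in X | _) _ in nr_sum *.
apply: leq_trans W_le _.
apply: (@leq_trans (18 * (k * Q * (D * h)))).
  by rewrite leq_mul2l /=; lia.
have : D * h <= 4 * sz.
  apply: (@leq_trans (D * (2 * nr))); first by rewrite leq_mul2l nr_ge orbT.
  by lia.
move=> hh; apply: (@leq_trans (18 * (k * Q * (4 * sz)))).
  by rewrite !leq_mul2l hh !orbT.
by rewrite (_ : 18 * _ = 72 * Q * k * sz) //; ring.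
Qed.

End Structure.

End Metric.

Local Open Scope ring_scope.

(** * Choosing the centers from samples *)

Section Expectation.

Variables (R : realFieldType) (T : finType).

Definition avg (S : {set T}) (f : T -> R) := (\sum_(x in S) f x) / #|S|%:R.

Fixpoint Ex (Ss : seq {set T}) (F : seq T -> R) : R :=
  if Ss is B :: Ss' then avg B (fun x => Ex Ss' (fun ys => F (x :: ys)))
  else F [::].

Implicit Types (S : {set T}) (f g : T -> R) (F G : seq T -> R).

Lemma ler_avgS S f g : (forall x, x \in S -> f x <= g x) -> avg S f <= avg S g.
Proof.
by move=> fg; rewrite /avg ler_wpM2r ?invr_ge0 ?ler0n // ler_sum.
Qed.

Lemma avg_const S a : S != set0 -> avg S (fun=> a) = a.
Proof.
move=> S0; rewrite /avg sumr_const -[a *+ _]mulr_natr mulfK //.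
by rewrite pnatr_eq0 cards_eq0.
Qed.

Lemma avgD S f g : avg S (fun x => f x + g x) = avg S f + avg S g.
Proof. by rewrite /avg big_split mulrDl. Qed.

Lemma avgZ S a f : avg S (fun x => a * f x) = a * avg S f.
Proof. by rewrite /avg -mulr_sumr mulrA. Qed.

Lemma eq_avg S f g : f =1 g -> avg S f = avg S g.
Proof. by move=> E; rewrite /avg; under eq_bigr do rewrite E. Qed.

Lemma ler_Ex Ss F G : (forall ys, size ys = size Ss -> F ys <= G ys) ->
  Ex Ss F <= Ex Ss G.
Proof.
elim: Ss F G => [|S Ss IH] F G H /=; first exact: H.
by apply: ler_avgS => x _; apply: IH => ys hy; apply: H; rewrite /= hy.
Qed.

Lemma eq_Ex Ss F G : F =1 G -> Ex Ss F = Ex Ss G.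
Proof.
by move=> E; apply/eqP; rewrite eq_le; apply/andP; split;
   apply: ler_Ex => ys _; rewrite E.
Qed.

Lemma Ex_const Ss a : all (fun S : {set T} => S != set0) Ss -> Ex Ss (fun=> a) = a.
Proof.
elim: Ss => //= S Ss IH /andP [S0 /IH E].
by rewrite (eq_avg _ (g := fun=> a)) ?avg_const.
Qed.

Lemma ExD Ss F G : Ex Ss (fun ys => F ys + G ys) = Ex Ss F + Ex Ss G.
Proof.
elim: Ss F G => [|S Ss IH] F G //=.
by rewrite -avgD; apply: eq_avg => x; rewrite IH.
Qed.

Lemma ExZ Ss a F : Ex Ss (fun ys => a * F ys) = a * Ex Ss F.
Proof.
elim: Ss F => [|S Ss IH] F //=.
by rewrite -avgZ; apply: eq_avg => x; rewrite IH.
Qed.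

Lemma Ex0 Ss : Ex Ss (fun=> 0) = 0.
Proof.
elim: Ss => [|S Ss IH] //=; rewrite (eq_avg _ (g := fun=> 0 * 0)) ?avgZ ?mul0r //.
Qed.

Lemma Ex_sum Ss (I : Type) (l : seq I) (P : pred I) (F : I -> seq T -> R) :
  Ex Ss (fun ys => \sum_(i <- l | P i) F i ys) = \sum_(i <- l | P i) Ex Ss (F i).
Proof.
elim: l => [|i l IH].
  by rewrite big_nil -[RHS](Ex0 Ss); apply: eq_Ex => ys; rewrite big_nil.
rewrite big_cons -IH.
rewrite (@eq_Ex _ _ (fun ys => (if P i then F i ys else 0) +
   \sum_(i <- l | P i) F i ys)); last first.
  by move=> ys; rewrite big_cons; case: ifP => // _; rewrite add0r.
rewrite ExD; case: ifP => // _.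
by rewrite Ex0 add0r.
Qed.

(** Independence and zero means kill the cross terms, so the variances add up; the offset [s]
    carries the part already sampled through the induction. *)
Lemma Ex_sqr (D : Type) (S : D -> {set T}) (h : D -> T -> R) (L : seq D) (s : R) :
  (forall t, S t != set0) -> (forall t, avg (S t) (h t) = 0) ->
  Ex (map S L) (fun ys => (s + \sum_(p <- zip L ys) h p.1 p.2) ^+ 2) =
  s ^+ 2 + \sum_(t <- L) avg (S t) (fun x => h t x ^+ 2).
Proof.
move=> S0 h0; elim: L s => [|a L IH] s /=; first by rewrite !big_nil !addr0.
rewrite big_cons.
rewrite (@eq_avg _ _ (fun x => (s + h a x) ^+ 2 +
  \sum_(t <- L) avg (S t) (fun x => h t x ^+ 2))); last first.
  by move=> x; rewrite -IH; apply: eq_Ex => ys; rewrite /= big_cons addrA.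
rewrite avgD avg_const // addrA; congr (_ + _).
rewrite (@eq_avg _ _ (fun x => (s ^+ 2 + (2 * s) * h a x) + h a x ^+ 2)).
  by rewrite !avgD avgZ h0 mulr0 addr0 avg_const.
by move=> x; ring.
Qed.

Lemma Ex_markov (Ss : seq {set T}) (Z : seq T -> R) (e a : R) :
  all (fun S : {set T} => S != set0) Ss -> (forall ys, 0 <= Z ys) -> 0 < a ->
  Ex Ss Z <= e -> 1 - e / a <= Ex Ss (fun ys => (Z ys <= a)%R%:R).
Proof.
move=> S0 Z0 a0 he.
apply: (@le_trans _ _ (Ex Ss (fun ys => 1 + (- a^-1) * Z ys))).
  rewrite ExD Ex_const // ExZ lerD2l mulNr lerN2 mulrC ler_wpM2r //.
  by rewrite invr_ge0 ltW.
apply: ler_Ex => ys _; case: (leP (Z ys) a) => h.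
  by rewrite mulNr gerDl oppr_le0 mulr_ge0 // invr_ge0 ltW.
by rewrite mulNr subr_le0 mulrC ler_pdivlMr // mul1r ltW.
Qed.

End Expectation.

(** * Second moment bound for the columnwise choice *)

Section Sampling.

Variables (R : realFieldType) (T : finType) (X : {set T}) (m k : nat).
Variables (bit : T -> 'I_m -> bool) (c : 'I_k -> 'I_m -> bool).
Variables (Gt : finType) (grp : T -> Gt) (ph : Gt -> 'I_k).
Variables (S : Gt -> {set T}) (w : Gt -> nat) (Q M r : nat) (L : seq Gt).

Definition grpset g := [set x in X | grp x == g].

Hypothesis S_grp : forall g, grpset g != set0 -> S g = grpset g.
Hypothesis S_neq0 : forall g, S g != set0.
Hypothesis w_le : forall g, (w g <= M * #|grpset g|)%N.
Hypothesis w_ge : forall g, (Q * (M * #|grpset g| - w g) <= M * #|grpset g|)%N.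
Hypothesis L_count : forall g, count_mem g L = r.
Hypothesis rE : r = (2 * Q ^ 2)%N.
Hypothesis Q_gt : (2 < Q)%N.
Hypothesis M_gt0 : (0 < M)%N.

Definition pcost (c' : 'I_k -> 'I_m -> bool) : nat :=
  \sum_(x in X) \sum_i (bit x i != c' (ph (grp x)) i).

Definition ucon ys (b : bool) j i : nat :=
  \sum_(p <- zip L ys | ph p.1 == j) w p.1 * (bit p.2 i != b).

Let sz g : R := #|grpset g|%:R.
Definition badn g i : nat := #|[set x in grpset g | bit x i != c (ph g) i]|.
Let bad g i : R := (badn g i)%:R.
Let h g i g' x : R :=
  (g' == g)%:R * (sz g * (bit x i != c (ph g) i)%:R - bad g i).
Let zeta g i ys := \sum_(p <- zip L ys) h g i p.1 p.2.
(** The coefficient [Q / r ^ 2] is the one that completes a square with [sz / Q] in [flip_cost]. *)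
Let Zi i ys := \sum_g zeta g i ys ^+ 2 / sz g * (Q%:R / r%:R ^+ 2).
Let Z ys := \sum_i Zi i ys.

Let Q0 : 0 < Q%:R :> R. Proof. by rewrite ltr0n; apply: leq_trans Q_gt. Qed.
Let r0 : 0 < r%:R :> R.
Proof. by rewrite ltr0n rE muln_gt0 expn_gt0; move: Q_gt; case: Q. Qed.
Let M0 : 0 < M%:R :> R. Proof. by rewrite ltr0n. Qed.

Lemma sum_bad g i : \sum_(x in grpset g) (bit x i != c (ph g) i)%:R = bad g i.
Proof.
rewrite /bad /badn -natr_sum; congr _%:R.
rewrite -sum1_card; under [RHS]eq_bigl do rewrite inE.
by rewrite [RHS]big_mkcondr; apply: eq_bigr => x _; case: (_ != _).
Qed.

Lemma bad_le g i : bad g i <= sz g.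
Proof.
by rewrite ler_nat subset_leq_card //; apply/subsetP => x; rewrite inE => /andP [].
Qed.

Lemma pcostE c' : (pcost c')%:R =
  \sum_i \sum_g (if c' (ph g) i != c (ph g) i then sz g - bad g i else bad g i).
Proof.
rewrite /pcost natr_sum (partition_big grp predT) //= exchange_big /=.
apply: eq_bigr => g _.
transitivity (\sum_(x in grpset g) \sum_i (bit x i != c' (ph g) i)%:R : R).
  apply: eq_big => x; first by rewrite inE.
  by move=> /andP [_ /eqP ->]; rewrite natr_sum.
rewrite exchange_big /=; apply: eq_bigr => i _.
case: eqP => [->|/eqP ne] /=; first exact: sum_bad.
rewrite -sum_bad /sz -sum1_card natr_sum -sumrB; apply: eq_bigr => x _.
by case: (bit x i) (c' _ _) (c _ _) ne => -[] [] //= _; rewrite ?subr0 ?subrr.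
Qed.

(** One scaled draw has variance [bad (sz - bad)], at most [bad] after division by [sz]. The noise
    is thus relative to the cost of the group and not to its size, which makes a number of samples
    independent of [n] sufficient. *)
Lemma Ex_zeta g i : Ex [seq S g | g <- L] (fun ys => zeta g i ys ^+ 2 / sz g) <=
  r%:R * bad g i.
Proof.
have [E|ne] := eqVneq (grpset g) set0.
  rewrite (@eq_Ex _ _ _ _ (fun=> 0)) ?Ex0; first by rewrite mulr_ge0 // ler0n.
  by move=> ys; rewrite /sz E cards0 invr0 mulr0.
have sz0 : sz g != 0 by rewrite pnatr_eq0 cards_eq0.
have sz0' : 0 < sz g by rewrite lt_def sz0 ler0n.
rewrite (@eq_Ex _ _ _ _ (fun ys => (sz g)^-1 *
   (0 + \sum_(p <- zip L ys) h g i p.1 p.2) ^+ 2)); last first.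
  by move=> ys; rewrite mulrC add0r.
have a0 g' : avg (S g') (h g i g') = 0.
  rewrite /h; case: eqP => [->|_]; last first.
    by rewrite /avg big1 ?mul0r // => x _; rewrite mul0r.
  rewrite S_grp // /avg; under eq_bigr do rewrite mul1r.
  by rewrite sumrB -mulr_sumr sum_bad sumr_const -[bad g i *+ _]mulr_natl subrr mul0r.
rewrite ExZ Ex_sqr // expr0n add0r.
have -> : \sum_(g' <- L) avg (S g') (fun x => h g i g' x ^+ 2) =
    \sum_(g' <- L | g' == g) (bad g i * (sz g - bad g i)).
  rewrite [RHS]big_mkcond /=; apply: eq_bigr => g' _; rewrite /h.
  case: eqP => [->|_]; last first.
    by rewrite /avg big1 ?mul0r // => x _; rewrite mul0r expr0n.
  rewrite S_grp // /avg.
  rewrite (eq_bigr (fun x => (sz g ^+ 2 - 2 * sz g * bad g i) *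
     (bit x i != c (ph g) i)%:R + bad g i ^+ 2)).
    rewrite big_split /= -mulr_sumr sum_bad sumr_const -[_ *+ _]mulr_natl -/(sz g).
    by field.
  by move=> x _; case: (_ != _) => /=; ring.
rewrite big_const_seq iter_addr_0 L_count -[_ *+ r]mulr_natl.
rewrite mulrCA ler_wpM2l ?ler0n // ler_pdivrMl // mulrC ler_wpM2r ?ler0n //.
by rewrite gerBl ler0n.
Qed.

Lemma Ex_Z : Ex [seq S g | g <- L] Z <= (pcost c)%:R / (2 * Q%:R).
Proof.
rewrite /Z Ex_sum pcostE mulr_suml; apply: ler_sum => i _.
rewrite /Zi Ex_sum mulr_suml; apply: ler_sum => g _; rewrite eqxx /=.
rewrite (@eq_Ex _ _ _ _ (fun ys => (Q%:R / r%:R ^+ 2) * (zeta g i ys ^+ 2 / sz g))).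
  rewrite ExZ; apply: le_trans (ler_wpM2l _ (Ex_zeta g i)) _.
    by rewrite divr_ge0 // ?ltW // exprn_gt0.
  rewrite (_ : Q%:R / r%:R ^+ 2 * (r%:R * bad g i) = bad g i * (Q%:R / r%:R)); last first.
    by field; rewrite gt_eqF.
  rewrite ler_wpM2l ?ler0n // rE natrM natrX ler_pdivrMr ?mulr_gt0 ?exprn_gt0 //.
  by rewrite (_ : _ * _ = Q%:R) //; field; rewrite gt_eqF.
by move=> ys; rewrite mulrC.
Qed.

Lemma Zi_ge0 i ys : 0 <= Zi i ys.
Proof.
by apply: sumr_ge0 => g _; rewrite mulr_ge0 // divr_ge0 ?ler0n ?sqr_ge0 //.
Qed.

(* [e] is the number of sampled disagreements of group [g] with its center in
   column [i], and [ze] its deviation from the mean: the true cost of flipping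
   the center bit is the one predicted by the sample, up to the last two terms. *)
Lemma flip_cost g i (e : R) ze : (w g)%:R * e <= M%:R * sz g * e ->
  ze = sz g * e - r%:R * bad g i ->
  sz g - 2 * bad g i <= (w g)%:R * (r%:R - 2 * e) / (M%:R * r%:R) +
    (2 / Q%:R * sz g + ze ^+ 2 / sz g * (Q%:R / r%:R ^+ 2)).
Proof.
move=> we zeE; have [E|ne] := eqVneq (sz g) 0.
  have bg : bad g i = 0.
    by apply/eqP; rewrite eq_le ler0n andbT -E bad_le.
  have wg : (w g)%:R = 0 :> R.
    apply/eqP; rewrite pnatr_eq0 -leqn0; apply: leq_trans (w_le g) _.
    by move/eqP: E; rewrite /sz pnatr_eq0 => /eqP ->; rewrite muln0.
  by rewrite E bg wg invr0 !(mul0r, mulr0) subr0 !addr0.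
have s0 : 0 < sz g by rewrite lt_def ne ler0n.
have wge : Q%:R * (M%:R * sz g - (w g)%:R) <= M%:R * sz g.
  by rewrite /sz -natrM -natrB ?w_le // -natrM ler_nat; exact: w_ge.
have h1 : sz g - 2 * bad g i <=
    (w g)%:R * (r%:R - 2 * e) / (M%:R * r%:R) + sz g / Q%:R + 2 * ze / r%:R.
  rewrite zeE.
  have -> : sz g - 2 * bad g i = (w g)%:R * (r%:R - 2 * e) / (M%:R * r%:R) +
    (M%:R * sz g - (w g)%:R) / M%:R + 2 * ((w g)%:R * e / M%:R - r%:R * bad g i) / r%:R.
    by field; rewrite !gt_eqF.
  apply: lerD.
    rewrite lerD2l ler_pdivrMr // mulrAC ler_pdivlMr // mulrC [sz g * _]mulrC.
    exact: wge.
  rewrite ler_pM2r ?invr_gt0 // ler_pM2l // lerD2r ler_pdivrMr //.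
  by rewrite mulrAC [sz g * _]mulrC.
apply: le_trans h1 _; rewrite -addrA lerD2l.
have -> : 2 / Q%:R * sz g + ze ^+ 2 / sz g * (Q%:R / r%:R ^+ 2) =
  sz g / Q%:R + 2 * ze / r%:R +
  (sz g / Q%:R) * (1 - ze * Q%:R / (r%:R * sz g)) ^+ 2.
  by field; rewrite !gt_eqF.
rewrite lerDl mulr_ge0 ?sqr_ge0 // divr_ge0 // ltW //.
Qed.

(** On a flipped group the costs of the two bits add up to the group size, so the terms [2 / Q * sz]
    of [flip_cost] are bounded by [2 / Q] times the sum of both costs and can be split between the
    two sides. *)
Lemma column_cost i ys c' : size ys = size L ->
  (\sum_j ucon ys (c' j i) j i <= \sum_j ucon ys (c j i) j i)%N ->
  (1 - 2 / Q%:R) *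
    \sum_g (if c' (ph g) i != c (ph g) i then sz g - bad g i else bad g i) <=
  (1 + 2 / Q%:R) * \sum_g bad g i + Zi i ys.
Proof.
move=> sy hmin.
pose en g := (\sum_(p <- zip L ys | p.1 == g) (bit p.2 i != c (ph g) i))%N.
have cnt g : (\sum_(p <- zip L ys | p.1 == g) 1 = r)%N.
  rewrite -(L_count g) -sum1_count.
  rewrite -[in RHS](@unzip1_zip _ _ L ys) ?sy // /unzip1 big_map.
  by apply: eq_bigl => p.
have en_le g : (en g <= r)%N.
  by rewrite -(cnt g); apply: leq_sum => p _; case: (_ != _).
have uE (c1 : 'I_k -> 'I_m -> bool) : (\sum_j ucon ys (c1 j i) j i)%:R =
    \sum_g (w g)%:R * (if c1 (ph g) i != c (ph g) i then r%:R - (en g)%:R else (en g)%:R) :> R.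
  rewrite /ucon.
  have -> : (\sum_j \sum_(p <- zip L ys | ph p.1 == j) w p.1 * (bit p.2 i != c1 j i) =
     \sum_(p <- zip L ys) w p.1 * (bit p.2 i != c1 (ph p.1) i))%N.
    rewrite (exchange_big_dep predT) //=; apply: eq_bigr => p _.
    by rewrite (big_pred1 (ph p.1)) // => j; rewrite eq_sym.
  have -> : (\sum_(p <- zip L ys) w p.1 * (bit p.2 i != c1 (ph p.1) i) =
     \sum_g \sum_(p <- zip L ys | p.1 == g) w g * (bit p.2 i != c1 (ph g) i))%N.
    rewrite (exchange_big_dep predT) //=; apply: eq_bigr => p _.
    by rewrite (big_pred1 p.1) // => j; rewrite eq_sym.
  rewrite natr_sum; apply: eq_bigr => g _.
  rewrite -big_distrr /= natrM; congr (_ * _).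
  case: eqP => [->//|/eqP ne] /=.
  rewrite -natrB // -(cnt g); congr _%:R.
  apply: (@addIn (en g)); rewrite subnK ?cnt // -[RHS](cnt g) /en -big_split /=.
  apply: eq_bigr => p _.
  by case: (bit _ _) (c1 _ _) (c _ _) ne => -[] [].
have zE g : zeta g i ys = sz g * (en g)%:R - r%:R * bad g i.
  rewrite /zeta /h (eq_bigr (fun p => if p.1 == g then
     sz g * (bit p.2 i != c (ph g) i)%:R - bad g i else 0)); last first.
    by move=> p _; case: (p.1 == g); rewrite ?mul1r ?mul0r.
  rewrite -big_mkcond /= sumrB -mulr_sumr /en natr_sum; congr (_ - _).
  by rewrite -(cnt g) natr_sum mulr_suml; under [RHS]eq_bigr do rewrite mul1r.
set fl := fun g => c' (ph g) i != c (ph g) i.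
(* The sampled costs of [c'] and [c] differ only on flipped groups, by [w (r - e) - w e] each. *)
have hw : \sum_(g | fl g) (w g)%:R * (r%:R - 2 * (en g)%:R) <= 0 :> R.
  move: hmin; rewrite -(ler_nat R) !uE -subr_le0 -sumrB => hs; apply: le_trans hs.
  rewrite big_mkcond /=; apply: ler_sum => g _; rewrite eqxx /= -/(fl g).
  case: (fl g); rewrite ?subrr //= -mulrBr.
  by rewrite (_ : r%:R - _ - _ = r%:R - 2 * (en g)%:R) //; ring.
set f' := \sum_g _; set f := \sum_g bad g i.
have Edif : f' - f = \sum_(g | fl g) (sz g - 2 * bad g i).
  rewrite /f' /f -sumrB [RHS]big_mkcond /=; apply: eq_bigr => g _.
  by rewrite -/(fl g); case: (fl g); [ring|rewrite subrr].
have Efl : \sum_(g | fl g) sz g <= f' + f.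
  rewrite /f' /f -big_split /= big_mkcond /=; apply: ler_sum => g _.
  rewrite -/(fl g); case: (fl g); first by rewrite subrK.
  by rewrite addr_ge0 ?ler0n.
have Hd : f' - f <= 2 / Q%:R * (f' + f) + Zi i ys.
  rewrite Edif; apply: (@le_trans _ _ (\sum_(g | fl g)
     ((w g)%:R * (r%:R - 2 * (en g)%:R) / (M%:R * r%:R) +
    (2 / Q%:R * sz g + zeta g i ys ^+ 2 / sz g * (Q%:R / r%:R ^+ 2))))).
    apply: ler_sum => g _; apply: flip_cost (zE g).
    by rewrite ler_wpM2r ?ler0n // /sz -natrM ler_nat w_le.
  rewrite !big_split /= -mulr_suml -mulr_sumr.
  rewrite -[X in _ <= X]add0r; apply: lerD.
    by rewrite mulr_le0_ge0 // invr_ge0 mulr_ge0 // ltW.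
  apply: lerD; first by rewrite ler_wpM2l // divr_ge0 // ltW.
  rewrite /Zi [X in _ <= X](bigID fl) /= lerDl; apply: sumr_ge0 => g _.
  by rewrite mulr_ge0 ?divr_ge0 ?sqr_ge0 ?ler0n.
rewrite mulrBl mulrDl !mul1r; move: Hd; rewrite mulrDr; lra.
Qed.

(** The summand [1 / 2] keeps the Markov threshold positive when the cost is 0; in [okys_cost] it
    disappears because costs are integers. *)
Definition okys ys := Z ys <= ((pcost c)%:R + 2^-1) / Q%:R.

Lemma okys_prob : 2^-1 <= Ex [seq S g | g <- L] (fun ys => (okys ys)%:R : R).
Proof.
have a0 : 0 < ((pcost c)%:R + 2^-1) / Q%:R :> R.
  by rewrite divr_gt0 // ltr_wpDl ?ler0n // invr_gt0.
have Z0 ys : 0 <= Z ys by apply: sumr_ge0 => i _; apply: Zi_ge0.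
apply: le_trans (Ex_markov _ Z0 a0 Ex_Z).
  rewrite lerBrDr -lerBrDl ler_pdivrMr //.
  rewrite (_ : _ * (_ / Q%:R) = ((pcost c)%:R + 2^-1) / (2 * Q%:R)); last first.
    by field; rewrite gt_eqF.
  by rewrite ler_pM2r ?invr_gt0 ?mulr_gt0 // lerDl invr_ge0.
by apply/allP => _ /mapP [g _ ->].
Qed.

Lemma okys_cost ys c' : size ys = size L -> okys ys ->
  (forall i, (\sum_j ucon ys (c' j i) j i <= \sum_j ucon ys (c j i) j i)%N) ->
  ((Q - 2) * pcost c' <= (Q + 3) * pcost c)%N.
Proof.
move=> sy ok hmin.
have H : (1 - 2 / Q%:R) * (pcost c')%:R <= (1 + 2 / Q%:R) * (pcost c)%:R + Z ys.
  rewrite !pcostE !mulr_sumr /Z -big_split /=; apply: ler_sum => i _.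
  apply: le_trans (column_cost sy (hmin i)) _.
  by rewrite lerD2r; under [X in _ <= _ * X]eq_bigr do rewrite eqxx.
have H2 : (Q%:R - 2) * (pcost c')%:R <= (Q%:R + 3) * (pcost c)%:R + 2^-1 :> R.
  have := le_trans H (lerD (lexx _) ok); rewrite -(ler_pM2l Q0).
  rewrite (_ : Q%:R * _ = (Q%:R - 2) * (pcost c')%:R); last first.
    by field; rewrite gt_eqF.
  rewrite (_ : Q%:R * _ = (Q%:R + 3) * (pcost c)%:R + 2^-1) //.
  by field; rewrite gt_eqF.
rewrite -ltnS -(ltr_nat R) -natr1 !natrM natrB ?(ltnW Q_gt) // natrD.
apply: le_lt_trans H2 _; rewrite ltrD2l.
by rewrite invf_lt1 ?ltr1n.
Qed.

End Sampling.

Local Open Scope nat_scope.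

(** * The deterministic parts of a trial *)

Definition addr m j i := j * m + i.

Lemma addr_lt k m j i : j < k -> i < m -> addr m j i < k * m.
Proof.
rewrite /addr => jk im; apply: (@leq_trans (j.+1 * m)).
  by rewrite mulSn addnC ltn_add2r.
by rewrite leq_mul2r jk orbT.
Qed.

Lemma addr_inj m j j' i i' : i < m -> i' < m ->
  addr m j i = addr m j' i' -> j = j' /\ i = i'.
Proof.
rewrite /addr => h h' E; have m0 : 0 < m by lia.
split.
  by have := congr1 (divn^~ m) E; rewrite !divnMDl // !divn_small // !addn0.
by have := congr1 (modn^~ m) E; rewrite /= !modnMDl !modn_small.
Qed.

Definition bitn v j := odd (v %/ 2 ^ j).

(** The machine has no division: bits are read off from the top, by comparing the remainder with
    [2 ^ j] and subtracting. *)
Lemma bitnE v j : bitn v j = (2 ^ j <= v %% 2 ^ j.+1) /\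
  v %% 2 ^ j = v %% 2 ^ j.+1 - (if bitn v j then 2 ^ j else 0).
Proof.
have p0 : 0 < 2 ^ j by rewrite expn_gt0.
have E : v %% 2 ^ j.+1 = bitn v j * 2 ^ j + v %% 2 ^ j.
  rewrite {1}(divn_eq v (2 ^ j)) {1}(divn_eq (v %/ 2 ^ j) 2) modn2 -/(bitn v j).
  rewrite mulnDl -mulnA -expnS -addnA modnMDl modn_small //.
  have := ltn_pmod v p0; rewrite expnS.
  by case: (bitn v j); rewrite ?mul1n ?mul0n; lia.
have := ltn_pmod v p0.
rewrite E; case: (bitn v j); rewrite ?mul1n ?mul0n ?addKn; split => //; lia.
Qed.

Lemma t_for_le a b t : a <= b -> t_for a t <= t_for b t.
Proof. by move=> ab; rewrite /t_for leq_add2r leq_mul2r ab orbT. Qed.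

(** The weight is the guess in register 24 times the total weight that the sampler left in register
    33. Register 20 sums all weights, hence dominates the disagreement of any column. *)
Definition AddUp :=
  let cell a := Add (Reg a) (Add (Reg 26) (Reg 27)) in
  let Bump a := Store (cell a) (Add (Mem (cell a)) (Reg 25)) in
  Seq (Mul 25 (Reg 24) (Reg 33))
  (Seq (Assign 20 (Add (Reg 20) (Reg 25)))
  (Seq (Mul 26 (Reg 22) (Reg 1))
    (For 27 (Reg 1)
      (If (Leq (Const 1) (Mem (Add (Reg 35) (Reg 27)))) (Bump 11) (Bump 12))))).

Definition t_acc m k M := t_mul M + t_mul k + t_for m 2 + 4.

Definition Decode :=
  let cell a := Add (Reg a) (Reg 38) in
  Seq (Assign 33 (Reg 23)) (Seq (Assign 34 (Const 0))
  (For 35 (Reg 2)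
    (Seq (Assign 36 (Sub (Sub (Reg 2) (Const 1)) (Reg 35)))
    (Seq (Pow 37 (Const 2) (Reg 36))
    (Seq (Mul 39 (Reg 36) (Reg 1))
    (Seq (Assign 38 (Add (Reg 39) (Reg 27)))
    (If (Leq (Reg 37) (Reg 33))
       (Seq (Assign 33 (Sub (Reg 33) (Reg 37)))
       (Seq (Assign 34 (Add (Reg 34) (Mem (cell 12))))
         (Store (cell 9) (Const 1))))
       (Seq (Assign 34 (Add (Reg 34) (Mem (cell 11))))
         (Store (cell 9) (Const 0)))))))))).

Definition t_decode_body k := t_pow 2 k + t_mul k + 12.
Definition t_decode k := t_for k (t_decode_body k) + 4.

(** [Decode] evaluates a tuple and also writes it to the candidate block, so the winner is decoded
    once more at the end. The initial minimum, register 20 plus 1, exceeds every column sum: the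
    first tuple in the relation is always accepted, and entry 0 remains only if the relation is
    empty. *)
Definition ChooseAt :=
  Seq (Mul 26 (Reg 3) (Reg 27)) (Seq (Assign 26 (Add (Reg 26) (Reg 8)))
  (Seq (Assign 29 (Add (Reg 20) (Const 1))) (Seq (Assign 28 (Const 0))
  (Seq
    (For 24 (Reg 3)
      (If (Leq (Const 1) (Mem (Add (Reg 26) (Reg 24))))
         (Seq (Assign 23 (Reg 24)) (Seq Decode
           (If (Leq (Add (Reg 34) (Const 1)) (Reg 29))
              (Seq (Assign 29 (Reg 34)) (Assign 28 (Reg 24))) Skip)))
         Skip))
  (Seq (Assign 23 (Reg 28)) Decode))))).

Definition t_choose_at k :=
  t_mul (2 ^ k) + t_for (2 ^ k) (t_decode k + 8) + t_decode k + 12.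

Definition Choose := For 27 (Reg 1) ChooseAt.

Definition t_choose m k := t_for m (t_choose_at k).

Definition Evaluate :=
  Seq (For 22 (Reg 2) (Seq (Mul 26 (Reg 22) (Reg 1))
        (Store (Add (Reg 13) (Reg 22)) (Add (Reg 9) (Reg 26)))))
  (Seq (Assign 17 (Reg 2)) (Seq (Assign 18 (Add (Reg 2) (Const 2))) Total)).

Definition t_evaluate n m k Q := t_for k (t_mul k + 2) + t_total n m k Q + 5.

Definition Update :=
  If (Leq (Add (Reg 33) (Const 1)) (Reg 15))
    (Seq (Assign 15 (Reg 33))
      (For 27 (Sub (Reg 10) (Reg 9))
        (Store (Add (Reg 10) (Reg 27)) (Mem (Add (Reg 9) (Reg 27))))))
    Skip.

Definition t_update m k := t_for (k * m) 1 + 3.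

Definition InitTrial :=
  Seq (For 27 (Sub (Reg 13) (Reg 11)) (Store (Add (Reg 11) (Reg 27)) (Const 0)))
  (Seq (Assign 20 (Const 0)) (Seq (Assign 17 (Const 1))
  (Seq (Store (Reg 13) (Const 0)) (Seq (Assign 18 (Add (Reg 2) (Const 2)))
    (Assign 19 (Const 0)))))).

Definition t_init_trial m k := t_for (2 * (k * m)) 1 + 10.

Section Programs.

Variables (R : realType) (eps : R).

Local Notation tri := (tri eps).

Variables (n m k Q r M N : nat) (inp : nat -> nat).

(* Memory above the input: candidate centers, best centers, the weights of the
   sampled 0 and 1 bits for each center and coordinate, the anchors (addresses
   of input rows), the thresholds. *)
Definition base := n * m + m * 2 ^ k.
Definition cb := base.
Definition bb := base + k * m.
Definition ub := base + 2 * (k * m).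
Definition vb := base + 3 * (k * m).
Definition ab := base + 4 * (k * m).
Definition hb := ab + k + 1.

Definition Glob s :=
  ([/\ regs s 0 = n, regs s 1 = m, regs s 2 = k, regs s 3 = 2 ^ k & regs s 4 = Q] /\
   [/\ regs s 5 = r, regs s 6 = M, regs s 7 = N, regs s 8 = n * m & regs s 9 = cb]) /\
  ([/\ regs s 10 = bb, regs s 11 = ub, regs s 12 = vb, regs s 13 = ab &
      regs s 14 = hb] /\ forall a, a < base -> smem s a = inp a).

Lemma GE s : Glob s ->
  (((regs s 0 = n) * (regs s 1 = m) * (regs s 2 = k) * (regs s 3 = (2 ^ k)%N) * (regs s 4 = Q)) *
  ((regs s 5 = r) * (regs s 6 = M) * (regs s 7 = N) * (regs s 8 = (n * m)%N) * (regs s 9 = cb)) *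
  ((regs s 10 = bb) * (regs s 11 = ub) * (regs s 12 = vb) * (regs s 13 = ab) * (regs s 14 = hb)))%type.
Proof. by move=> [[[-> -> -> -> ->] [-> -> -> -> ->]] [[-> -> -> -> ->] _]]. Qed.

Lemma GM s a : Glob s -> a < base -> smem s a = inp a.
Proof. by move=> [_ [_ H]]; apply: H. Qed.

Definition memsame (P : nat -> Prop) (s s' : state) :=
  forall a, P a -> smem s' a = smem s a.

Lemma Glob_keep b s s' : 15 <= b -> keep b s s' ->
  memsame (fun a => a < base) s s' -> Glob s -> Glob s'.
Proof.
move=> hb15 kk mm G.
have K x : x < 15 -> regs s' x = regs s x by move=> hx; apply: kk; lia.
split; first by split; split; rewrite K // !(GE G).
split; first by split; rewrite K // !(GE G).
by move=> a ha; rewrite mm // (GM G).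
Qed.

(** The block [ub] collects the sampled ones and [vb] the sampled zeros, so this is the price of
    giving bit [b] to coordinate [i] of center [j]. *)
Definition Uat s (b : bool) j i := smem s ((if b then vb else ub) + addr m j i).

Definition ptbit p i := 0 < inp (p + i).

Definition addu (w j p : nat) (u : bool -> nat -> nat -> nat) b j' i :=
  u b j' i + (if j' == j then w * (ptbit p i != b) else 0).

Lemma tri_add_up s (I : state -> Prop) : Glob s ->
  regs s 35 + m <= base -> regs s 24 <= M -> regs s 22 < k ->
  (forall s', keep 20 s s' ->
     regs s' 20 = regs s 20 + regs s 24 * regs s 33 ->
     (forall x, x \in [:: 21; 22; 23] -> regs s' x = regs s x) ->
     memsame (fun a => a < ub \/ ab <= a) s s' ->
     (forall b j i, j < k -> i < m ->
        Uat s' b j i = addu (regs s 24 * regs s 33) (regs s 22) (regs s 35)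
                         (Uat s) b j i) ->
     I s') ->
  tri AddUp s (t_acc m k M) I.
Proof.
move=> G hp ht hj HI.
set w := regs s 24 * regs s 33 in HI *; set j := regs s 22 in hj HI *.
set p := regs s 35 in hp HI *.
apply: (@tri_time _ _ _ _
  (t_mul (regs s 24) + (1 + (t_mul j + t_for m 2).+1).+1).+1).
  rewrite /t_acc /t_mul /t_for; nia.
apply: tri_seq; apply: (@tri_mul _ _ _ _ _ _ _ (regs s 33)) => //.
  by move=> s' k1 m1 /=; rewrite !k1.
move=> s1 k1 m1 E1; apply: tri_seq; apply: tri_assign.
set s2 := set_reg _ _ _.
apply: tri_seq; apply: (@tri_mul _ _ _ _ _ _ _ m) => //.
  move=> s' k3 m3 /=; rewrite !k3 // /s2 /= /upd /= !k1 //.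
  by rewrite !(GE G).
move=> s3 k3 m3 E3.
have k13 x : x < 60 -> x != 25 -> x != 26 -> x != 20 -> regs s3 x = regs s x.
  move=> x1 x2 x3 x4; have x5 : x != 60 by lia.
  by rewrite k3 // /s2 /= /upd (negbTE x4) k1.
have E20 : regs s3 20 = regs s 20 + w.
  by rewrite k3 // /s2 /= /upd /= E1 k1.
have E25 : regs s3 25 = w by rewrite k3 // /s2 /= /upd /= E1.
have m03 : smem s3 = smem s by rewrite m3 /s2 /= m1.
pose Inv i s' := [/\ regs s' 27 = i,
  forall x, x < 60 -> x != 27 -> regs s' x = regs s3 x,
  memsame (fun a => a < ub \/ ab <= a) s s' &
  forall b j' i', j' < k -> i' < m ->
    Uat s' b j' i' = if i' < i then addu w j p (Uat s) b j' i' else Uat s b j' i'].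
apply: (@tri_weaken _ _ _ _ (t_for m 2) _ (Inv m)) => //; last first.
  move=> s' [_ h2 h3 h4]; apply: HI => //.
  + by move=> x hx; rewrite h2 ?k13 //; lia.
  + by rewrite h2.
  + by move=> x; rewrite !inE => /or3P [] /eqP ->; rewrite h2 // k13.
  + by move=> b j' i' h h'; rewrite h4 // h'.
apply: tri_for => [i s' hi [h1 h2 h3 h4]|i s' hi [h1 h2 h3 h4]|].
- by rewrite h1 /= h2 // k13 // !(GE G).
- have Ea b : (if b then vb else ub) + addr m j i < ab.
    by have := addr_lt hj hi; rewrite /ab /vb /ub; case: b; lia.
  have Bump b s'' : s'' = set_mem s' ((if b then vb else ub) + addr m j i)
      (Uat s b j i + w) -> ptbit p i != b -> Inv i.+1 (set_reg s'' 27 i.+1).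
    move=> -> pb; split => //.
    + by move=> x x1 x2; rewrite regs_other // h2.
    + move=> a ha; rewrite /= /upd; case: eqP => [E|_]; last exact: h3.
      exfalso; have := Ea b; case: ha; rewrite E; last lia.
      by rewrite /vb /ub; case: b {E pb}; lia.
    + move=> b' j' i' hj' hi'.
      have -> : Uat (set_reg (set_mem s' ((if b then vb else ub) + addr m j i)
          (Uat s b j i + w)) 27 i.+1) b' j' i' =
        if [&& b' == b, j' == j & i' == i] then Uat s b j i + w else Uat s' b' j' i'.
        rewrite /Uat /= /upd; case: eqP => [E|NE].
          have L1 := addr_lt hj' hi'; have L2 := addr_lt hj hi.
          have Eb : b' = b.
            move: E; rewrite /vb /ub.
            by case: b b' {pb} => -[]; lia.
          move: E; rewrite Eb => /addnI /addr_inj [] // -> ->.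
          by rewrite !eqxx.
        case: (boolP [&& b' == b, j' == j & i' == i]) => [/and3P|//].
        case=> /eqP Eb /eqP Ej /eqP Ei.
        by case: NE; rewrite Eb Ej Ei.
      rewrite h4 // /addu (ltnS i' i) [i' <= i]leq_eqVlt.
      have [-> | ni] := eqVneq i' i; rewrite ?ltnn /= ?andbT ?andbF //.
      have [-> | nj] := eqVneq j' j; rewrite /= ?andbT ?andbF ?addn0 //.
      have [-> | nb] := eqVneq b' b; first by rewrite pb muln1.
      have -> : ptbit p i = b' by move: pb nb; case: (ptbit p i); case: b; case: b'.
      by rewrite eqxx muln0 addn0.
  have Epi : smem s' (regs s' 35 + regs s' 27) = inp (p + i).
    rewrite h1 h2 // k13 // -/p h3 ?(GM G) //; first by lia.
    left; rewrite /ub; lia.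
  have Ecell b : smem s' ((if b then vb else ub) + addr m j i) = Uat s b j i.
    by rewrite -[LHS]/(Uat s' b j i) h4 // ltnn.
  have E26 : regs s' 26 = j * m.
    by rewrite h2 // E3 /s2 /= /upd /= k1.
  apply: tri_if => /=; rewrite Epi => c1; apply: tri_store => /=;
     rewrite h1 E26 !h2 // E25 !k13 // !(GE G).
  + by apply: (Bump false); rewrite -?(Ecell false) // /ptbit c1.
  + by apply: (Bump true); rewrite -?(Ecell true) // /ptbit (negbTE c1).
- split => //.
  + by move=> x x1 x2; rewrite regs_other.
  + by move=> a _; rewrite /= m03.
  + by move=> b j' i' _ _; rewrite /Uat /= m03.
Qed.

Lemma tri_decode s (I : state -> Prop) v i : Glob s ->
  regs s 23 = v -> v < 2 ^ k -> regs s 27 = i -> i < m ->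
  (forall s', keep 33 s s' ->
     regs s' 34 = \sum_(j < k) Uat s (bitn v j) j i ->
     memsame (fun a => forall j, j < k -> a <> cb + addr m j i) s s' ->
     (forall j, j < k -> smem s' (cb + addr m j i) = bitn v j) -> I s') ->
  tri Decode s (t_decode k) I.
Proof.
move=> G E23 v_lt E27 i_lt HI.
have -> : t_decode k = (1 + (1 + t_for k (t_decode_body k)).+1).+1.
  by rewrite /t_decode; lia.
apply: tri_seq; apply: tri_assign; apply: tri_seq; apply: tri_assign.
(* After [t] turns the top [t] bits are decoded, and register 33 holds the remainder formed by the
   others. *)
pose Inv t s' := [/\ [/\ regs s' 35 = t, regs s' 33 = v %% 2 ^ (k - t),
    regs s' 34 = \sum_(k - t <= j < k) Uat s (bitn v j) j i & keep 33 s s'],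
    memsame (fun a => forall j, k - t <= j -> j < k -> a <> cb + addr m j i) s s' &
    (forall j, k - t <= j -> j < k -> smem s' (cb + addr m j i) = bitn v j)].
apply: (@tri_weaken _ _ _ _ (t_for k (t_decode_body k)) _ (Inv k)) => //; last first.
  move=> s'; rewrite /Inv subnn big_mkord => -[[_ _ h1 h2] h3 h4]; apply: HI => //.
  - by move=> a ha; apply: h3 => j _; apply: ha.
  - by move=> j; apply: h4.
apply: tri_for => [t s' ht [[h1 _ _ h2] _ _]|t s' ht [[h1 h2 h3 h4] h5 h6]|].
- by rewrite h1 /= h2 // !(GE G).
- set j := k - 1 - t; have jk : j < k by lia.
  have Ej : k - t.+1 = j by lia.
  have Ej' : k - t = j.+1 by lia.
  rewrite Ej' in h2 h3 h5 h6.
  have [Eb Er] := bitnE v j.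
  pose F j := Uat s (bitn v j) j i.
  apply: (@tri_time _ _ _ _ (1 + (t_pow 2 j + (t_mul j + (1 + 6).+1).+1).+1).+1).
    have := @t_for_le j k (t_mul 2 + 2); have := @t_for_le j k 1.
    by rewrite /t_decode_body /t_pow /t_mul; lia.
  apply: tri_seq; apply: tri_assign.
  set s1 := set_reg _ _ _.
  have E36 : regs s1 36 = j by rewrite /= /upd /= h1 h4 // !(GE G).
  apply: tri_seq; apply: (@tri_pow _ _ _ _ _ _ 2 j) => // [s'' k2 m2|].
    by rewrite /= k2.
  move=> s2 k2 m2 E37.
  apply: tri_seq; apply: (@tri_mul _ _ _ _ _ _ j m) => // [s'' k3 m3|].
    by rewrite /= !k3 // !k2 // E36 /= /upd /= h4 // !(GE G).
  move=> s3 k3 m3 E39.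
  apply: tri_seq; apply: tri_assign.
  set s4 := set_reg _ _ _.
  have K4 x : x < 60 -> x \notin [:: 36; 37; 38; 39] -> regs s4 x = regs s' x.
    rewrite !inE !negb_or => x1 /and4P [x2 x3 x4 x5].
    have x6 : x != 60 by lia.
    by rewrite /s4 /= /upd (negbTE x4) k3 // k2 // /s1 /= /upd (negbTE x2).
  have M4 : smem s4 = smem s' by rewrite /s4 /= m3 m2.
  have E38 : regs s4 38 = addr m j i.
    by rewrite /s4 /= /upd /= E39 k3 // k2 // /s1 /= /upd /= h4 // E27.
  have E37' : regs s4 37 = 2 ^ j by rewrite /s4 /= /upd /= k3.
  have K4' : keep 33 s s4.
    move=> x hx; rewrite K4 ?h4 //; first by lia.
    by rewrite !inE !negb_or; apply/and4P; split; lia.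
  have EU b : smem s4 ((if b then vb else ub) + addr m j i) = Uat s b j i.
    rewrite M4 h5 // => j' _ j'k; have := addr_lt j'k i_lt.
    by rewrite /vb /ub /cb; case: b; lia.
  have fin s5 : keep 33 s s5 -> regs s5 35 = t -> regs s5 33 = v %% 2 ^ j ->
     regs s5 34 = regs s' 34 + F j ->
     (forall a, smem s5 a = if a == cb + addr m j i then nat_of_bool (bitn v j) else smem s' a) ->
     Inv t.+1 (set_reg s5 35 t.+1).
    move=> g1 g2 g3 g4 g5; rewrite /Inv Ej; split; first split => //.
    - by rewrite /= /upd /= g4 h3 [RHS]big_ltn // addnC.
    - exact: keep_set.
    - move=> a ha; rewrite /= g5 ifN; last by apply/eqP; apply: ha.
      by apply: h5 => j' hj'; apply: ha; apply: ltnW.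
    - move=> j' l1 l2; rewrite /= g5; case: eqP => [/addnI /addr_inj [] // -> //|ne].
      apply: h6 => //; rewrite ltn_neqAle l1 andbT; apply/eqP => E.
      by apply: ne; rewrite E.
  have Fj b : b = bitn v j -> F j = smem s4 ((if b then vb else ub) + addr m j i).
    by move=> ->; rewrite EU.
  clearbody s4; apply: tri_if => /=; rewrite E37' K4 // h2 -Eb => c1.
    apply: (@tri_time _ _ _ _ (1 + (1 + 1).+1).+1) => //.
    apply: tri_seq; apply: tri_assign; apply: tri_seq; apply: tri_assign.
    apply: tri_store; rewrite /= /upd /= E37' E38 !K4 // h1.
    rewrite !(h4 9, h4 12) // !(GE G).
    apply: fin => //=; rewrite /upd /=.
    - by do 2 apply: keep_set => //.
    - by rewrite K4.
    - by rewrite Er c1 h2.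
    - by rewrite (Fj true) // c1.
    - by move=> a; rewrite c1 M4.
  apply: (@tri_time _ _ _ _ (1 + 1).+1) => //.
  apply: tri_seq; apply: tri_assign.
  apply: tri_store; rewrite /= /upd /= E38 !K4 // h1.
  rewrite !(h4 9, h4 11) // !(GE G).
  apply: fin => //=; rewrite /upd /=.
  - by apply: keep_set => //.
  - by rewrite K4.
  - by rewrite K4 // Er (negbTE c1) subn0 h2.
  - by rewrite (Fj false) // (negbTE c1).
  - by move=> a; rewrite (negbTE c1) M4.
- rewrite /Inv subn0; split; first split => //.
  + by rewrite /= /upd /= E23 modn_small.
  + by rewrite big_geq.
  + by do 3 apply: keep_set => //.
  + by [].
  + by move=> j h1 h2; exfalso; lia.
Qed.

Definition tab i v := inp (n * m + (i * 2 ^ k + v)).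

Definition csum s v i := \sum_(j < k) Uat s (bitn v j) j i.

Definition offcol i a := forall j, j < k -> a <> cb + addr m j i.

Lemma offcol_low i a : a < base -> offcol i a.
Proof. by move=> ha j _; rewrite /cb; lia. Qed.

Lemma offcol_high i a : i < m -> bb <= a -> offcol i a.
Proof. by move=> hi ha j hj; have := addr_lt hj hi; move: ha; rewrite /bb /cb; lia. Qed.

Lemma Uat_same s s' b j i : memsame (fun a => bb <= a) s s' ->
  Uat s' b j i = Uat s b j i.
Proof. by move=> H; apply: H; rewrite /vb /ub /bb; case: b; lia. Qed.

Lemma tri_choose_at s (I : state -> Prop) i : Glob s -> regs s 27 = i -> i < m ->
  (forall f : nat -> bool, \sum_(j < k) Uat s (f j) j i <= regs s 20) ->
  (forall s' v, keep 23 s s' -> regs s' 27 = i -> memsame (offcol i) s s' ->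
     v < 2 ^ k -> (forall j, j < k -> smem s' (cb + addr m j i) = bitn v j) ->
     ((exists2 v', v' < 2 ^ k & 0 < tab i v') -> 0 < tab i v /\
       forall v', v' < 2 ^ k -> 0 < tab i v' -> csum s v i <= csum s v' i) ->
     I s') ->
  tri ChooseAt s (t_choose_at k) I.
Proof.
move=> G E27 i_lt Htw HI; set tw := regs s 20 in Htw.
set tl := t_for (2 ^ k) (t_decode k + 8).
apply: (@tri_time _ _ _ _
  (t_mul (2 ^ k) + (1 + (1 + (1 + (tl + (1 + t_decode k).+1).+1).+1).+1).+1).+1).
  by rewrite /t_choose_at -/tl; lia.
apply: tri_seq; apply: (@tri_mul _ _ _ _ _ _ (2 ^ k) i) => // [s'' k2 m2|].
  by rewrite /= !k2 // !(GE G).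
move=> s1 k1 m1 E26; do 3 (apply: tri_seq; apply: tri_assign).
set s4 := set_reg _ _ _.
have K4 x : x < 60 -> x \notin [:: 26; 28; 29] -> regs s4 x = regs s x.
  rewrite !inE !negb_or => x1 /and3P [x2 x3 x4]; have x5 : x != 60 by lia.
  by rewrite /s4 /= /upd (negbTE x2) (negbTE x3) (negbTE x4) k1.
have M4 : smem s4 = smem s by rewrite /s4 /= m1.
have R26 : regs s4 26 = i * 2 ^ k + n * m.
  by rewrite /s4 /= /upd /= E26 k1 // !(GE G) mulnC.
have R28 : regs s4 28 = 0 by [].
have R29 : regs s4 29 = tw + 1 by rewrite /s4 /= /upd /= k1.
clearbody s4.
have tab_base v : v < 2 ^ k -> n * m + (i * 2 ^ k + v) < base.
  move=> hv; rewrite /base ltn_add2l; exact: (addr_lt i_lt hv).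
have stable s' : keep 23 s s' -> memsame (offcol i) s s' ->
    Glob s' /\ forall b j, Uat s' b j i = Uat s b j i.
  move=> kk mm; split.
    by apply: Glob_keep kk _ G => // a ha; apply: mm; apply: offcol_low.
  by move=> b j; apply: Uat_same => a ha; apply: mm; apply: offcol_high.
pose Inv t s' := exists bv, [/\ [/\ regs s' 24 = t, regs s' 26 = i * 2 ^ k + n * m,
    regs s' 27 = i, keep 23 s s' & memsame (offcol i) s s'],
    regs s' 28 = bv, bv < 2 ^ k,
    forall v', v' < t -> 0 < tab i v' -> regs s' 29 <= csum s v' i &
    (0 < tab i bv /\ regs s' 29 = csum s bv i) \/ regs s' 29 = tw + 1].
apply: tri_seq; apply: (@tri_weaken _ _ _ _ tl _ (Inv (2 ^ k))) => //.
  apply: tri_for => [t s' ht [bv [[h1 _ _ h2 _] _ _ _ _]]|t s' ht|].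
  - by rewrite h1 /= h2 // !(GE G).
  - move=> [bv [[h24 h26 h27 hk hm] h28 bv_lt hmin hbv]].
    have [G' HU] := stable s' hk hm.
    have Etab : smem s' (regs s' 26 + regs s' 24) = tab i t.
      rewrite h26 h24 /tab (GM G') //; first by congr inp; lia.
      by have := tab_base t ht; lia.
    have -> : t_decode k + 8 = (t_decode k + 7).+1 by lia.
    apply: tri_if; rewrite /= Etab => c1; last first.
      apply: (@tri_time _ _ _ _ 1) => //; first by lia.
      apply: tri_skip; exists bv; split; rewrite ?regs_same ?regs_other ?h24 //.
      + by split; rewrite ?regs_same ?regs_other ?h24 //; apply: keep_set.
      + move=> v'; rewrite ltnS leq_eqVlt => /orP [/eqP -> |]; last exact: hmin.
        by rewrite (negbTE c1).
    apply: (@tri_time _ _ _ _ (1 + (t_decode k + 4).+1).+1) => //; first by lia.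
    apply: tri_seq; apply: tri_assign; set s5 := set_reg _ _ _.
    have k5 : keep 23 s s5 by apply: keep_set.
    have G5 : Glob s5 by apply: (@Glob_keep 23 s') => //; apply: keep_set.
    apply: tri_seq; apply: (@tri_decode _ _ t i) => // s6 k6 E34 m6 _.
    have Ecs : regs s6 34 = csum s t i.
      by rewrite E34; apply: eq_bigr => j _; apply: HU.
    have k06 : keep 23 s s6 by apply: keep_trans k5 _; apply: keep_le k6.
    have m06 : memsame (offcol i) s s6 by move=> a ha; rewrite m6 // hm.
    have R6 x : 23 < x -> x < 33 -> regs s6 x = regs s' x.
      by move=> x1 x2; rewrite k6 // /s5 regs_other //; lia.
    apply: tri_if => /=; rewrite Ecs R6 // addn1 => c2.
      apply: (@tri_time _ _ _ _ (1 + 1).+1) => //.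
      apply: tri_seq; apply: tri_assign; apply: tri_assign.
      exists t; split; rewrite /= /upd /= ?Ecs ?R6 ?h24 //.
      + split; rewrite /= /upd /= ?R6 ?h24 //.
        by do 3 apply: keep_set => //.
      + move=> v'; rewrite ltnS leq_eqVlt => /orP [/eqP -> //|l1 l2].
        by apply: ltnW; apply: leq_trans c2 _; apply: hmin.
      + by left.
    apply: (@tri_time _ _ _ _ 1) => //; apply: tri_skip.
    exists bv; split; rewrite /= /upd /= ?R6 ?h24 //.
    + by split; rewrite /= /upd /= ?R6 ?h24 //; apply: keep_set.
    + move=> v'; rewrite ltnS leq_eqVlt => /orP [/eqP -> _|]; last exact: hmin.
      by move: c2; rewrite -leqNgt.
  - exists 0; split; rewrite /= /upd /= ?R28 ?R29 ?expn_gt0 //; last by right.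
    split; rewrite /= /upd /= ?R26 ?(K4 27) //.
    + apply: keep_set => // x hx; rewrite K4 //; first by lia.
      by rewrite !inE !negb_or; apply/and3P; split; lia.
    + by move=> a _; rewrite /= M4.
move=> s' [bv [[h24 h26 h27 hk hm] h28 bv_lt hmin hbv]].
have [G' HU] := stable s' hk hm.
apply: tri_seq; apply: tri_assign; set s5 := set_reg _ _ _.
have k5 : keep 23 s s5 by apply: keep_set.
have G5 : Glob s5 by apply: (@Glob_keep 23 s') => //; apply: keep_set.
apply: (@tri_decode _ _ bv i) => // s6 k6 E34 m6 b6.
apply: (HI s6 bv) => //.
- by apply: keep_trans k5 _; apply: keep_le k6.
- by rewrite k6.
- by move=> a ha; rewrite m6 // hm.
move=> [v' v'_lt tv']; case: hbv => [[h1 h2]|h2]; last first.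
  have := hmin v' v'_lt tv'; have := Htw (bitn v'); rewrite -/(csum s v' i) h2.
  by move=> h3; rewrite addn1 ltnNge h3.
by split=> // v'' h3 h4; rewrite -h2; apply: hmin.
Qed.

Definition chosen s s' i := exists v, [/\ v < 2 ^ k,
  forall j, j < k -> smem s' (cb + addr m j i) = bitn v j &
  (exists2 v', v' < 2 ^ k & 0 < tab i v') -> 0 < tab i v /\
       forall v', v' < 2 ^ k -> 0 < tab i v' -> csum s v i <= csum s v' i].

Lemma tri_choose s (I : state -> Prop) : Glob s ->
  (forall i (f : nat -> bool), i < m -> \sum_(j < k) Uat s (f j) j i <= regs s 20) ->
  (forall s', keep 23 s s' -> memsame (fun a => a < cb \/ bb <= a) s s' ->
     (forall i, i < m -> chosen s s' i) -> I s') ->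
  tri Choose s (t_choose m k) I.
Proof.
move=> G Htw HI.
pose Inv t s' := [/\ regs s' 27 = t, keep 23 s s',
   memsame (fun a => a < cb \/ bb <= a) s s' & forall i, i < t -> chosen s s' i].
apply: (@tri_weaken _ _ _ _ (t_choose m k) _ (Inv m)) => //; last first.
  by move=> s' [_ h2 h3 h4]; apply: HI.
have GI s' : keep 23 s s' -> memsame (fun a => a < cb \/ bb <= a) s s' -> Glob s'.
  by move=> kk mm; apply: Glob_keep kk _ G => // a ha; apply: mm; left.
apply: tri_for => [t s' ht [h1 h2 h3 h4]|t s' ht [h1 h2 h3 h4]|].
- by rewrite h1 /= h2 // !(GE G).
- have HU b j i : Uat s' b j i = Uat s b j i.
    by apply: Uat_same => a ha; apply: h3; right.
  have Hc v i : csum s' v i = csum s v i by apply: eq_bigr => j _; apply: HU.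
  apply: (@tri_choose_at _ _ t) => // [|f|s1 v k1 E27 m1 v_lt hbits hv]; first exact: GI.
    by under eq_bigr do rewrite HU; rewrite h2 //; apply: Htw.
  split; rewrite ?regs_same ?E27 //.
  + by apply: keep_set => //; apply: keep_trans h2 k1.
  + move=> a ha; rewrite /= m1 ?h3 //.
    by case: ha => ha; [apply: offcol_low|apply: offcol_high].
  + move=> i; rewrite ltnS leq_eqVlt => /orP [/eqP ->|lt_it].
      exists v; split => // /hv [l1 l2]; split => // v' l3 l4.
      by rewrite -!Hc; apply: l2.
    have [v0 [l1 l2 l3]] := h4 i lt_it; exists v0; split => // j hj.
    rewrite /= m1 ?l2 // => j' hj' /addnI /addr_inj [] //; first by lia.
    by move=> _ E; move: lt_it; rewrite E ltnn.
- by split => //; apply: keep_set.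
Qed.

Lemma tri_evaluate s (I : state -> Prop) : Glob s ->
  (forall s', keep 17 s s' -> memsame (fun a => a < ab) s s' ->
     regs s' 33 = \sum_(x < n) (amin (fun j => hamn (smem s) m (x * m) (cb + j * m)) m k).1 ->
     I s') ->
  tri Evaluate s (t_evaluate n m k Q) I.
Proof.
move=> G HI.
have -> : t_evaluate n m k Q =
  (t_for k (t_mul k + 2) + (1 + (1 + t_total n m k Q).+1).+1).+1.
  by rewrite /t_evaluate; lia.
pose Inv t s' := [/\ regs s' 22 = t, keep 17 s s', memsame (fun a => a < ab) s s' &
  forall j, j < t -> smem s' (ab + j) = cb + j * m].
apply: tri_seq; apply: (@tri_weaken _ _ _ _ (t_for k (t_mul k + 2)) _ (Inv k)) => //.
  apply: tri_for => [t s' ht [h1 h2 h3 h4]|t s' ht [h1 h2 h3 h4]|].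
  - by rewrite h1 /= h2 // !(GE G).
  - apply: (@tri_time _ _ _ _ (t_mul t + 1).+1).
      by have := @t_for_le t k 1 (ltnW ht); rewrite /t_mul; lia.
    apply: tri_seq; apply: (@tri_mul _ _ _ _ _ _ t m) => // [s'' k2 m2|].
      by rewrite /= !k2 // h1 h2 // !(GE G).
    move=> s1 k1 m1 E1; apply: tri_store => /=.
    rewrite E1 !k1 // h1 !h2 // !(GE G).
    split.
    + by rewrite /= /upd.
    + apply: keep_set => //; apply: keep_mem; apply: keep_trans h2 _ => x hx.
      by apply: k1; lia.
    + by move=> a ha; rewrite /= /upd ifN ?m1 ?h3 //; lia.
    + move=> j; rewrite /= /upd eqn_add2l; case: eqP => [->//|ne hj].
      by rewrite m1 h4 //; lia.
  - by split => //; apply: keep_set.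
move=> s1 [_ k1 m1 h1].
apply: tri_seq; apply: tri_assign; apply: tri_seq; apply: tri_assign.
set s3 := set_reg _ _ _.
have k3 : keep 17 s s3 by do 2 apply: keep_set => //.
have E17 : regs s3 17 = k by rewrite /s3 /= /upd /= k1 // !(GE G).
have E18 : regs s3 18 = k + 2 by rewrite /s3 /= /upd /= k1 // !(GE G).
have E0 : regs s3 0 = n by rewrite k3 // !(GE G).
have E1 : regs s3 1 = m by rewrite k3 // !(GE G).
have E2 : regs s3 2 = k by rewrite k3 // !(GE G).
have E4 : regs s3 4 = Q by rewrite k3 // !(GE G).
have E13 : regs s3 13 = ab by rewrite k3 // !(GE G).
rewrite -{1}E0 -{1}E1 -{1}E17 -{1}E4; apply: tri_total => s4 k4 m4 E33.
apply: HI.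
- by apply: keep_trans k3 _; apply: keep_le k4.
- by move=> a ha; rewrite m4 /s3 /= m1.
rewrite E33 E0; apply: eq_bigr => x _; rewrite E1 /wgt /wt E18 E2.
rewrite !ifN -?ltnNge; try lia.
rewrite /dist_s E17 E1 E13; congr (_.1); apply: eq_amin => j hj.
rewrite /s3 /= h1 //; apply: eq_bigr => i _; congr (_ != _); apply: m1.
  have := ltn_ord x; have := ltn_ord i => h h'.
  by have := addr_lt h' h; rewrite /addr /ab /base; lia.
by have := addr_lt hj (ltn_ord i); rewrite /addr /ab /cb; lia.
Qed.

Lemma tri_update s (I : state -> Prop) : Glob s ->
  (forall s', keep 15 s s' -> regs s' 16 = regs s 16 ->
     memsame (fun a => a < bb \/ ub <= a) s s' ->
     (regs s 33 < regs s 15 -> regs s' 15 = regs s 33 /\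
        forall o, o < k * m -> smem s' (bb + o) = smem s (cb + o)) ->
     (regs s 15 <= regs s 33 -> regs s' 15 = regs s 15 /\ smem s' = smem s) ->
     I s') ->
  tri Update s (t_update m k) I.
Proof.
move=> G HI; have -> : t_update m k = (t_for (k * m) 1 + 2).+1 by rewrite /t_update; lia.
apply: tri_if => /=; rewrite addn1 => c1; last first.
  apply: (@tri_time _ _ _ _ 1); first by lia.
  by apply: tri_skip; apply: HI => //; rewrite (negbTE c1).
apply: (@tri_time _ _ _ _ (1 + t_for (k * m) 1).+1); first by lia.
apply: tri_seq; apply: tri_assign.
pose Inv t s' := [/\ regs s' 27 = t,
  forall x, x != 27 -> regs s' x = regs (set_reg s 15 (regs s 33)) x,
  memsame (fun a => a < bb \/ ub <= a) s s' &
  forall o, o < t -> smem s' (bb + o) = smem s (cb + o)].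
apply: (@tri_weaken _ _ _ _ (t_for (k * m) 1) _ (Inv (k * m))) => //; last first.
  move=> s' [_ h2 h3 h4]; apply: HI => //.
  - move=> x hx; rewrite h2 ?regs_other //; lia.
  - by rewrite h2.
  - by rewrite h2 // regs_same.
  - by rewrite leqNgt c1.
apply: tri_for => [t s' ht [h1 h2 h3 h4]|t s' ht [h1 h2 h3 h4]|].
- rewrite h1 /= !h2 // !regs_other // !(GE G); split => //.
  by rewrite /bb /cb; lia.
- apply: tri_store => /=; rewrite h1 !h2 // !regs_other // !(GE G).
  have Et : smem s' (cb + t) = smem s (cb + t).
    by apply: h3; left; rewrite /bb /cb ltn_add2l.
  rewrite Et; split.
  + by rewrite /= /upd.
  + by move=> x hx; rewrite regs_other // h2.
  + move=> a ha; rewrite /= /upd ifN ?h3 //.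
    by apply/eqP; case: ha; rewrite /ub /bb; lia.
  + move=> o ho; rewrite /= /upd eqn_add2l; case: eqP => [->//|ne].
    by rewrite h4 //; lia.
- by split => // x hx; rewrite regs_other.
Qed.

Lemma tri_init_trial s (I : state -> Prop) : Glob s ->
  (forall s', keep 17 s s' -> memsame (fun a => a < ub) s s' ->
     [/\ regs s' 20 = 0, regs s' 17 = 1, regs s' 18 = k + 2 & regs s' 19 = 0] ->
     smem s' ab = 0 ->
     (forall b j i, j < k -> i < m -> Uat s' b j i = 0) -> I s') ->
  tri InitTrial s (t_init_trial m k) I.
Proof.
move=> G HI.
pose Inv t s' := [/\ regs s' 27 = t, keep 17 s s',
  memsame (fun a => a < ub) s s' &
  forall o, o < t -> smem s' (ub + o) = 0].
apply: (@tri_time _ _ _ _ (t_for (2 * (k * m)) 1 +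
   (1 + (1 + (1 + (1 + 1).+1).+1).+1).+1).+1).
  by rewrite /t_init_trial; lia.
apply: tri_seq; apply: (@tri_weaken _ _ _ _ (t_for (2 * (k * m)) 1) _ (Inv (2 * (k * m)))) => //.
  apply: tri_for => [t s' ht [h1 h2 h3 h4]|t s' ht [h1 h2 h3 h4]|].
  - rewrite h1 /= !h2 // !(GE G); split => //; rewrite /ab /ub; lia.
  - apply: tri_store => /=; rewrite h1 !h2 // !(GE G); split.
    + by rewrite /= /upd.
    + by apply: keep_set.
    + by move=> a ha; rewrite /= /upd ifN ?h3 //; lia.
    + move=> o ho; rewrite /= /upd eqn_add2l; case: eqP => [_ //|ne].
      by rewrite h4 //; lia.
  - by split => //; apply: keep_set.
move=> s1 [_ k1 m1 z1].
apply: tri_seq; apply: tri_assign; apply: tri_seq; apply: tri_assign.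
apply: tri_seq; apply: tri_store; apply: tri_seq; apply: tri_assign; apply: tri_assign.
rewrite /= /upd /= !k1 // !(GE G).
apply: HI.
- by do 2 apply: keep_set => //; apply: keep_mem; do 2 apply: keep_set => //.
- by move=> a ha; rewrite /= /upd ifN ?m1 //; move: ha; rewrite /ub /ab; lia.
- by [].
- by rewrite /= /upd eqxx.
- move=> b j i hj hi; have := addr_lt hj hi => L.
  rewrite /Uat /= /upd ifN; last by rewrite /vb /ub /ab; case: b; lia.
  case: b; last by apply: z1; lia.
  have -> : vb + addr m j i = ub + (k * m + addr m j i) by rewrite /vb /ub; lia.
  by apply: z1; lia.
Qed.

End Programs.

(** * Success of the guesses *)

Lemma amin_le D b n : (amin D b n).1 <= b /\ forall l, l < n -> (amin D b n).1 <= D l.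
Proof.
elim: n => [|n [IH1 IH2]] /=; first by split.
case: ltnP => h /=; split.
- exact: leq_trans (ltnW h) IH1.
- move=> l; rewrite ltnS leq_eqVlt => /orP [/eqP -> //|/IH2 h2].
  exact: leq_trans (ltnW h) h2.
- exact: IH1.
- by move=> l; rewrite ltnS leq_eqVlt => /orP [/eqP -> //|/IH2].
Qed.

Lemma amin_attained D b n : 0 < n -> (forall l, l < n -> D l <= b) ->
  (amin D b n).2 < n /\ D (amin D b n).2 = (amin D b n).1.
Proof.
move=> n0 hD.
have : (amin D b n = (b, 0)) \/
   ((amin D b n).2 < n /\ D (amin D b n).2 = (amin D b n).1).
  elim: n {n0 hD} => [|n IH] /=; first by left.
  case: ltnP => h /=; first by right.
  by case: IH => [->|[h1 h2]]; [left|right; split => //; apply: ltnW].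
case=> // E; rewrite E /=; split => //; apply/eqP.
by rewrite eqn_leq hD //=; have [_ /(_ 0 n0)] := amin_le D b n; rewrite E.
Qed.

(** * Hamming distance to a list of anchors *)

Section Hamming.

Variable m : nat.
Implicit Types x y z : m.-tuple bool.

Lemma hdistE x y : hdist x y = \sum_(i < m) (tnth x i != tnth y i).
Proof.
rewrite /hdist -sum1_card; under eq_bigl do rewrite inE.
by rewrite big_mkcond; apply: eq_bigr => i _; case: (_ == _).
Qed.

Lemma hdist_le x y : hdist x y <= m.
Proof. by rewrite -[m in _ <= m]card_ord max_card. Qed.

Lemma hdistC x y : hdist x y = hdist y x.
Proof. by rewrite !hdistE; apply: eq_bigr => i _; rewrite eq_sym. Qed.

Lemma hdist_tri x y z : hdist x z <= hdist x y + hdist y z.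
Proof.
rewrite !hdistE -big_split; apply: leq_sum => i _ /=.
by case: (tnth x i) (tnth y i) (tnth z i) => -[] [].
Qed.

Lemma hdist_setP x (Y : {set m.-tuple bool}) :
  (forall y, y \in Y -> hdist_set x Y <= hdist x y) /\
  (forall v, v <= m -> (forall y, y \in Y -> v <= hdist x y) -> v <= hdist_set x Y).
Proof.
rewrite /hdist_set; split=> [y yY|v vm vY].
  elim: (index_enum _) (mem_index_enum y) => // a s IH.
  rewrite inE big_cons => /orP [/eqP <-|/IH h]; first by rewrite yY geq_minl.
  by case: ifP => // _; rewrite geq_min h orbT.
by elim/big_ind: _ => // a b; rewrite leq_min => -> ->.
Qed.

Definition mdT (A : seq (m.-tuple bool)) x :=
  amin (fun l => hdist x (nth x A l)) m (size A).

Definition dT A x := (mdT A x).1.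
Definition cellT A x := (mdT A x).2.

Lemma dT_le A x l y0 : l < size A -> dT A x <= hdist x (nth y0 A l).
Proof.
move=> hl; rewrite (set_nth_default x) //.
by have [_ h] := amin_le (fun l => hdist x (nth x A l)) m (size A); apply: h.
Qed.

Lemma cellTP A x y0 : 0 < size A ->
  cellT A x < size A /\ hdist x (nth y0 A (cellT A x)) = dT A x.
Proof.
move=> A0; have [|h1 h2] := @amin_attained (fun l => hdist x (nth x A l)) m _ A0.
  by move=> l _; apply: hdist_le.
by split => //; rewrite (set_nth_default x).
Qed.

Lemma dT_mem A x z : z \in A -> dT A x <= hdist x z.
Proof. by move=> zA; rewrite -[z in hdist x z](nth_index x zA) dT_le ?index_mem. Qed.

Lemma dT_lip A x y : 0 < size A -> dT A x <= hdist x y + dT A y.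
Proof.
move=> A0; have [h1 h2] := cellTP y x A0; rewrite -h2.
by apply: leq_trans (dT_le x x h1) (hdist_tri _ _ _).
Qed.

Lemma dT_rcons A x z : 0 < size A -> dT (rcons A z) x <= dT A x /\ dT (rcons A z) x <= hdist x z.
Proof.
move=> A0; split; last by apply: dT_mem; rewrite mem_rcons mem_head.
have [h1 h2] := cellTP x x A0; rewrite -h2; apply: dT_mem.
by rewrite mem_rcons inE mem_nth ?orbT.
Qed.

Lemma cost_entries k (X : {set m.-tuple bool}) (C : k.-tuple (m.-tuple bool)) :
  0 < k -> cost X (entries C) = \sum_(x in X) dT C x.
Proof.
move=> k0; apply: eq_bigr => x _; have [h1 h2] := hdist_setP x (entries C).
have C0 : 0 < size C by rewrite size_tuple.
apply/eqP; rewrite eqn_leq; apply/andP; split.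
  have [c1 c2] := cellTP x x C0; rewrite -c2; apply: h1.
  by rewrite inE mem_nth.
apply: h2; first by have [] := amin_le (fun l => hdist x (nth x C l)) m (size C).
by move=> y; rewrite inE => yC; apply: dT_mem.
Qed.

Lemma cost_le_assign k (X : {set m.-tuple bool}) (C : k.-tuple (m.-tuple bool))
    (f : m.-tuple bool -> 'I_k) :
  cost X (entries C) <= \sum_(x in X) hdist x (tnth C (f x)).
Proof.
apply: leq_sum => x _; have [h1 _] := hdist_setP x (entries C).
by apply: h1; rewrite inE mem_tnth.
Qed.

Lemma cost_le_max (X : {set m.-tuple bool}) Y : cost X Y <= #|X| * m.
Proof.
rewrite -sum_nat_const; apply: leq_sum => x _.
rewrite /hdist_set; elim/big_ind: _ => // [a b ha hb|y _]; last exact: hdist_le.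
by rewrite geq_min ha.
Qed.

Lemma OPT_attained k (X : {set m.-tuple bool}) (Rs : m.-tuple {set k.-tuple bool}) :
  (exists C, satisfies Rs C) ->
  exists2 C, satisfies Rs C & cost X (entries C) <= OPT X Rs.
Proof.
move=> [C0 sC0]; rewrite /OPT.
elim/big_ind: _ => [|a b [C1 h1 h2] [C2 h3 h4]|C sC].
- by exists C0 => //; exact: cost_le_max.
- by case: (leqP a b) => _; [exists C1|exists C2].
- by exists C.
Qed.

End Hamming.

(** * Success events of a trial and their probabilities *)

Section Instance.

Variables (R : realType) (m k : nat) (X : {set m.-tuple bool}).
Variables (Rs : m.-tuple {set k.-tuple bool}) (E Q r BI M : nat).
Variables (row0 : m.-tuple bool) (C0 : k.-tuple (m.-tuple bool)) (j0 : 'I_k).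

Local Notation T := (m.-tuple bool).

Hypothesis E_gt1 : 1 < E.
Hypothesis Q_E : Q = 64 * E.
Hypothesis r_E : r = 2 * Q ^ 2.
Hypothesis BI_ge : 216 * Q ^ 2 * k ^ 2 <= BI.
Hypothesis M_ge : Q * BI <= M.
Hypothesis C0_sat : satisfies Rs C0.
Hypothesis C0_opt : cost X (entries C0) <= OPT X Rs.

Let k0 : 0 < k. Proof. by case: j0 => i; apply: leq_ltn_trans. Qed.
Let Q0 : 0 < Q. Proof. by rewrite Q_E muln_gt0 /=; apply: ltnW. Qed.
Let cc j := tnth C0 j.
Definition jX (x : T) : 'I_k := [arg min_(j < j0) hdist x (tnth C0 j)].
Let opt := \sum_(x in X) hdist x (cc (jX x)).

Lemma opt_le : opt <= OPT X Rs.
Proof.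
apply: leq_trans C0_opt; rewrite cost_entries //; apply: leq_sum => x _.
have [|h1 <-] := @cellTP m C0 x x; first by rewrite size_tuple.
rewrite size_tuple in h1; rewrite /jX; case: arg_minnP => // j _ hj.
by have := hj (Ordinal h1) isT; rewrite [tnth _ (Ordinal _)](tnth_nth x).
Qed.

Definition dsum A := \sum_(x in X) dT A x.

Local Notation badA A := (badj X (@hdist m) cc jX (dT A)).

(** The potential of the seeding phase when [i] anchors are still to be drawn: each successful draw
    covers a further cluster, unless the goal [18 opt] is already met. *)
Definition good1 A i := (dsum A <= 18 * opt) || (#|badA A| <= i).

Lemma good1_0 A : good1 A 0 -> dsum A <= 18 * opt.
Proof.
case/orP => //; rewrite leqn0 cards_eq0 => /eqP b0.
rewrite /dsum /opt (sum_cluster X jX) (sum_cluster X jX (fun x => hdist x _)).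
rewrite big_distrr /=; apply: leq_sum => j _.
have : j \notin badA A by rewrite b0 inE.
rewrite inE -leqNgt => /leq_trans; apply; rewrite leq_mul2r; apply/orP; right; by [].
Qed.

Lemma dsum_rcons A x : 0 < size A -> dsum (rcons A x) <= dsum A.
Proof. by move=> A0; apply: leq_sum => y _; have [] := dT_rcons y x A0. Qed.

Lemma anchor_step A i : 0 < size A -> good1 A i.+1 ->
  if dsum A == 0 then forall x, good1 (rcons A x) i else
  (6^-1 <= (\sum_(x in X) (dT A x)%:R * (good1 (rcons A x) i)%:R) / (dsum A)%:R :> R)%R.
Proof.
move=> A0 g1.
have [le|gt] := leqP (dsum A) (18 * opt).
  have gT x : good1 (rcons A x) i.
    by apply/orP; left; apply: leq_trans le; apply: dsum_rcons.
  case: eqP => [//|/eqP ne].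
  under eq_bigr do rewrite gT mulr1.
  by rewrite -natr_sum divff ?pnatr_eq0 // invf_le1 // ler1n.
have d0 : dsum A != 0 by rewrite -lt0n; apply: leq_ltn_trans gt.
rewrite (negbTE d0); move: g1; rewrite /good1 leqNgt gt /= => bi.
have [Z hZ hgood] := seeding_step (@hdistC m) (@hdist_tri m) (fun x y => dT_lip x y A0) gt.
apply: (@le_trans _ _ ((\sum_(x in X | x \in Z) dT A x)%:R / (dsum A)%:R)%R).
  rewrite ler_pdivlMr ?ltr0n ?lt0n // mulrC ler_pdivrMr // mulrC -natrM ler_nat.
  exact: hZ.
rewrite ler_wpM2r ?invr_ge0 ?ler0n // natr_sum big_mkcondr /=.
apply: ler_sum => x xX; case: ifP => [xZ|_]; last by rewrite mulr_ge0 ?ler0n.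
rewrite (_ : _ || _); first by rewrite mulr1.
apply/orP; right; rewrite -ltnS; apply: leq_trans bi; apply: (hgood x) => // y yX.
exact: dT_rcons.
Qed.


Definition aA (A : seq T) (l : 'I_k.+1) := nth row0 A l.
Definition cellA (A : seq T) (x : T) : 'I_k.+1 := inord (cellT A x).
Local Notation farA A := (far X (@hdist m) cc jX Q (aA A) (cellA A)).
Local Notation newA A := (newj X (@hdist m) cc jX Q (aA A) (cellA A) j0).

Lemma dAE A x : size A = k.+1 -> hdist x (aA A (cellA A x)) = dT A x.
Proof.
move=> sA; have [|h1 h2] := cellTP x row0 (A := A); first by rewrite sA.
by rewrite /aA /cellA inordK // -sA.
Qed.

Lemma dA_minE A x l : size A = k.+1 ->
  hdist x (aA A (cellA A x)) <= hdist x (aA A l).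
Proof. by move=> sA; rewrite dAE // /aA dT_le // sA. Qed.

Definition farset_of (A : seq T) j := [set x in X | farA A x && (newA A x == j)].

(** A usable threshold: the set it cuts out contains the far group of [j], and a uniform sample of
    it hits that group with probability at least [1 / BI] whenever there is something to hit. *)
Definition good2 A j th :=
  [forall x in farset_of A j, th <= 6 * (Q * dT A x)] &&
  ((farset_of A j != set0) ==>
   (#|[set x in X | th <= 6 * (Q * dT A x)]| <= BI * #|farset_of A j|)).

Lemma good2_empty A j th : farset_of A j = set0 -> good2 A j th.
Proof. by move=> E0; rewrite /good2 E0 eqxx andbT; apply/forall_inP => x; rewrite inE. Qed.

Lemma card_sum1 (P : pred T) : #|[set x in X | P x]| = \sum_(x in X | P x) 1.
Proof. by rewrite -sum1_card; apply: eq_bigl => x; rewrite inE. Qed.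

Lemma BI_gt0 : 0 < BI.
Proof. by apply: leq_trans BI_ge; rewrite !(muln_gt0, expn_gt0) Q0 k0. Qed.

Lemma W_E A : size A = k.+1 -> \sum_(x in X) hdist x (aA A (cellA A x)) = dsum A.
Proof. by move=> sA; apply: eq_bigr => x _; rewrite dAE. Qed.

Lemma thr_step A j : size A = k.+1 -> dsum A <= 18 * opt ->
  if dsum A == 0 then good2 A j 0 else
  (BI%:R^-1 <= (\sum_(x in X) (dT A x)%:R * (good2 A j (dT A x))%:R) / (dsum A)%:R :> R)%R.
Proof.
move=> sA le.
have [E0|/set0Pn [x0]] := eqVneq (farset_of A j) set0.
  case: eqP => [_|/eqP ne]; first exact: good2_empty.
  under eq_bigr do rewrite good2_empty // mulr1.
  by rewrite -natr_sum divff ?pnatr_eq0 // invf_le1 ?ltr0n ?ler1n ?BI_gt0.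
rewrite inE => /and3P [x0X fx0 nx0].
have x0_gt : 0 < dT A x0 by rewrite -dAE //; apply: far_gt0 fx0.
have d0 : dsum A != 0.
  by rewrite -lt0n; apply: leq_trans x0_gt _; rewrite /dsum (bigD1 x0) //= leq_addr.
rewrite (negbTE d0).
have [||Z hZ hgood] := @far_group _ X _ (@hdist_tri m) _ cc jX _ Q (aA A) (cellA A) j0
  (fun x l _ => dA_minE x l sA) Q0 _ j.
- by rewrite W_E.
- by exists x0 => //; rewrite fx0.
have gd z : z \in X -> z \in Z -> good2 A j (dT A z).
  move=> zX zZ; have [h1 h2] := hgood z zX zZ; rewrite !dAE // in h1 h2.
  apply/andP; split.
    apply/forall_inP => x; rewrite inE => /andP [xX fx].
    by have := h1 x xX fx; rewrite dAE.
  apply/implyP => _; rewrite !card_sum1.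
  apply: leq_trans (leq_trans _ h2) _.
    by apply/eq_leq/eq_bigl => x; rewrite dAE.
  rewrite leq_mul2r; apply/orP; right; apply: leq_trans BI_ge.
  by rewrite leq_mul2l -mulnn leq_pmull ?orbT.
apply: (@le_trans _ _ ((\sum_(x in X | x \in Z) dT A x)%:R / (dsum A)%:R)%R).
  rewrite ler_pdivlMr ?ltr0n ?lt0n // mulrC ler_pdivrMr ?ltr0n ?BI_gt0 // mulrC -natrM ler_nat.
  rewrite -(W_E sA); apply: leq_trans hZ _.
  rewrite (eq_bigr (dT A)) => [|x _]; last by rewrite dAE.
  rewrite leq_mul2r; apply/orP; right; apply: leq_trans BI_ge.
  by rewrite -!mulnn; move: Q0 k0; nia.
rewrite ler_wpM2r ?invr_ge0 ?ler0n // natr_sum big_mkcondr /=.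
apply: ler_sum => x xX; case: ifP => [xZ|_]; last by rewrite mulr_ge0 ?ler0n.
by rewrite gd // mulr1.
Qed.

(** The set the machine samples for a group [(l, j)]: cell [l] when [l <= k], the points selected by
    the threshold of [j] when [l = k + 1]. *)
Definition BB A (th : seq nat) (g : nat * nat) : {set T} :=
  [set x in X | 0 < wt k Q g.1 (nth 0 th g.2) (mdT A x)].

(** The weight is one that the machine can guess, and the target [Sg g] is hit with probability at
    least [1 / BI]. For an empty [BB] the sampler returns [row0]. *)
Definition specok A th (Sg : nat * nat -> {set T}) (wg : nat * nat -> nat) g :=
  (exists2 t, t <= M & wg g = t * #|BB A th g|) /\
  ((BB A th g = set0 /\ Sg g = [set row0]) \/
   [/\ Sg g \subset BB A th g, Sg g != set0 & #|BB A th g| <= BI * #|Sg g|]).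

Definition goal_cost c := E * c <= (E + 1) * OPT X Rs.

(** Quantifying over all columnwise minimizers makes the event independent of how the machine breaks
    ties. *)
Definition goodu (u : bool -> nat -> nat -> nat) : bool :=
  [forall C : k.-tuple T, (satisfies Rs C &&
    [forall i : 'I_m, forall b in tnth Rs i,
      \sum_(j < k) u (tnth (tnth C j) i) j i <= \sum_(j < k) u (tnth b j) j i])
    ==> goal_cost (cost X (entries C))].

Lemma eq_goodu u u' : (forall b j i, j < k -> i < m -> u b j i = u' b j i) ->
  goodu u = goodu u'.
Proof.
move=> E'; apply: eq_forallb => C; congr (_ ==> _); congr (_ && _).
apply: eq_forallb => i; apply: eq_forallb => b; congr (_ ==> _).
by congr (_ <= _); apply: eq_bigr => j _; rewrite E'.
Qed.

Definition addT (w j : nat) (x : T) (u : bool -> nat -> nat -> nat) b j' i :=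
  u b j' i + (if j' == j then w * (nth false x i != b) else 0).

(** A lower bound for the chance that one draw guesses the right weight among [M + 1] and falls in
    its group. *)
Definition kappa : R := ((M.+1 * BI)%:R^-1)%R.

Lemma kappa_ge0 : (0 <= kappa)%R.
Proof. by rewrite invr_ge0 ler0n. Qed.

(** A lower bound for the success probability when the draws [L] remain and the counters are [u]:
    only runs in which every guess is right and every sample falls in its target are counted. Given
    this, the samples are independent and uniform on the targets. *)
Fixpoint V (Sg : nat * nat -> {set T}) (wg : nat * nat -> nat) L u : R :=
  (if L is g :: L' then
    kappa * avg (Sg g) (fun x => V Sg wg L' (addT (wg g) g.2 x u))
  else (goodu u)%:R)%R.

Lemma V_ge0 Sg wg L u : (0 <= V Sg wg L u)%R.
Proof.
elim: L u => [|g L IH] u /=; first exact: ler0n.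
by rewrite mulr_ge0 ?kappa_ge0 // divr_ge0 ?ler0n // sumr_ge0.
Qed.

Lemma eq_V Sg wg L u u' : (forall b j i, j < k -> i < m -> u b j i = u' b j i) ->
  V Sg wg L u = V Sg wg L u'.
Proof.
elim: L u u' => [|g L IH] u u' H /=; first by rewrite (eq_goodu H).
congr (_ * _)%R; apply: eq_avg => x; apply: IH => b j i hj hi.
by rewrite /addT H.
Qed.

Lemma V_Ex Sg wg L u : V Sg wg L u = (kappa ^+ size L *
  Ex (map Sg L) (fun ys => (goodu (fun b j i => (u b j i +
     \sum_(p <- zip L ys | p.1.2 == j) wg p.1 * (nth false p.2 i != b))%N))%:R))%R.
Proof.
elim: L u => [|g L IH] u.
  rewrite /= mul1r; congr (_%:R)%R; congr nat_of_bool; apply: eq_goodu => b j i _ _.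
  by rewrite big_nil addn0.
rewrite [LHS]/= exprS -mulrA; congr (_ * _)%R.
rewrite [Ex _ _]/= -avgZ; apply: eq_avg => x; rewrite IH; congr (_ * _)%R.
apply: eq_Ex => ys; congr (_%:R)%R; congr nat_of_bool; apply: eq_goodu => b j i _ _.
rewrite [zip _ _]/= big_cons /addT /=; case: eqP => [->|ne].
  by rewrite eqxx addnA.
by case: eqP => [E'|_]; [case: ne|rewrite addn0].
Qed.

(** Suffixes of the sampling schedule, so that the nested loops can refer to the draws that
    remain. *)
Definition Lrow (l j : nat) := flatten [seq nseq r (l, j') | j' <- iota j (k - j)].
Definition Lfrom (l : nat) := flatten [seq Lrow l' 0 | l' <- iota l (k.+2 - l)].

Lemma size_Lfrom : size (Lfrom 0) = k.+2 * (k * r).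
Proof.
rewrite /Lfrom subn0 size_flatten /shape -map_comp sumnE big_map.
rewrite (eq_bigr (fun=> k * r)) => [|l _ /=].
  by rewrite big_const_seq count_predT size_iota iter_addn_0 mulnC.
rewrite /Lrow subn0 size_flatten /shape -map_comp sumnE big_map.
rewrite (eq_bigr (fun=> r)) => [|j _ /=]; last by rewrite size_nseq.
by rewrite big_const_seq count_predT size_iota iter_addn_0 mulnC.
Qed.

Let Gt : finType := ('I_k.+2 * 'I_k)%type.
Let vg (g : Gt) : nat * nat := (val g.1, val g.2).
Let Lfin : seq Gt :=
  flatten [seq flatten [seq nseq r (l, j) | j <- enum 'I_k] | l <- enum 'I_k.+2].

Lemma Lfin_val : map vg Lfin = Lfrom 0.
Proof.
rewrite /Lfin /Lfrom map_flatten -map_comp subn0 -(val_enum_ord k.+2) -map_comp.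
congr flatten; apply: eq_map => l /=.
rewrite /Lrow map_flatten -map_comp subn0 -(val_enum_ord k) -map_comp.
by congr flatten; apply: eq_map => j /=; rewrite map_nseq.
Qed.

Lemma Lfin_count g : count_mem g Lfin = r.
Proof.
rewrite /Lfin count_flatten -map_comp sumnE big_map big_enum /=.
rewrite (eq_bigr (fun l => if l == g.1 then r else 0)) => [|l _].
  by rewrite -big_mkcond big_pred1_eq.
rewrite count_flatten -map_comp sumnE big_map big_enum /=.
rewrite (eq_bigr (fun j => if (l == g.1) && (j == g.2) then r else 0)) => [|j _].
  case: (l == g.1) => /=; first by rewrite -big_mkcond big_pred1_eq.
  by rewrite big1_eq.
rewrite /= count_nseq; case: g => g1 g2 /=.
by rewrite -[(_, _) == _]/((l == g1) && (j == g2)); case: (_ && _); rewrite ?mul1n ?mul0n.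
Qed.

(** The reassigned clustering serves as the reference solution: its groups are the targets, and
    [okys_prob] with [okys_cost] bounds the loss against it. *)
Lemma V_full A th : size A = k.+1 -> dsum A <= 18 * opt ->
  (forall j : 'I_k, good2 A j (nth 0 th j)) ->
  exists Sg wg, (forall l j, l < k.+2 -> j < k -> specok A th Sg wg (l, j)) /\
    (kappa ^+ (k.+2 * (k * r)) / 2 <= V Sg wg (Lfrom 0) (fun _ _ _ => 0%N))%R.
Proof.
move=> sA le gth.
have cell_lt x : cellT A x < k.+1.
  by rewrite -sA; have [|] := cellTP x x (A := A); first by rewrite sA.
have cell_le x : cellT A x <= k by rewrite -ltnS cell_lt.
(* Near points are grouped by cell and new cluster; far points share the extra row [k + 1], one
   group for each cluster. *)
pose l_of x := if farA A x then k.+1 else cellT A x.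
have l_of_lt x : l_of x < k.+2.
  by rewrite /l_of; case: ifP => // _; apply: ltnW; rewrite ltnS.
pose grp x : Gt := (Ordinal (l_of_lt x), newA A x).
pose G := grpset X grp.
pose B g := BB A th (vg g).
have grpE y (l : 'I_k.+2) j : (grp y == (l, j)) = (l_of y == l) && (newA A y == j).
  by [].
have GB g : G g \subset B g.
  apply/subsetP => x; rewrite !inE => /andP [xX /eqP <-]; rewrite xX /= /wt /l_of.
  case fx: (farA A x); last by rewrite cell_le eqxx.
  rewrite ltnn addn1 leqnn lt0b.
  have /andP [/forall_inP h _] := gth (newA A x); apply: h.
  by rewrite inE xX fx eqxx.
have B_le g : G g != set0 -> #|B g| <= BI * #|G g|.
  case: g => l j; case/set0Pn => x; rewrite inE => /andP [xX /eqP [El Ej]].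
  have l_E : val l = l_of x by rewrite -El.
  case fx: (farA A x).
    have lE : val l = k.+1 by rewrite l_E /l_of fx.
    have EG : G (l, j) = farset_of A j.
      apply/setP => y; rewrite !inE grpE lE /l_of.
      case: (y \in X) => //=; case: (farA A y) => /=; first by rewrite eqxx.
      by rewrite (ltn_eqF (cell_lt y)).
    have EB : B (l, j) = [set y in X | nth 0 th j <= 6 * (Q * dT A y)].
      by apply/setP => y; rewrite !inE /= lE /wt ltnn addn1 leqnn lt0b.
    rewrite EG EB; have /andP [_ /implyP] := gth j; apply.
    by apply/set0Pn; exists x; rewrite inE xX fx -Ej eqxx.
  have lE : val l = cellT A x by rewrite l_E /l_of fx.
  have EB : #|B (l, j)| = cellsz X (cellA A) (cellA A x).
    rewrite /cellsz -card_sum1; congr #|pred_of_set _|; apply/setP => y.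
    by rewrite !inE /= lE /wt cell_le lt0b -val_eqE /= !inordK.
  rewrite EB; have := @near_group _ X (@hdist m) _ cc jX _ Q (aA A) (cellA A) j0 Q0 x xX.
  rewrite fx => /(_ isT) h; apply: leq_trans h _.
  have EG : \sum_(y in X | [&& ~~ farA A y, cellA A y == cellA A x & newA A y == newA A x]) 1 = #|G (l, j)|.
    rewrite -card_sum1; congr #|pred_of_set _|; apply/setP => y.
    rewrite !inE grpE lE -Ej /l_of.
    case: (y \in X) => //=; case: (farA A y) => /=.
      by rewrite gtn_eqF // cell_lt.
    by rewrite -val_eqE /= !inordK.
  rewrite EG leq_mul2r; apply/orP; right; apply: leq_trans BI_ge.
  by rewrite leq_mul2r -mulnn; apply/orP; right; move: Q0; nia.
(* An empty group gets weight 0, so its sample may be arbitrary: the target is then everything the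
   sampler can return. *)
pose Sf g := if G g != set0 then G g else if B g != set0 then B g else [set row0].
(* The best multiple of [#|B g|] below [M * #|G g|]; the remainder is less than
   [#|B g| <= BI * #|G g|], a [1 / Q] fraction because [Q * BI <= M]. *)
pose tf g := if G g != set0 then (M * #|G g|) %/ #|B g| else 0.
pose wf g := tf g * #|B g|.
pose bk (g : nat * nat) : Gt := (inord g.1, insubd j0 g.2).
have bkK g : bk (vg g) = g.
  by case: g => l j; rewrite /bk /vg /= inord_val; congr (_, _); apply: val_inj; rewrite val_insubd ltn_ord.
have Gle g : #|G g| <= #|B g| by apply: subset_leq_card.
have Gpos g : G g != set0 -> 0 < #|G g| by rewrite card_gt0.
have wf_le g : wf g <= M * #|G g|.
  by rewrite /wf /tf; case: ifP => // _; apply: leq_divM.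
have wf_ge g : Q * (M * #|G g| - wf g) <= M * #|G g|.
  have [E0|G0] := eqVneq (G g) set0; first by rewrite E0 cards0 muln0 sub0n muln0.
  rewrite /wf /tf G0; set a := M * _; have Bp : 0 < #|B g| := leq_trans (Gpos g G0) (Gle g).
  have -> : a - a %/ #|B g| * #|B g| = a %% #|B g| by rewrite {1}(divn_eq a #|B g|) addKn.
  apply: leq_trans (leq_mul (leqnn Q) (ltnW (ltn_pmod a Bp))) _.
  apply: leq_trans (leq_mul (leqnn Q) (B_le g G0)) _.
  by rewrite mulnA leq_mul2r M_ge orbT.
have Sf0 g : Sf g != set0.
  rewrite /Sf; case: ifP => // _; case: ifP => // _.
  by apply/set0Pn; exists row0; rewrite inE.
have Q2 : 2 < Q by rewrite Q_E; lia.
have M0 : 0 < M by apply: leq_trans M_ge; rewrite muln_gt0 Q0 BI_gt0.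
exists (Sf \o bk), (wf \o bk); split=> [l j hl hj|].
  rewrite /specok /=; set g := bk _.
  have vgE : vg g = (l, j).
    by rewrite /vg /g /bk /= inordK // val_insubd hj.
  rewrite -vgE -/(B g); split.
    exists (tf g) => //; rewrite /tf; case: ifP => // G0.
    rewrite -ltnS ltn_divLR ?(leq_trans (Gpos g G0) (Gle g)) //.
    rewrite mulSn; have : M * #|G g| <= M * #|B g| by rewrite leq_mul2l Gle orbT.
    by have := leq_trans (Gpos g G0) (Gle g); lia.
  rewrite /Sf; case: ifP => [G0|/negbFE/eqP G0].
    by right; split => //; apply: B_le.
  case: ifP => [B0|/negbFE/eqP ->]; last by left.
  by right; split => //; rewrite leq_pmull ?BI_gt0.
rewrite V_Ex size_Lfrom ler_wpM2l ?exprn_ge0 ?kappa_ge0 //.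
rewrite -Lfin_val -map_comp.
rewrite (eq_map (g := Sf)); last by move=> g /=; rewrite bkK.
pose bit (x : T) (i : 'I_m) := tnth x i.
pose c0 (j : 'I_k) (i : 'I_m) := tnth (cc j) i.
have SG g : G g != set0 -> Sf g = G g by rewrite /Sf => ->.
apply: le_trans (@okys_prob R _ X _ _ bit c0 Gt grp snd Sf Q r Lfin SG Sf0 Lfin_count r_E Q2) _.
apply: ler_Ex => ys; rewrite size_map => sy.
case ok: (okys _ _ _ _ _ _ _ _ _ _); last by rewrite ler0n.
rewrite ler_nat lt0b; apply/forallP => C; apply/implyP => /andP [sC /forallP hmin].
pose c1 (j : 'I_k) (i : 'I_m) := tnth (tnth C j) i.
have := @okys_cost R _ X _ _ bit c0 Gt grp snd wf Q M r Lfin wf_le wf_ge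
  Lfin_count r_E Q2 M0 ys c1 sy ok.
have uE b (j : 'I_k) (i : 'I_m) : \sum_(p <- zip (map vg Lfin) ys | p.1.2 == j)
    (wf \o bk) p.1 * (nth false p.2 i != b) = ucon bit snd wf Lfin ys b j i.
  have zE (s : seq Gt) (t : seq T) : zip (map vg s) t = [seq (vg p.1, p.2) | p <- zip s t].
    by elim: s t => [|g s IH] [|y t] //=; rewrite IH.
  rewrite zE big_map; apply: eq_big => p /=; first by rewrite -val_eqE.
  by move=> _; rewrite bkK /bit (tnth_nth false).
have H : forall i, \sum_j ucon bit snd wf Lfin ys (c1 j i) j i <=
    \sum_j ucon bit snd wf Lfin ys (c0 j i) j i.
  move=> i.
  have := hmin i => /forall_inP /(_ [tuple tnth (tnth C0 j) i | j < k]).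
  have /forallP /(_ i) -> := C0_sat => /(_ isT).
  move=> h; apply: leq_trans (leq_trans _ h) _; apply/eq_leq/eq_bigr => j _.
    by rewrite /= add0n uE.
  by rewrite /= add0n uE tnth_mktuple.
move=> /(_ H) {H} H.
have pE (D : k.-tuple T) : pcost X bit grp snd (fun j i => tnth (tnth D j) i) =
    \sum_(x in X) hdist x (tnth D (newA A x)).
  by apply: eq_bigr => x _; rewrite hdistE.
rewrite !pE in H.
have H1 := cost_le_assign X C (newA A).
have H2 := @newj_cost _ X _ (@hdistC m) (@hdist_tri m) _ cc jX _ Q (aA A) (cellA A) j0
  (fun x l _ => dA_minE x l sA) Q0.
rewrite W_E // in H2; have {}H2 := H2 le.
rewrite /goal_cost; move: H H1 H2 opt_le.
set cC := cost _ _; set s1 := \sum_(x in X) _; set s2 := \sum_(x in X) _.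
rewrite -/opt => H H1 H2 H3.
have K1 : Q * (Q - 2) * cC <= (Q + 3) * ((Q + 21) * OPT X Rs).
  apply: (@leq_trans (Q * ((Q + 3) * s2))).
    by rewrite -mulnA leq_mul2l; apply/orP; right; apply: leq_trans H; rewrite leq_mul2l H1 orbT.
  rewrite mulnCA leq_mul2l; apply/orP; right; apply: leq_trans H2 _.
  by rewrite leq_mul2l H3 orbT.
have Qp : 0 < Q * (Q - 2) by rewrite muln_gt0 Q0 subn_gt0.
rewrite -(leq_pmul2l Qp) mulnCA; apply: leq_trans (leq_mul (leqnn E) K1) _.
rewrite !mulnA leq_mul2r; apply/orP; right.
(* What remains is [E (Q + 3) (Q + 21) <= (E + 1) Q (Q - 2)], in essence [26 E Q <= Q ^ 2], with
   room to spare for [Q = 64 E]. *)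
rewrite Q_E; move: E_gt1; clear; nia.
Qed.

End Instance.

(** * The randomized parts of a trial *)

Lemma size_allpairs_const (A B C : Type) (f : A -> B -> C) (s : seq A)
    (t : A -> seq B) p : (forall a, size (t a) = p) ->
  size [seq f a b | a <- s, b <- t a] = size s * p.
Proof. by move=> ht; elim: s => //= a s IH; rewrite size_cat size_map ht IH mulSn. Qed.

Lemma nth_allpairs_const (A B C : Type) (f : A -> B -> C) (s : seq A)
    (t : A -> seq B) p a0 b0 c0 x i : (forall a, size (t a) = p) ->
  x < size s -> i < p ->
  nth c0 [seq f a b | a <- s, b <- t a] (x * p + i) =
  f (nth a0 s x) (nth b0 (t (nth a0 s x)) i).
Proof.
move=> ht; elim: s x => //= a s IH [|x] hx hi; rewrite nth_cat size_map ht.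
  by rewrite hi (nth_map b0) ?ht.
by rewrite mulSn -addnA ltnNge leq_addr /= addKn IH.
Qed.

Lemma iota0S p : iota 0 p.+1 = rcons (iota 0 p) p.
Proof. by rewrite -addn1 iotaD cats1. Qed.

(** * Vectors and truth tables in the input memory *)

Section Encoding.

Variables (m k : nat) (xs : seq (m.-tuple bool)) (Rs : m.-tuple {set k.-tuple bool}).

Local Notation T := (m.-tuple bool).
Local Notation inp := (nth 0 (encode xs Rs)).

Definition rowm (mu : nat -> nat) p : T := [tuple (0 < mu (p + i)) | i < m].

Lemma inp_row x0 x i : x < size xs -> i < m -> inp (x * m + i) = nth false (nth x0 xs x) i.
Proof.
move=> hx hi; have ht (a : T) : size (tval a) = m by apply: size_tuple.
rewrite /encode nth_cat (size_allpairs_const _ _ ht) addr_lt //.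
by rewrite (nth_allpairs_const (p := m) _ x0 false).
Qed.

Lemma inp_tab i v : forall hi : i < m, v < 2 ^ k ->
  inp (size xs * m + (i * 2 ^ k + v)) =
  ([tuple bitn v j | j < k] \in tnth Rs (Ordinal hi)).
Proof.
move=> hi hv; have ht (a : T) : size (tval a) = m by apply: size_tuple.
rewrite /encode nth_cat (size_allpairs_const _ _ ht) ltnNge leq_addr /= addKn.
rewrite (nth_allpairs_const (p := 2 ^ k) _ set0 0) ?size_tuple //.
  by rewrite nth_iota // add0n (tnth_nth set0).
Qed.

Lemma inp_le1 a : inp a <= 1.
Proof.
case: (ltnP a (size (encode xs Rs))) => h; last by rewrite nth_default.
have : inp a \in encode xs Rs by apply: mem_nth.
rewrite /encode mem_cat => /orP [] /allpairsPdep [b [c [_ _ ->]]]; exact: leq_b1.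
Qed.

Lemma rowm_inp x0 x : x < size xs -> rowm inp (x * m) = nth x0 xs x.
Proof.
move=> hx; apply: eq_from_tnth => i; rewrite tnth_mktuple (inp_row x0) // lt0b.
by rewrite (tnth_nth false).
Qed.

Lemma hamn_rowm mu p q : (forall i, i < m -> mu (p + i) <= 1) ->
  (forall i, i < m -> mu (q + i) <= 1) ->
  hamn mu m p q = hdist (rowm mu p) (rowm mu q).
Proof.
move=> hp hq; rewrite hdistE; apply: eq_bigr => i _; rewrite !tnth_mktuple.
have := hp i (ltn_ord i); have := hq i (ltn_ord i).
by case: (mu (p + i)) => [|[]] //; case: (mu (q + i)) => [|[]].
Qed.

Lemma sum_rows (V : nmodType) (X : {set T}) (F : T -> V) : perm_eq xs (enum X) ->
  (\sum_(x < size xs) F (rowm inp (x * m)) = \sum_(x in X) F x)%R.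
Proof.
move=> px; rewrite -[RHS]big_enum -[RHS](perm_big _ px) /=.
case: xs inp_row rowm_inp => [|x0 s] _ hr; first by rewrite big_ord0 big_nil.
rewrite [RHS](big_nth x0) big_mkord; apply: eq_bigr => x _.
by rewrite (hr x0).
Qed.

End Encoding.

Lemma t_for_mono a t t' : t <= t' -> t_for a t <= t_for a t'.
Proof. by move=> tt; rewrite /t_for leq_add2r leq_mul2l leq_add2r tt orbT. Qed.

Lemma t_pt_le m na nb Q : na <= nb -> t_pt m na Q <= t_pt m nb Q.
Proof. by move=> h; rewrite /t_pt /t_mindist 3!leq_add2r; apply: t_for_le. Qed.

Lemma t_total_le n m na nb Q : na <= nb -> t_total n m na Q <= t_total n m nb Q.
Proof. by move=> h; rewrite leq_add2r t_for_mono // leq_add2r t_pt_le. Qed.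

Lemma t_sampler_le n m na nb Q : na <= nb -> t_sampler n m na Q <= t_sampler n m nb Q.
Proof.
move=> h; rewrite leq_add2r leq_add ?t_total_le // leq_add2r t_for_mono //.
by rewrite leq_add2r t_pt_le.
Qed.

Section Trial.

Variables (R : realType) (eps : R) (m k : nat) (X : {set m.-tuple bool}).
Variables (Rs : m.-tuple {set k.-tuple bool}) (xs : seq (m.-tuple bool)).
Variables (Q r M N : nat).
Hypothesis xs_enum : perm_eq xs (enum X).

Local Notation T := (m.-tuple bool).
Local Notation tri := (tri eps).
Local Notation J := (J eps).
Local Notation n := (size xs).
Local Notation inp := (nth 0 (encode xs Rs)).
Local Notation Glob := (Glob n m k Q r M N inp).
Local Notation base := (base n m k).
Local Notation cb := (cb n m k).
Local Notation bb := (bb n m k).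
Local Notation ub := (ub n m k).
Local Notation vb := (vb n m k).
Local Notation ab := (ab n m k).
Local Notation hb := (hb n m k).
Local Notation Uat := (Uat n m k).
Local Notation row := (rowm m inp).

(** The truth tables alone take [m * 2 ^ k] cells, so the default address 0 starts [m] input cells
    even when there are no points. *)
Lemma base_ge : m <= base.
Proof.
rewrite /base; apply: leq_trans (leq_addl _ _); apply: leq_pmulr.
by rewrite expn_gt0.
Qed.

Lemma row_base x : x < n -> x * m + m <= base.
Proof.
move=> hx; rewrite /base addnC -mulSn; apply: leq_trans (leq_addr _ _).
by rewrite leq_mul2r hx orbT.
Qed.

Definition anch s : seq T := [seq row (smem s (ab + l)) | l <- iota 0 (regs s 17)].
Definition vptr s := forall l, l < regs s 17 -> smem s (ab + l) + m <= base.

Lemma size_anch s : size (anch s) = regs s 17.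
Proof. by rewrite size_map size_iota. Qed.

Lemma rowm_ext mu mu' p : (forall i, i < m -> mu (p + i) = mu' (p + i)) ->
  rowm m mu p = rowm m mu' p.
Proof. by move=> H; apply: eq_from_tnth => i; rewrite !tnth_mktuple H. Qed.

Lemma dist_sE s p : Glob s -> vptr s -> p + m <= base ->
  dist_s s p = mdT (anch s) (row p).
Proof.
move=> G vp hp; rewrite /dist_s /mdT size_anch !(GE G); apply: eq_amin => l hl.
have h2 := vp l hl.
have Ein q : q + m <= base -> forall i, i < m -> smem s (q + i) = inp (q + i).
  by move=> hq i hi; rewrite (GM G) //; lia.
rewrite hamn_rowm => [|i hi|i hi]; try by rewrite Ein // inp_le1.
rewrite (rowm_ext (Ein _ hp)) (rowm_ext (Ein _ h2)); congr hdist.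
by rewrite (nth_map 0) ?size_iota // nth_iota.
Qed.

Definition om s (x : T) := wt k Q (regs s 18) (regs s 19) (mdT (anch s) x).

Lemma wgtE s p : Glob s -> vptr s -> p + m <= base -> wgt s p = om s (row p).
Proof. by move=> G vp hp; rewrite /wgt dist_sE // !(GE G). Qed.

(** The branch for total weight 0 is the default output of the sampler, the vector at address 0. *)
Definition EW (w : T -> nat) (g : T -> R) : R :=
  (let tot := (\sum_(x in X) w x)%N in
  if tot == 0%N then g (row 0) else (\sum_(x in X) (w x)%:R * g x) / tot%:R)%R.

Lemma row_in x : x < n -> row (x * m) \in X.
Proof.
move=> hx; have [x0 _] : exists x0 : T, True.
  by case: xs hx => // x0 s _; exists x0.
by rewrite (rowm_inp _ x0) // -mem_enum -(perm_mem xs_enum) mem_nth.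
Qed.

Lemma J_samplerT s (I : state -> Prop) (f : state -> R) (g : T -> R) :
  Glob s -> vptr s -> regs s 17 <= k.+1 -> (forall s, 0 <= f s)%R ->
  let tot := \sum_(x in X) om s x in
  (forall s', keep 30 s s' -> smem s' = smem s -> regs s' 33 = tot ->
     regs s' 35 + m <= base ->
     (tot = 0 /\ regs s' 35 = 0 /\ regs s' 36 = 0) \/
     [/\ row (regs s' 35) \in X, 0 < om s (row (regs s' 35)) &
         regs s' 36 = dT (anch s) (row (regs s' 35))] ->
     I s' /\ (g (row (regs s' 35)) <= f s')%R) ->
  J Sampler s (t_sampler n m k.+1 Q) I f (EW (om s) g).
Proof.
move=> G vp na f0 tot HI.
have Et : \sum_(x < n) wgt s (x * m) = tot.
  rewrite /tot -(sum_rows Rs (om s) xs_enum); apply: eq_bigr => x _.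
  by rewrite wgtE // row_base.
have := @J_sampler R eps s I f (fun p => g (row p)).
rewrite /= !(GE G) Et => H; have {}H := H f0.
apply: (J_conseq (H _)) => //.
- move=> s' k1 m1 E33 HH; apply: HI => //.
    case: HH => [[_ [-> _]]|[x hx [_ -> _]]]; first exact: base_ge.
    exact: row_base.
  case: HH => [|[x hx [h1 -> ->]]]; first by left.
  right; rewrite dist_sE ?row_base //; split => //; first exact: row_in.
  by rewrite -wgtE // row_base.
- exact: t_sampler_le.
- rewrite /EW -/tot; case: eqP => // _.
  rewrite -(sum_rows Rs _ xs_enum) le_eqVlt; apply/orP; left; apply/eqP.
  by congr (_ / _)%R; apply: eq_bigr => x _; rewrite wgtE // row_base.
Qed.

Lemma eq_EW w w' g : w =1 w' -> EW w g = EW w' g.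
Proof.
move=> Ew; rewrite /EW (eq_bigr w') => [|x _ //].
by case: ifP => // _; congr (_ / _)%R; apply: eq_bigr => x _; rewrite Ew.
Qed.

Lemma om_D s : regs s 18 = k + 2 -> om s =1 dT (anch s).
Proof. by move=> E18 x; rewrite /om /wt E18 !ifN // -ltnNge; lia. Qed.

(** The frame of a trial: the input and the best solution so far survive, while the candidate block
    and everything from the counters on may change. *)
Definition Tr s0 s := [/\ Glob s, keep 17 s0 s &
  memsame (fun a => a < cb \/ bb <= a /\ a < ub) s0 s].

Lemma Tr_trans s0 s b s' : Tr s0 s -> 17 <= b -> keep b s s' ->
  memsame (fun a => a < cb \/ bb <= a /\ a < ub) s s' -> Tr s0 s'.
Proof.
move=> [G k1 m1] hb k2 m2; split.
- apply: Glob_keep k2 _ G; first by lia.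
  by move=> a ha; apply: m2; left.
- by apply: keep_trans k1 _; apply: keep_le k2.
- by move=> a ha; rewrite m2 // m1.
Qed.

Lemma below_ab a : a < cb \/ bb <= a /\ a < ub -> a < ab.
Proof. by rewrite /ab /ub /bb /cb; lia. Qed.

Definition AnchorLoop := For 21 (Reg 2)
  (Seq Sampler (Seq (Store (Add (Reg 13) (Reg 17)) (Reg 35))
                    (Assign 17 (Add (Reg 17) (Const 1))))).

Definition t_anchors n m k Q := t_for k (t_sampler n m k.+1 Q + 4).

Definition I1 s0 i s := [/\ Tr s0 s,
  [/\ regs s 21 = i, regs s 17 = i.+1, regs s 18 = k + 2 & regs s 20 = 0],
  vptr s & forall b j i, j < k -> i < m -> Uat s b j i = 0].

Lemma Uat_ext s s' b j i : j < k -> i < m ->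
  (forall a, a < ab -> smem s' a = smem s a) -> Uat s' b j i = Uat s b j i.
Proof.
move=> hj hi H; apply: H; have := addr_lt hj hi.
by rewrite /ab /vb /ub; case: b; lia.
Qed.

Lemma J_anchors s0 s (f1 : seq T -> nat -> R) :
  Tr s0 s -> [/\ regs s 17 = 1, regs s 18 = k + 2 & regs s 20 = 0] ->
  smem s ab = 0 -> (forall b j i, j < k -> i < m -> Uat s b j i = 0) ->
  (forall A i, 0 <= f1 A i)%R ->
  (forall A i, 0 < size A ->
     (f1 A i.+1 <= EW (dT A) (fun x => f1 (rcons A x) i))%R) ->
  J AnchorLoop s (t_anchors n m k Q) (I1 s0 k) (fun s => f1 (anch s) 0)
    (f1 [:: row 0] k).
Proof.
move=> Ts [E17 E18 E20] z zU f0 fstep.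
have -> : f1 [:: row 0] k = f1 (anch (set_reg s 21 0)) (k - 0).
  rewrite subn0; congr (f1 _ _).
  by rewrite /anch /= /upd /= E17 /= addn0 z.
suff H : J AnchorLoop s (t_anchors n m k Q) (I1 s0 k)
    (fun s => f1 (anch s) (k - k)) (f1 (anch (set_reg s 21 0)) (k - 0)).
  by move: H; rewrite subnn.
apply: (@J_for R eps _ _ _ k s _ (I1 s0) (fun i s => f1 (anch s) (k - i))).
- by move=> *; apply: f0.
- by move=> i s' hi [[G _ _] [-> _ _ _] _ _]; rewrite /= !(GE G).
- move=> i s1 hi [Ts1 [F21 F17 F18 F20] vp zU1].
  have G1 : Glob s1 by case: Ts1.
  have -> : t_sampler n m k.+1 Q + 4 = (t_sampler n m k.+1 Q + 3).+1 by lia.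
  have -> : k - i = (k - i.+1).+1 by rewrite subnSK.
  pose P s' := [/\ keep 30 s1 s', smem s' = smem s1 & regs s' 35 + m <= base].
  apply: (@J_seq _ _ _ _ _ _ _ P _ (fun s' => f1 (rcons (anch s1) (row (regs s' 35))) (k - i.+1))) => //.
    apply: J_conseq (leqnn _) _ (fun s' h => conj h (lexx _)) _ => [|s'|].
    + apply: (@J_samplerT s1 P _ (fun x => f1 (rcons (anch s1) x) (k - i.+1))).
      * exact: G1.
      * exact: vp.
      * by rewrite F17 ltnW.
      * by move=> s'; apply: f0.
      * by move=> s' h1 h2 h3 h4 _; split.
    + exact: f0.
    + rewrite (eq_EW _ (om_D F18)); apply: fstep.
      by rewrite size_anch F17.
  move=> s2 [k2 m2 h35]; apply: tri_J_and.
  apply: (@tri_time _ _ _ _ (1 + 1).+1) => //.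
  apply: tri_seq; apply: tri_store; apply: tri_assign.
  rewrite /= !(k2 13, k2 17) // !(GE G1) F17.
  set s3 := set_reg _ _ _.
  have M3 a : a < ab + i.+1 -> smem s3 a = smem s1 a.
    by move=> ha; rewrite /s3 /= /upd ifN ?m2 //; lia.
  have G17 : regs s3 17 = i.+2 by rewrite /s3 /= /upd /= addn1.
  have S3 : smem s3 (ab + i.+1) = regs s2 35 by rewrite /s3 /= /upd eqxx.
  have K3 : keep 17 s1 s3.
    by do 2 apply: keep_set => //; apply: keep_mem; exact: keep_le k2.
  have R3 : [/\ regs s3 21 = i.+1, regs s3 17 = i.+2, regs s3 18 = k + 2 & regs s3 20 = 0].
    by rewrite /s3 /= /upd /= !k2 // F21 F18 F20 addn1.
  clearbody s3.
  have A3 : anch s3 = rcons (anch s1) (row (regs s2 35)).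
    rewrite /anch G17 F17 iota0S map_rcons S3.
    congr (rcons _ _); apply/eq_in_map => l; rewrite mem_iota /= add0n => hl.
    by rewrite M3 //; lia.
  split; last by rewrite A3.
  split.
  + apply: Tr_trans Ts1 (leqnn 17) K3 _.
    by move=> a /below_ab ha; apply: M3; lia.
  + exact: R3.
  + move=> l; rewrite G17 ltnS leq_eqVlt => /orP [/eqP ->|hl]; first by rewrite S3.
    by rewrite M3 ?ltn_add2l ?vp ?F17.
  + move=> b j i' hj hi'; rewrite (@Uat_ext s1) ?zU1 // => a ha.
    by apply: M3; lia.
- split => //.
  + apply: Tr_trans Ts (leqnn 17) _ _ => //; exact: keep_set.
  + by move=> l; rewrite /= /upd /= E17; case: l => // _; rewrite addn0 z base_ge.
Qed.

Definition ThrLoop := For 22 (Reg 2)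
  (Seq Sampler (Store (Add (Reg 14) (Reg 22)) (Reg 36))).

Definition t_thr n m k Q := t_for k (t_sampler n m k.+1 Q + 2).

Definition thrs j s : seq nat := [seq smem s (hb + j') | j' <- iota 0 j].

Lemma size_thrs j s : size (thrs j s) = j.
Proof. by rewrite size_map size_iota. Qed.

Definition I2 s0 A j s := [/\ Tr s0 s,
  [/\ regs s 22 = j, regs s 17 = k.+1, regs s 18 = k + 2 & regs s 20 = 0],
  vptr s, anch s = A & forall b j i, j < k -> i < m -> Uat s b j i = 0].

Lemma J_thr s0 s (f2 : seq nat -> R) : I1 s0 k s ->
  (forall th, 0 <= f2 th)%R ->
  (forall th, size th < k ->
     (f2 th <= EW (dT (anch s)) (fun x => f2 (rcons th
       (if \sum_(y in X) dT (anch s) y == 0%N then 0%N else dT (anch s) x))))%R) ->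
  J ThrLoop s (t_thr n m k Q) (I2 s0 (anch s) k) (fun s => f2 (thrs k s)) (f2 [::]).
Proof.
move=> [Ts [E21 E17 E18 E20] vp zU] f0 fstep.
rewrite -[[::]]/(thrs 0 (set_reg s 22 0)).
apply: (@J_for R eps _ _ _ k s _ (I2 s0 (anch s)) (fun j s => f2 (thrs j s))).
- by move=> *; apply: f0.
- by move=> i s' hi [[G _ _] [-> _ _ _] _ _]; rewrite /= !(GE G).
- move=> j s1 hj [Ts1 [F22 F17 F18 F20] vp1 A1 zU1].
  have G1 : Glob s1 by case: Ts1.
  have -> : t_sampler n m k.+1 Q + 2 = (t_sampler n m k.+1 Q + 1).+1 by lia.
  pose P s' := [/\ keep 30 s1 s', smem s' = smem s1 &
    (\sum_(x in X) dT (anch s) x = 0 /\ regs s' 35 = 0 /\ regs s' 36 = 0) \/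
     regs s' 36 = dT (anch s) (row (regs s' 35))].
  apply: (@J_seq _ _ _ _ _ _ _ P _ (fun s' => f2 (rcons (thrs j s1) (regs s' 36)))) => //.
    apply: J_conseq (leqnn _) _ (fun s' h => conj h (lexx _)) _ => [|s'|].
    + apply: (@J_samplerT s1 P _ (fun x => f2 (rcons (thrs j s1)
        (if \sum_(y in X) dT (anch s) y == 0 then 0 else dT (anch s) x)))).
      * exact: G1.
      * exact: vp1.
      * by rewrite F17.
      * by move=> s'; apply: f0.
      rewrite (eq_bigr (dT (anch s1))) => [|x _]; last exact: om_D.
      rewrite A1 => s' h1 h2 h3 h4 [[e0 [e1 e2]]|[e1 e2 e3]].
        by rewrite e0 e2; split => //; split=> //; left.
      split; first by split => //; right.
      case: eqP => [e0|_]; last by rewrite e3.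
      move: e2; rewrite om_D // A1 => e2; exfalso.
      by move/eqP: e0; rewrite sum_nat_eq0 => /forall_inP /(_ _ e1) /eqP e0; rewrite e0 in e2.
    + exact: f0.
    + rewrite (eq_EW _ (om_D F18)) A1; apply: fstep.
      by rewrite size_thrs.
  move=> s2 [k2 m2 h36]; apply: tri_J_and.
  apply: tri_store; rewrite /= !(k2 14, k2 22) // !(GE G1) F22.
  set s3 := set_reg _ _ _.
  have M3 a : a < hb + j -> smem s3 a = smem s1 a.
    by move=> ha; rewrite /s3 /= /upd ifN ?m2 //; lia.
  have ha3 : ab + k < hb by rewrite /hb; lia.
  have K3 : keep 17 s1 s3.
    by apply: keep_set => //; apply: keep_mem; exact: keep_le k2.
  have R3 : [/\ regs s3 22 = j.+1, regs s3 17 = k.+1, regs s3 18 = k + 2 & regs s3 20 = 0].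
    by rewrite /s3 /= /upd /= !k2 // F17 F18 F20.
  have S3 : smem s3 (hb + j) = regs s2 36 by rewrite /s3 /= /upd eqxx.
  clearbody s3; have [_ G17 _ _] := R3.
  have A3 : anch s3 = anch s1.
    rewrite /anch G17 F17; apply/eq_in_map => l; rewrite mem_iota /= add0n => hl.
    by congr row; apply: M3; lia.
  split.
    split.
    + apply: Tr_trans Ts1 (leqnn 17) K3 _.
      by move=> a /below_ab ha; apply: M3; lia.
    + exact: R3.
    + move=> l; rewrite G17 => hl.
      by rewrite M3 ?vp1 ?F17 //; lia.
    + by rewrite A3.
    + move=> b j' i' hj' hi'; rewrite (@Uat_ext s1) ?zU1 // => a ha.
      by apply: M3; lia.
  rewrite /thrs iota0S map_rcons S3.
  rewrite le_eqVlt; apply/orP; left; apply/eqP; congr (f2 (rcons _ _)).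
  apply/esym/eq_in_map => l; rewrite mem_iota /= add0n => hl.
  by rewrite M3 //; lia.
- split => //; first by apply: Tr_trans Ts (leqnn 17) _ _ => //; exact: keep_set.
Qed.

Definition Draw :=
  Seq (Rand 24 (Add (Reg 6) (Const 1))) (Seq Sampler AddUp).

Definition t_draw n m k Q M := t_sampler n m k.+1 Q + t_acc m k M + 3.

Definition DrawLoop :=
  For 21 (Add (Reg 2) (Const 2)) (For 22 (Reg 2)
    (Seq (Assign 18 (Reg 21)) (Seq (Assign 19 (Mem (Add (Reg 14) (Reg 22))))
      (For 23 (Reg 5) Draw)))).

Definition t_draws n m k Q r M := t_for (k + 2) (t_for k (t_for r (t_draw n m k Q M) + 4)).

(** The last clause, for an arbitrary choice [f] of bits, is what the initial minimum of [ChooseAt]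
    relies on. *)
Definition I3 s0 A th s :=
  [/\ Tr s0 s, regs s 17 = k.+1, vptr s, anch s = A /\ thrs k s = th &
    forall i (f : nat -> bool), i < m -> \sum_(j < k) Uat s (f j) j i <= regs s 20].

Lemma I3_keep s0 A th s s' : I3 s0 A th s -> keep 18 s s' ->
  regs s' 20 = regs s 20 -> smem s' = smem s -> I3 s0 A th s'.
Proof.
move=> [Ts E17 vp [hA hth] hU] k1 E20 m1.
have E17' : regs s' 17 = regs s 17 by rewrite k1.
split => //.
- by apply: Tr_trans Ts (leqnn 17) _ _; [exact: keep_le k1|move=> a _; rewrite m1].
- by rewrite E17'.
- by move=> l; rewrite E17' m1; apply: vp.
- by split; [rewrite -hA /anch E17' m1|rewrite -hth /thrs m1].
- by move=> i f hi; rewrite E20 /Uat m1; apply: hU.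
Qed.

(** One draw as an abstract inequality: a uniform guess [t] followed by a weighted sample. The
    sampling loops are thereby verified once, for any [F3] that satisfies it. *)
Definition F3_step A th (F3 : seq (nat * nat) -> (bool -> nat -> nat -> nat) -> R) :=
  forall l j L u, l < k.+2 -> j < k ->
  let w x := wt k Q l (nth 0 th j) (mdT A x) in
  (F3 ((l, j) :: L) u <= (\sum_(t < M.+1) EW w (fun x =>
     F3 L (addT (t * \sum_(y in X) w y)%N j x u))) / M.+1%:R)%R.

Definition F3_ext (F3 : seq (nat * nat) -> (bool -> nat -> nat -> nat) -> R) :=
  forall L u u', (forall b j i, j < k -> i < m -> u b j i = u' b j i) ->
  F3 L u = F3 L u'.

Lemma addu_addT w j p u b j' i : i < m ->
  addu inp w j p u b j' i = addT w j (row p) u b j' i.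
Proof.
by move=> hi; rewrite /addu /addT -(tnth_nth _ _ (Ordinal hi)) tnth_mktuple.
Qed.

Lemma J_draw s0 A th F3 s l j L : I3 s0 A th s ->
  F3_step A th F3 -> F3_ext F3 -> (forall L u, 0 <= F3 L u)%R ->
  l < k.+2 -> j < k ->
  regs s 18 = l -> regs s 19 = nth 0 th j -> regs s 22 = j ->
  J Draw s (t_draw n m k Q M)
    (fun s' => I3 s0 A th s' /\
       forall x, x \in [:: 18; 19; 21; 22; 23] -> regs s' x = regs s x)
    (fun s' => F3 L (Uat s')) (F3 ((l, j) :: L) (Uat s)).
Proof.
move=> H3 hstep hext F0 hl hj E18 E19 E22.
have [Ts E17 vp [hA hth] hU] := H3; have G : Glob s by case: Ts.
set w := fun x => wt k Q l (nth 0 th j) (mdT A x).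
set tot := \sum_(y in X) w y.
have -> : t_draw n m k Q M = (1 + (t_sampler n m k.+1 Q + t_acc m k M).+1).+1.
  by rewrite /t_draw; lia.
pose P1 s1 := exists2 t, s1 = set_reg s 24 t & t <= M.
apply: (@J_seq _ _ _ _ _ _ _ P1 _ (fun s1 => EW w (fun x =>
  F3 L (addT (regs s1 24 * tot) j x (Uat s))))) => //.
  have EM : maxn 1 (eval s (Add (Reg 6) (Const 1))) = M.+1.
    by rewrite /= !(GE G) addn1 (maxn_idPr _).
  apply: J_rand => [x|]; rewrite EM; first by exists x.
  apply: le_trans (hstep l j L _ hl hj) _.
  by rewrite le_eqVlt; apply/orP; left.
move=> _ [t -> ht]; set s1 := set_reg s 24 t.
have H31 : I3 s0 A th s1 by apply: I3_keep H3 _ _ _ => //; apply: keep_set.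
have [Ts1 F17 vp1 [hA1 _] _] := H31; have G1 : Glob s1 by case: Ts1.
have omw : om s1 =1 w by move=> x; rewrite /om hA1 /s1 /= /upd /= E18 E19.
pose P2 s2 := [/\ keep 30 s1 s2, smem s2 = smem s1, regs s2 33 = tot &
  regs s2 35 + m <= base].
apply: (@J_seq _ _ _ _ _ _ _ P2 _
  (fun s2 => F3 L (addT (t * tot) j (row (regs s2 35)) (Uat s)))) => //.
  rewrite -(eq_EW _ omw); apply: J_samplerT => //; first by rewrite F17.
  move=> s2 k2 m2; rewrite (eq_bigr w) => [|x _]; last exact: omw.
  by move=> E33 hp _; split.
move=> s2 [k2 m2 E33 hp]; apply: tri_J_and.
have H32 : I3 s0 A th s2.
  by apply: I3_keep H31 _ _ m2; [exact: keep_le k2|rewrite k2].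
have [Ts2 K17 vp2 [hA2 hth2] hU2] := H32; have G2 : Glob s2 by case: Ts2.
have E24 : regs s2 24 = t by rewrite k2.
have R22 : regs s2 22 = j by rewrite k2.
apply: (tri_add_up eps G2); rewrite ?E24 ?R22 // E33.
move=> s3 k3 E20 kx m3 U3.
have U3' b j' i : j' < k -> i < m ->
    Uat s3 b j' i = addT (t * tot) j (row (regs s2 35)) (Uat s) b j' i.
  by move=> hj' hi; rewrite U3 // addu_addT // /addT /Uat m2.
have A3 : forall a, a < ub \/ ab <= a -> smem s3 a = smem s2 a by [].
have k17 : keep 17 s2 s3 by apply: keep_le k3.
split; last first.
  by rewrite (hext _ _ _ (fun b j' i h1 h2 => esym (U3' b j' i h1 h2))).
split.
- split.
  + apply: Tr_trans Ts2 (leqnn 17) k17 _ => a ha; apply: A3.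
    by case: ha => [ha|[_ ha]]; left => //; move: ha; rewrite /ub /cb; lia.
  + by rewrite k3.
  + by move=> l'; rewrite k3 // A3; [apply: vp2|right; apply: leq_addr].
  + split.
      rewrite -hA2 /anch k3 //; apply: eq_map => l'.
      by rewrite A3 //; right; apply: leq_addr.
    rewrite -hth2 /thrs; apply: eq_map => j'; rewrite A3 //; right.
    by rewrite /hb; lia.
  + move=> i f hi; rewrite E20.
    under eq_bigr => j' _ do rewrite U3' // /addT.
    rewrite big_split /= leq_add //; first by rewrite k2 //=; apply: hU.
    rewrite -big_mkcond /= (big_pred1 (Ordinal hj)) => [|j'].
      by case: (_ != _); rewrite ?muln1 ?muln0.
    by [].
- move=> x; rewrite !inE => hx.
  have [xb|xb] : x < 20 \/ x \in [:: 21; 22; 23].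
  + by case/or4P: hx => [/eqP ->|/eqP ->|/eqP ->|/orP [] /eqP ->]; [left|left|right|right|right].
  + by rewrite k3 // k2 /s1 ?regs_other //; lia.
  + by rewrite kx // k2 /s1 ?regs_other //; move: xb; rewrite !inE; lia.
Qed.

Lemma J_draws s0 A th F3 s : I2 s0 A k s -> thrs k s = th ->
  F3_step A th F3 -> F3_ext F3 -> (forall L u, 0 <= F3 L u)%R ->
  J DrawLoop s (t_draws n m k Q r M) (I3 s0 A th)
    (fun s' => F3 [::] (Uat s')) (F3 (Lfrom k r 0) (fun _ _ _ => 0)).
Proof.
move=> [Ts [E22 E17 E18 E20] vp hA zU] hth hstep hext F0.
have H3 : I3 s0 A th s.
  by split => // i f hi; rewrite big1 // => j _; rewrite zU.
rewrite (hext _ _ (Uat (set_reg s 21 0))) => [|b j i hj hi]; last by rewrite -[RHS]/(Uat s b j i) zU.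
pose Io l s' := I3 s0 A th s' /\ regs s' 21 = l.
pose fo l s' := F3 (Lfrom k r l) (Uat s').
suff H : J DrawLoop s (t_draws n m k Q r M) (Io (k + 2)) (fo (k + 2))
    (fo 0 (set_reg s 21 0)).
  apply: (J_conseq H) => // s' [h1 _]; split => //.
  by rewrite /fo /Lfrom addn2 subnn.
apply: J_for => [l s'|l s' hl [[[G _ _] _ _ _ _] ->]|l s1 hl [H31 R21]|].
- exact: F0.
- by rewrite /= !(GE G).
- have G1 : Glob s1 by case: H31 => -[].
  pose Ii j s' := I3 s0 A th s' /\ (regs s' 21 = l /\ regs s' 22 = j).
  pose fi j s' := F3 (Lrow k r l j ++ Lfrom k r l.+1) (Uat s').
  suff H : J (For 22 (Reg 2)
     (Seq (Assign 18 (Reg 21)) (Seq (Assign 19 (Mem (Add (Reg 14) (Reg 22))))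
      (For 23 (Reg 5) Draw)))) s1 (t_for k (t_for r (t_draw n m k Q M) + 4))
     (Ii k) (fi k) (fi 0 (set_reg s1 22 0)).
    apply: (J_conseq H) => //.
    + by move=> s'; apply: F0.
    + move=> s' [h1 [h2 _]]; split; first split.
      * apply: I3_keep h1 _ _ _ => //; apply: keep_set => //.
      * by rewrite regs_same h2.
      * by rewrite /fo /fi /Lrow subnn.
    + rewrite /fi /fo /Lfrom -addn2 -[k + 2 - l](@subnK 1) ?subn_gt0 //.
      by rewrite addn1 /= -subnDA addn1.
  apply: J_for => [j s'|j s' hj [[[G _ _] _ _ _ _] [_ ->]]|j s2 hj [H32 [Q21 Q22]]|].
  + exact: F0.
  + by rewrite /= !(GE G).
  + have G2 : Glob s2 by case: H32 => -[].
    have -> : t_for r (t_draw n m k Q M) + 4 =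
      (1 + (1 + t_for r (t_draw n m k Q M)).+1).+1 by lia.
    pose S1 s3 := s3 = set_reg (set_reg s2 18 l) 19 (nth 0 th j).
    pose rest := Lrow k r l j.+1 ++ Lfrom k r l.+1.
    have hth2 : smem s2 (hb + j) = nth 0 th j.
      case: H32 => _ _ _ [_ <-] _.
      by rewrite (nth_map 0) ?size_iota // nth_iota.
    apply: (@J_seq _ _ _ _ _ _ _ (fun s3 => s3 = set_reg s2 18 l) _ (fun=> fi j s2)).
    - by move=> *; apply: F0.
    - by apply: tri_J => //; apply: tri_assign; rewrite /= Q21.
    move=> _ ->.
    apply: (@J_seq _ _ _ _ _ _ _ S1 _ (fun=> fi j s2)).
    - by move=> *; apply: F0.
    - apply: tri_J => //; apply: tri_assign; rewrite /= /upd /= !(GE G2) Q22 hth2.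
      by [].
    move=> _ ->; set s3 := set_reg _ _ _.
    have H33 : I3 s0 A th s3.
      by apply: I3_keep H32 _ _ _ => //; do 2 apply: keep_set => //.
    pose Iq q s' := I3 s0 A th s' /\ [/\ regs s' 18 = l, regs s' 19 = nth 0 th j,
      regs s' 21 = l, regs s' 22 = j & regs s' 23 = q].
    pose fq q s' := F3 (nseq (r - q) (l, j) ++ rest) (Uat s').
    suff H : J (For 23 (Reg 5) Draw) s3 (t_for r (t_draw n m k Q M))
       (Iq r) (fq r) (fq 0 (set_reg s3 23 0)).
      apply: (J_conseq H) => //.
      * by move=> s'; apply: F0.
      * move=> s' [h1 [h2 h3 h4 h5 h6]]; split; first split.
        - by apply: I3_keep h1 _ _ _ => //; apply: keep_set.
        - by rewrite regs_other // regs_same h5 h4.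
        - by rewrite /fq /fi subnn.
      * rewrite /fq /fi /rest subn0 catA.
        have -> : Lrow k r l j = nseq r (l, j) ++ Lrow k r l j.+1.
          by rewrite /Lrow -(subnSK hj).
        by [].
    apply: J_for => [q s'|q s' hq [[[G _ _] _ _ _ _] [_ _ _ _ ->]]|q s4 hq [H34 [h18 h19 h21 h22 h23]]|].
    - exact: F0.
    - by rewrite /= !(GE G).
    - rewrite /fq -(subnSK hq) /=.
      have hl' : l < k.+2 by rewrite -addn2.
      apply: (J_conseq (@J_draw s0 A th F3 s4 l j _ H34 hstep hext F0 hl' hj h18 h19 h22)) => //.
      move=> s' [h1 h2].
      split => //; split.
        by apply: I3_keep h1 _ _ _ => //; apply: keep_set.
      by rewrite /= /upd /= !h2 // h18 h19 h21 h22 h23.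
    - split; first by apply: I3_keep H33 _ _ _ => //; apply: keep_set.
      by rewrite /= /upd /= Q21 Q22.
  + split; first by apply: I3_keep H31 _ _ _ => //; apply: keep_set.
    by rewrite /= /upd /= R21.
- by split => //; apply: I3_keep H3 _ _ _ => //; apply: keep_set.
Qed.

End Trial.

(** * A complete trial *)

Lemma bitn_surj (s : seq bool) :
  exists2 v, v < 2 ^ size s & forall j, j < size s -> bitn v j = nth false s j.
Proof.
elim: s => [|b s [v v_lt hv]]; first by exists 0.
exists (b + v * 2).
  by rewrite /= expnS; case: b; move: v_lt; rewrite /=; lia.
have b2 : b < 2 by case: b.
case=> [|j] hj; first by rewrite /bitn divn1 oddD oddM andbF addbF; case: (b).
rewrite /bitn expnS divnMA divnDMl // (divn_small b2) add0n; exact: hv.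
Qed.

Lemma bitn_tuple k (b : k.-tuple bool) :
  exists2 v, v < 2 ^ k & b = [tuple bitn v j | j < k].
Proof.
have [v] := bitn_surj b; rewrite size_tuple => hv hb; exists v => //.
by apply: eq_from_tnth => j; rewrite tnth_mktuple hb // (tnth_nth false).
Qed.

Section Trial.

Variables (R : realType) (eps : R) (m k : nat) (X : {set m.-tuple bool}).
Variables (Rs : m.-tuple {set k.-tuple bool}) (xs : seq (m.-tuple bool)).
Variables (E Q r M N : nat).
Hypothesis k0 : 0 < k.
Hypothesis xs_enum : perm_eq xs (enum X).

Local Notation T := (m.-tuple bool).
Local Notation tri := (tri eps).
Local Notation J := (J eps).
Local Notation n := (size xs).
Local Notation inp := (nth 0 (encode xs Rs)).
Local Notation Glob := (Glob n m k Q r M N inp).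
Local Notation base := (base n m k).
Local Notation cb := (cb n m k).
Local Notation bb := (bb n m k).
Local Notation ub := (ub n m k).
Local Notation ab := (ab n m k).
Local Notation Uat := (Uat n m k).
Local Notation row := (rowm m inp).
Local Notation I3 := (I3 Rs xs Q r M N).

Definition rows_at (s : state) a : k.-tuple T := [tuple rowm m (smem s) (a + j * m) | j < k].

Definition feas := [exists C : k.-tuple T, satisfies Rs C].

(** Register 15 starts at [n * m + 1], above every cost, which marks that the best block holds
    nothing yet. *)
Definition Inv (s : state) := Glob s /\ (regs s 15 <= n * m ->
  cost X (entries (rows_at s bb)) = regs s 15 /\
  (feas -> satisfies Rs (rows_at s bb))).

Lemma columnE s' (i : 'I_m) v :
  (forall j, j < k -> smem s' (cb + addr m j i) = bitn v j) ->
  [tuple tnth (tnth (rows_at s' cb) j) i | j < k] = [tuple bitn v j | j < k].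
Proof.
move=> hb; apply: eq_from_tnth => j; rewrite !tnth_mktuple.
by rewrite -addnA hb // lt0b.
Qed.

Lemma tabE (i : 'I_m) v : v < 2 ^ k ->
  (0 < tab n m k inp i v) = ([tuple bitn v j | j < k] \in tnth Rs i).
Proof.
move=> hv; rewrite /tab (inp_tab xs Rs (ltn_ord i) hv) lt0b.
by have -> : Ordinal (ltn_ord i) = i by apply: val_inj.
Qed.

Lemma feas_tab (i : 'I_m) : feas -> exists2 v, v < 2 ^ k & 0 < tab n m k inp i v.
Proof.
case/existsP => C /forallP /(_ i).
have [v hv ->] := bitn_tuple [tuple tnth (tnth C j) i | j < k].
by exists v => //; rewrite tabE.
Qed.

Lemma chosen_satisfies s s' : (forall i, i < m -> chosen n m k inp s s' i) ->
  feas -> satisfies Rs (rows_at s' cb).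
Proof.
move=> H hf; apply/forallP => i.
have [v [hv hb /(_ (feas_tab i hf)) [h _]]] := H i (ltn_ord i).
by rewrite (columnE hb) -tabE.
Qed.

Lemma chosen_min s s' (i : 'I_m) : (forall i, i < m -> chosen n m k inp s s' i) ->
  forall b, b \in tnth Rs i ->
  \sum_(j < k) Uat s (tnth (tnth (rows_at s' cb) j) i) j i <=
  \sum_(j < k) Uat s (tnth b j) j i.
Proof.
move=> H b hb; have [w hw Ew] := bitn_tuple b.
have tw : 0 < tab n m k inp i w by rewrite tabE // -Ew.
have [v [hv hbits hmin]] := H i (ltn_ord i).
have [|_ hm] := hmin; first by exists w.
apply: leq_trans (leq_trans (hm w hw tw) _); apply/eq_leq/eq_bigr => j _.
  by rewrite !tnth_mktuple -addnA hbits // lt0b.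
by rewrite Ew tnth_mktuple.
Qed.

Definition Finish := Seq Choose (Seq Evaluate Update).

Definition t_finish n m k Q :=
  t_choose m k + t_evaluate n m k Q + t_update m k + 2.

Lemma tri_finish s0 A th s : I3 s0 A th s -> Inv s0 ->
  tri Finish s (t_finish n m k Q) (fun s' => [/\ Inv s',
    regs s' 16 = regs s0 16, regs s' 15 <= regs s0 15, regs s' 15 <= n * m &
    feas -> goodu X Rs E (Uat s) -> goal_cost X Rs E (regs s' 15)]).
Proof.
move=> [[G k00 m00] E17 vp [hA hth] hU] [_ inv0].
have nX : n = #|X| by rewrite (perm_size xs_enum) cardE.
have -> : t_finish n m k Q = (t_choose m k + (t_evaluate n m k Q + t_update m k).+1).+1.
  by rewrite /t_finish; lia.
apply: tri_seq; apply: (tri_choose eps G hU) => s1 k1 m1 hc.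
have G1 : Glob s1 by apply: Glob_keep k1 _ G => // a ha; apply: m1; left.
set C := rows_at s1 cb.
have hbit j i : j < k -> i < m -> smem s1 (cb + j * m + i) <= 1.
  move=> hj hi; have [v [_ hb _]] := hc i hi.
  by rewrite -addnA hb // leq_b1.
apply: tri_seq; apply: (tri_evaluate eps G1) => s2 k2 m2 E33.
have G2 : Glob s2.
  by apply: Glob_keep k2 _ G1 => // a ha; apply: m2; rewrite /ab; lia.
have C2 : rows_at s2 cb = C.
  apply: eq_from_tnth => j; rewrite !tnth_mktuple; apply: rowm_ext => i hi.
  apply: m2; have := addr_lt (ltn_ord j) hi; rewrite /addr /ab /cb; lia.
have cE : regs s2 33 = cost X (entries C).
  rewrite E33 cost_entries // -(sum_rows Rs (dT C) xs_enum); apply: eq_bigr => x _.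
  rewrite /dT /mdT size_tuple; congr (_.1); apply: eq_amin => j hj.
  have Ex i : i < m -> smem s1 (x * m + i) = inp (x * m + i).
    by move=> hi; rewrite (GM G1) //; have := row_base k (ltn_ord x); lia.
  rewrite hamn_rowm => [|i hi|i hi]; [|by rewrite Ex // inp_le1|exact: hbit].
  rewrite (rowm_ext Ex); congr hdist.
  by rewrite -(tnth_nth _ _ (Ordinal hj)) tnth_mktuple.
have cle : regs s2 33 <= n * m by rewrite cE nX cost_le_max.
have K02 : keep 17 s0 s2.
  by apply: keep_trans k00 (keep_trans (keep_le _ k1) k2).
have M02 a : bb <= a -> a < ub -> smem s2 a = smem s0 a.
  move=> h1 h2; rewrite m2; last by move: h2; rewrite /ub /ab; lia.
  by rewrite m1; [rewrite m00 //; right|right].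
have hgoal : feas -> goodu X Rs E (Uat s) -> goal_cost X Rs E (regs s2 33).
  move=> hf /forallP /(_ C) /implyP; rewrite cE; apply.
  rewrite (chosen_satisfies hc hf) /=; apply/forallP => i; apply/forall_inP => b hb.
  exact: chosen_min.
have rows_ext s' a a' : (forall o, o < k * m -> smem s' (a + o) = smem s2 (a' + o)) ->
    rows_at s' a = rows_at s2 a'.
  move=> H; apply: eq_from_tnth => j; rewrite !tnth_mktuple.
  apply: eq_from_tnth => i; rewrite !tnth_mktuple -!addnA H //.
  exact: (addr_lt (ltn_ord j) (ltn_ord i)).
have E15 : regs s2 15 = regs s0 15 by apply: K02.
apply: (tri_update eps G2) => s3 k3 E16 m3 hlt hge.
have G3 : Glob s3.
  by apply: Glob_keep k3 _ G2 => // a ha; apply: m3; left; rewrite /bb; lia.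
have E16' : regs s3 16 = regs s0 16 by rewrite E16; apply: K02.
case: (ltnP (regs s2 33) (regs s2 15)) => h.
  have [e1 e2] := hlt h; split => //; rewrite ?e1 //.
  - split => // _; rewrite e1 (rows_ext _ _ cb e2) C2 -cE; split => // hf.
    exact: chosen_satisfies hc hf.
  - by rewrite -E15 ltnW.
have [e1 e2] := hge h; split => //; rewrite ?e1 ?E15 //.
- split => //; rewrite e1 E15 => /inv0.
  have -> // : rows_at s3 bb = rows_at s0 bb.
  apply: eq_from_tnth => j; rewrite !tnth_mktuple; apply: rowm_ext => i hi.
  have := addr_lt (ltn_ord j) hi; rewrite e2 -addnA /addr => L.
  by apply: M02; rewrite ?leq_addr // /bb /ub; lia.
- by rewrite -E15; apply: leq_trans h cle.
move=> hf hg; rewrite -E15; apply: leq_trans (hgoal hf hg).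
by rewrite leq_mul2l h orbT.
Qed.

Definition TrialC :=
  Seq InitTrial (Seq AnchorLoop (Seq ThrLoop (Seq DrawLoop Finish))).

Definition t_trial n m k Q r M :=
  t_init_trial m k + t_anchors n m k Q + t_thr n m k Q + t_draws n m k Q r M +
  t_finish n m k Q + 4.

(** The phases are linked by abstract lower bounds [f1], [f2] and [F3]: zero functions yield what
    holds on every run, and the probabilities of the success events yield the success bound. *)
Lemma J_trial s (f1 : seq T -> nat -> R) (f2 : seq T -> seq nat -> R) :
  Inv s ->
  (forall A i, 0 <= f1 A i)%R -> (forall A th, 0 <= f2 A th)%R ->
  (forall A i, 0 < size A ->
     (f1 A i.+1 <= EW X Rs xs (dT A) (fun x => f1 (rcons A x) i))%R) ->
  (forall A, size A = k.+1 -> (f1 A 0 <= f2 A [::])%R) ->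
  (forall A th, size A = k.+1 -> size th < k ->
     (f2 A th <= EW X Rs xs (dT A) (fun x => f2 A (rcons th
       (if \sum_(y in X) dT A y == 0%N then 0%N else dT A x))))%R) ->
  (forall A th, size A = k.+1 -> size th = k -> exists F3,
     [/\ F3_step X Rs xs Q M A th F3, F3_ext m k F3, (forall L u, 0 <= F3 L u)%R,
         (f2 A th <= F3 (Lfrom k r 0) (fun _ _ _ => 0%N))%R &
         forall u, (F3 [::] u <= (feas && goodu X Rs E u)%:R)%R]) ->
  J TrialC s (t_trial n m k Q r M) (fun s' => [/\ Inv s',
      regs s' 16 = regs s 16, regs s' 15 <= regs s 15 & regs s' 15 <= n * m])
    (fun s' => (goal_cost X Rs E (regs s' 15))%:R)%R (f1 [:: row 0] k).
Proof.
move=> inv f10 f20 h1 h12 h2 h23.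
have G : Glob s by case: inv.
have -> : t_trial n m k Q r M = (t_init_trial m k + (t_anchors n m k Q +
  (t_thr n m k Q + (t_draws n m k Q r M + t_finish n m k Q).+1).+1).+1).+1.
  by rewrite /t_trial; lia.
have ge0 (s' : state) : (0 <= (goal_cost X Rs E (regs s' 15))%:R :> R)%R by apply: ler0n.
pose P s1 := [/\ Tr Rs xs Q r M N s s1,
  [/\ regs s1 17 = 1, regs s1 18 = k + 2 & regs s1 20 = 0],
  smem s1 ab = 0 & forall b j i, j < k -> i < m -> Uat s1 b j i = 0].
apply: (@J_seq _ _ _ _ _ _ _ P _ (fun=> f1 [:: row 0] k)) => //.
  apply: tri_J => //; apply: (tri_init_trial eps G) => s1 k1 m1 [e20 e17 e18 e19] z zU.
  split => //; split => //.
    by apply: Glob_keep k1 _ G => // a ha; apply: m1; rewrite /ub; lia.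
  by move=> a ha; apply: m1; case: ha => [|[]//]; rewrite /ub /cb; lia.
move=> s1 [Ts1 e1 z1 zU1].
apply: (J_seq ge0 (@J_anchors R eps m k X Rs xs Q r M N xs_enum s s1 f1 Ts1 e1 z1 zU1 f10 h1)).
move=> s2 HI1; have sA : size (anch Rs xs s2) = k.+1.
  by case: HI1 => _ [_ e17 _ _] _ _; rewrite size_anch e17.
pose A := anch Rs xs s2.
apply: (J_conseq (v := f2 A [::]) _ (leqnn _) ge0 (fun s' h => conj h (lexx _))); last exact: h12.
apply: (J_seq ge0 (@J_thr R eps m k X Rs xs Q r M N xs_enum s s2 (f2 A) HI1 (f20 A) (fun th => h2 A th sA))).
move=> s3 HI2; set th := thrs k xs k s3.
have sth : size th = k by apply: size_thrs.
have [F3 [F3s F3e F30 F3f F3g]] := h23 A th sA sth.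
apply: (J_conseq (v := F3 (Lfrom k r 0) (fun _ _ _ => 0)) _ (leqnn _) ge0 (fun s' h => conj h (lexx _))) => //.
apply: (J_seq ge0 (@J_draws R eps m k X Rs xs Q r M N xs_enum s A th F3 s3 HI2 erefl F3s F3e F30)).
move=> s4 HI3; apply: tri_J_and.
apply: tri_weaken (tri_finish HI3 inv) (leqnn _) _ => s5 [g1 g2 g3 g4 g5].
split => //; apply: le_trans (F3g _) _.
rewrite ler_nat; case: (boolP (_ && _)) => // /andP [hf hg].
by rewrite (g5 hf hg).
Qed.

End Trial.

Section TrialSuccess.

Variables (R : realType) (eps : R) (m k : nat) (X : {set m.-tuple bool}).
Variables (Rs : m.-tuple {set k.-tuple bool}) (xs : seq (m.-tuple bool)).
Variables (E Q r BI M N : nat).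
Hypothesis k0 : 0 < k.
Hypothesis xs_enum : perm_eq xs (enum X).

Local Notation T := (m.-tuple bool).
Local Notation J := (J eps).
Local Notation n := (size xs).
Local Notation inp := (nth 0 (encode xs Rs)).
Local Notation row := (rowm m inp).
Local Notation EW := (EW X Rs xs).
Local Notation Inv := (Inv X Rs xs Q r M N).
Local Notation trial_post s := (fun s' => [/\ Inv s',
      regs s' 16 = regs s 16, regs s' 15 <= regs s 15 & regs s' 15 <= n * m]).

Lemma EW_ge0 (w : T -> nat) (g : T -> R) : (forall x, 0 <= g x)%R -> (0 <= EW w g)%R.
Proof.
move=> g0; rewrite /EW; case: eqP => // _; rewrite divr_ge0 ?ler0n //.
by apply: sumr_ge0 => x _; rewrite mulr_ge0 ?ler0n.
Qed.

Lemma EW_ext (w : T -> nat) (g g' : T -> R) : g =1 g' -> EW w g = EW w g'.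
Proof.
move=> H; rewrite /EW H; case: ifP => // _; congr (_ / _)%R.
by apply: eq_bigr => x _; rewrite H.
Qed.

(** Zero functions make all probabilistic premises of [J_trial] trivial, so this covers infeasible
    instances as well. *)
Lemma trial_sure s : Inv s ->
  tri eps TrialC s (t_trial n m k Q r M) (trial_post s).
Proof.
move=> inv; apply: J_tri.
apply: (@J_trial R eps m k X Rs xs 0 Q r M N k0 xs_enum s (fun _ _ => 0%R) (fun _ _ => 0%R) inv) => //.
- by move=> *; apply: EW_ge0.
- by move=> *; apply: EW_ge0.
move=> A th _ _; exists (fun _ _ => 0%R); split => //.
move=> l j L u hl hj /=; apply: divr_ge0; last exact: ler0n.
by apply: sumr_ge0 => t _; apply: EW_ge0.
Qed.

Variables (C0 : k.-tuple T).
Hypothesis E_gt1 : 1 < E.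
Hypothesis Q_E : Q = 64 * E.
Hypothesis r_E : r = 2 * Q ^ 2.
Hypothesis BI_ge : 216 * Q ^ 2 * k ^ 2 <= BI.
Hypothesis M_ge : Q * BI <= M.
Hypothesis C0_sat : satisfies Rs C0.
Hypothesis C0_opt : cost X (entries C0) <= OPT X Rs.

Let j0 : 'I_k := Ordinal k0.
Let opt := \sum_(x in X) hdist x (tnth C0 (jX C0 j0 x)).
Local Notation kap := (kappa R BI M).
Local Notation specok := (specok k X Q BI M (row 0)).

Let BI0 : 0 < BI.
Proof.
apply: leq_trans BI_ge; rewrite !(muln_gt0, expn_gt0) k0 Q_E muln_gt0 /=.
by rewrite (ltnW E_gt1).
Qed.

(** The target is at least a [1 / BI] fraction of the sampled set, which costs the factor [BI]; the
    uniform guess of the weight costs [M + 1]. *)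
Lemma V_step A th Sg wg :
  (forall l j, l < k.+2 -> j < k -> specok A th Sg wg (l, j)) ->
  F3_step X Rs xs Q M A th (V R X Rs E BI M Sg wg).
Proof.
move=> ok l j L u hl hj; cbv zeta.
set w := fun x => wt k Q l (nth 0 th j) (mdT A x).
have [[t0 ht0 Ew] hS] := ok l j hl hj.
set V' := V R X Rs E BI M Sg wg.
set B := BB k X Q A th (l, j) in Ew hS.
have w01 x : w x = (0 < w x).
  rewrite /w /wt; case: ifP => _; first by case: (_ == _).
  by rewrite addn1 -ltnS hl; case: (_ <= _).
have tB : \sum_(y in X) w y = #|B|.
  rewrite /B /BB -sum1_card; under [RHS]eq_bigl do rewrite inE.
  by rewrite [RHS]big_mkcondr; apply: eq_bigr => x _; rewrite w01 /w /=; case: (0 < _).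
pose h (x : T) := V' L (addT (wg (l, j)) j x u).
have h0 x : (0 <= h x)%R by apply: V_ge0.
have -> : V' ((l, j) :: L) u = (kap * avg (Sg (l, j)) h)%R by [].
have key : (avg (Sg (l, j)) h / BI%:R <= EW w h)%R.
  rewrite /EW tB; case: hS => [[B0 ->]|[sub S0 le]].
    rewrite B0 cards0 eqxx /avg big_set1 cards1 divr1.
    by rewrite ler_pdivrMr ?ltr0n // ler_peMr // ler1n.
  have B0 : #|B| != 0.
    rewrite -lt0n; apply: leq_trans (subset_leq_card sub); by rewrite card_gt0.
  rewrite (negbTE B0) /avg -mulrA -invfM -natrM.
  apply: (@le_trans _ _ ((\sum_(x in Sg (l, j)) h x) / #|B|%:R)%R).
    apply: ler_wpM2l; first by apply: sumr_ge0.
    rewrite lef_pV2 ?posrE ?ltr0n ?lt0n // ?muln_eq0 ?negb_or ?cards_eq0 ?S0 -?lt0n //.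
    by rewrite ler_nat mulnC.
  rewrite ler_wpM2r ?invr_ge0 ?ler0n //.
  rewrite big_mkcond [leRHS]big_mkcond; apply: ler_sum => x _.
  case: ifP => [xS|_].
    have : x \in B by apply: (subsetP sub).
    by rewrite inE => /andP [-> h1]; rewrite w01 h1 mul1r.
  by case: ifP => // _; rewrite mulr_ge0 ?ler0n.
rewrite /kappa natrM invfM -mulrA mulrC [(_ * avg _ _)%R]mulrC.
rewrite ler_wpM2r ?invr_ge0 ?ler0n //.
(* Of the average over [t] only the right guess [t0] is kept. *)
apply: le_trans key _; rewrite (bigD1 (Ordinal (ht0 : t0 < M.+1))) //= -/V'.
rewrite tB -Ew lerDl sumr_ge0 // => t _; apply: EW_ge0 => x; exact: V_ge0.
Qed.

Definition pfinal : R := (kap ^+ (k.+2 * (k * r)) / 2)%R.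
(** A factor [1 / 6] for each anchor, [1 / BI] for each threshold, [kappa] for each sample, and
    [1 / 2] from the second moment bound. *)
Definition ptrial : R := (6^-1 ^+ k * (BI%:R^-1 ^+ k * pfinal))%R.

Let pfinal_ge0 : (0 <= pfinal)%R.
Proof. by rewrite divr_ge0 // exprn_ge0 // kappa_ge0. Qed.

Lemma EW_scale w (g : T -> R) (b : R) : EW w (fun x => g x * b)%R = (EW w g * b)%R.
Proof.
rewrite /EW; case: eqP => // _; rewrite [RHS]mulrAC [in RHS]mulr_suml; congr (_ / _)%R.
by apply: eq_bigr => x _; rewrite mulrA.
Qed.

Lemma trial_success s : Inv s ->
  J TrialC s (t_trial n m k Q r M) (trial_post s)
    (fun s' => (goal_cost X Rs E (regs s' 15))%:R)%R ptrial.
Proof.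
move=> inv.
(* All random choices still ahead are prepaid; [f2] likewise pays [1 / BI] for each threshold not
   yet drawn. *)
pose f1 A i : R := ((good1 X C0 j0 A i)%:R * (6^-1 ^+ i * (BI%:R^-1 ^+ k * pfinal)))%R.
pose g2 A th := (dsum X A <= 18 * opt) && [forall j : 'I_k,
  (j < size th) ==> good2 X Q BI (row 0) C0 j0 A j (nth 0 th j)].
pose f2 A th : R := ((g2 A th)%:R * (BI%:R^-1 ^+ (k - size th) * pfinal))%R.
have bk0 i : (0 <= BI%:R^-1 ^+ i * pfinal :> R)%R.
  by rewrite mulr_ge0 // exprn_ge0 // invr_ge0 ler0n.
have f10 A i : (0 <= f1 A i)%R.
  by rewrite mulr_ge0 ?ler0n // mulr_ge0 // exprn_ge0 // invr_ge0.
have f20 A th : (0 <= f2 A th)%R by rewrite mulr_ge0 ?ler0n.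
have g1 : good1 X C0 j0 [:: row 0] k.
  by apply/orP; right; rewrite -[k in _ <= k]card_ord max_card.
have := @J_trial R eps m k X Rs xs E Q r M N k0 xs_enum s f1 f2 inv f10 f20.
have -> : f1 [:: row 0] k = ptrial by rewrite /f1 g1 mul1r.
apply.
- move=> A i A0; rewrite /f1 EW_scale.
  case g: (good1 X C0 j0 A i.+1); last first.
    rewrite mul0r mulr_ge0 //; first by apply: EW_ge0 => x; apply: ler0n.
    by rewrite mulr_ge0 // exprn_ge0 // invr_ge0.
  rewrite mul1r exprS -mulrA ler_wpM2r //.
    by rewrite mulr_ge0 // exprn_ge0 // invr_ge0.
  have := anchor_step R A0 g; rewrite /EW -/(dsum X A); case: eqP => // _ ->.
  by rewrite invf_le1 ?ler1n.
- move=> A sA; rewrite /f1 /f2 /= subn0 expr0 mul1r ler_wpM2r //.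
  rewrite ler_nat; case g: (good1 _ _ _ _ _) => //; rewrite lt0b /g2 good1_0 //=.
  by apply/forallP.
- move=> A th sA st.
  set sel := fun x => (if \sum_(y in X) dT A y == 0%N then 0%N else dT A x).
  have Ef x : f2 A (rcons th (sel x)) = ((g2 A (rcons th (sel x)))%:R *
      (BI%:R^-1 ^+ (k - (size th).+1) * pfinal))%R.
    by rewrite /f2 size_rcons.
  rewrite (_ : EW _ _ = EW (dT A) (fun x => (g2 A (rcons th (sel x)))%:R *
      (BI%:R^-1 ^+ (k - (size th).+1) * pfinal))%R); last first.
    exact: EW_ext Ef.
  rewrite EW_scale {1}/f2.
  case g: (g2 A th); last first.
    by rewrite mul0r mulr_ge0 //; apply: EW_ge0 => x; apply: ler0n.
  have [le /forallP hj] := andP g.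
  rewrite mul1r -(subnSK st) exprS -mulrA ler_wpM2r //.
  have gr th' : good2 X Q BI (row 0) C0 j0 A (Ordinal st) th' ->
      g2 A (rcons th th').
    move=> hth; rewrite /g2 le /=; apply/forallP => j; apply/implyP.
    rewrite size_rcons ltnS leq_eqVlt nth_rcons => /orP [/eqP Ej|jlt].
      rewrite Ej ltnn eqxx; have -> // : j = Ordinal st by apply: val_inj.
    by rewrite jlt; have /implyP := hj j; apply.
  have := @thr_step R m k X Rs E Q r BI M (row 0) C0 j0 E_gt1 Q_E r_E BI_ge M_ge C0_sat C0_opt A
    (Ordinal st) sA le.
  rewrite /EW -/(dsum X A) /sel -/(dsum X A); case: eqP => [_ gg|_ hh].
    by rewrite gr // invf_le1 ?ltr0n // ler1n.
  apply: le_trans hh _; rewrite ler_wpM2r ?invr_ge0 ?ler0n //.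
  apply: ler_sum => x _; rewrite ler_wpM2l ?ler0n // ler_nat.
  by case gg: (good2 _ _ _ _ _ _ _ _ _) => //; rewrite gr.
move=> A th sA st; case g: (g2 A th); last first.
  exists (fun _ _ => 0%R); split => //; last by rewrite /f2 g mul0r.
  move=> l j L u hl hj /=; apply: divr_ge0; last exact: ler0n.
  by apply: sumr_ge0 => t _; apply: EW_ge0.
have [le /forallP hj] := andP g.
have [|Sg [wg [ok hV]]] := @V_full R m k X Rs E Q r BI M (row 0) C0 j0 E_gt1 Q_E r_E BI_ge M_ge
   C0_sat C0_opt A th sA le.
  by move=> j; have /implyP := hj j; apply; rewrite st.
exists (V R X Rs E BI M Sg wg); split.
- exact: V_step.
- by move=> L u u' h; apply: eq_V.
- by move=> L u; apply: V_ge0.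
- by rewrite /f2 g st subnn expr0 !mul1r.
- move=> u /=; have -> // : feas Rs by apply/existsP; exists C0.
Qed.

End TrialSuccess.

(** * The main program *)

(** Constant multiples are spelled out as sums; the size of the expression depends on [d] and [e]
    only, so one assignment remains one step. *)
Definition dbl d e := iter d (fun e => Add e e) e.

Lemma eval_dbl s d e : eval s (dbl d e) = 2 ^ d * eval s e.
Proof. by elim: d => [|d IH] /=; rewrite ?mul1n // -/(dbl d e) IH expnS addnn -mul2n mulnA. Qed.

Lemma evalD s e1 e2 : eval s (Add e1 e2) = eval s e1 + eval s e2.
Proof. by []. Qed.

(** Since [eps] is accessible only through comparisons, [E] is found by linear search from 2 on;
    register 21 is the flag that stops it. *)
Definition FindE :=
  Seq (Assign 20 (Const 2)) (Seq (Assign 21 (Const 1))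
    (While (Leq (Const 1) (Reg 21))
      (If (LeqEps (Const 1) (Reg 20)) (Assign 21 (Const 0))
         (Assign 20 (Add (Reg 20) (Const 1)))))).

Definition t_find E := E.-1 * 3 + 5.

(** The choice [M = Q ^ (5 k)] makes [Q * BI <= M] for [BI = Q ^ (4 k)]. The number of trials, in
    register 7, has to exceed the inverse success probability of one trial. *)
Definition Init :=
  let k := Reg 2 in let km := Reg 25 in
  Seq FindE (Seq (Assign 4 (dbl 6 (Reg 20)))
  (Seq (Mul 5 (Reg 4) (Reg 4)) (Seq (Assign 5 (dbl 1 (Reg 5)))
  (Seq (Pow 3 (Const 2) k)
  (Seq (Pow 6 (Reg 4) (Add k (dbl 2 k)))
  (Seq (Mul 21 k k) (Seq (Mul 22 (Reg 21) k) (Seq (Mul 23 (Reg 22) (Reg 5))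
  (Seq (Pow 7 (Reg 4) (dbl 6 (Reg 23)))
  (Seq (Mul 8 (Reg 0) (Reg 1)) (Seq (Mul 24 (Reg 1) (Reg 3))
  (Seq (Mul 25 k (Reg 1))
  (Seq (Assign 9 (Add (Reg 8) (Reg 24)))
  (Seq (Assign 10 (Add (Reg 9) km)) (Seq (Assign 11 (Add (Reg 10) km))
  (Seq (Assign 12 (Add (Reg 11) km)) (Seq (Assign 13 (Add (Reg 12) km))
  (Seq (Assign 14 (Add (Reg 13) (Add k (Const 1))))
    (Assign 15 (Add (Reg 8) (Const 1))))))))))))))))))))).

Definition t_init n m k Q E r :=
  t_find E + t_mul Q + t_pow 2 k + t_pow Q (k + 4 * k) + t_mul k + t_mul (k * k) +
  t_mul (k * k * k) + t_pow Q (64 * (k * k * k * r)) + t_mul n + t_mul m + t_mul k + 40.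

Definition Main := Seq Init (Seq (For 16 (Reg 7) TrialC) (Assign 0 (Reg 10))).

Section Main.

Variables (R : realType) (eps : R) (m k : nat) (X : {set m.-tuple bool}).
Variables (Rs : m.-tuple {set k.-tuple bool}) (xs : seq (m.-tuple bool)).
Variable E : nat.
Hypothesis k0 : 0 < k.
Hypothesis xs_enum : perm_eq xs (enum X).
Hypothesis E_gt1 : 1 < E.
Hypothesis E_eps : (1 <= E%:R * eps)%R.
Hypothesis E_min : forall e, 1 < e -> (1 <= e%:R * eps)%R -> E <= e.

Local Notation n := (size xs).
Local Notation inp := (nth 0 (encode xs Rs)).
Local Notation Q := (64 * E).
Local Notation r := (2 * Q ^ 2).
Local Notation M := (Q ^ (k + 4 * k)).
Local Notation N := (Q ^ (64 * (k * k * k * r))).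
Local Notation Glob := (Glob n m k Q r M N inp).
Local Notation Inv := (Inv X Rs xs Q r M N).

Lemma tri_find s (I : state -> Prop) :
  (forall s', keep 20 s s' -> smem s' = smem s -> regs s' 20 = E -> I s') ->
  tri eps FindE s (t_find E) I.
Proof.
move=> HI.
have -> : t_find E = (1 + (1 + (E.-1 * 3).+1).+1).+1 by rewrite /t_find; lia.
apply: tri_seq; apply: tri_assign; apply: tri_seq; apply: tri_assign.
(* There are [E - 1] turns: [E - 2] increments and a last one that only clears the flag. *)
pose P i s' := [/\ regs s' 20 = minn (2 + i) E, regs s' 21 = (i < E.-1),
  keep 20 s s' & smem s' = smem s].
apply: (@tri_weaken _ _ _ _ (E.-1 * 3).+1 _ (P E.-1)) => //; last first.
  move=> s' [h1 _ h3 h4]; apply: HI => //; rewrite h1; lia.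
apply: (@tri_while _ _ _ _ _ _ 2) => [i s' hi [_ h2 _ _]|s' [_ h2 _ _]|i s' hi [h1 h2 h3 h4]|].
- by rewrite /= h2 hi.
- by rewrite /= h2 ltnn.
- have E1 : regs s' 20 = 2 + i by rewrite h1; lia.
  apply: tri_if; rewrite /= E1 => h.
    have hE : E <= 2 + i by apply: E_min.
    apply: tri_assign; split; rewrite /= /upd /= ?E1.
    + by lia.
    + by rewrite (_ : i.+1 < E.-1 = false) //; lia.
    + exact: keep_set.
    + exact: h4.
  have hE : 2 + i < E.
    rewrite ltn_neqAle; apply/andP; split; last by lia.
    by apply: contra h => /eqP ->; exact: E_eps.
  apply: tri_assign; split; rewrite /= /upd /= ?E1 ?h2.
  + by lia.
  + by rewrite hi (_ : i.+1 < E.-1) //; lia.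
  + exact: keep_set.
  + exact: h4.
- split; rewrite /= /upd /= ?addn0.
  + by lia.
  + by rewrite (_ : 0 < E.-1) //; lia.
  + by do 2 apply: keep_set => //.
  + by [].
Qed.

Definition others d (s s' : state) :=
  forall x, x < 60 -> x != d -> regs s' x = regs s x.

Lemma tri_assignK v d e s (I : state -> Prop) : eval s e = v ->
  (forall s', others d s s' -> smem s' = smem s -> regs s' d = v -> I s') ->
  tri eps (Assign d e) s 1 I.
Proof.
move=> ve HI; apply: tri_assign; apply: HI => //; last by rewrite regs_same.
by move=> x _ xd; rewrite regs_other.
Qed.

Lemma tri_mulK a b d x y s (I : state -> Prop) :
  [&& d < 60, x < 60, y < 60, x != d & y != d] -> regs s x = a -> regs s y = b ->
  (forall s', others d s s' -> smem s' = smem s -> regs s' d = a * b -> I s') ->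
  tri eps (Mul d (Reg x) (Reg y)) s (t_mul a) I.
Proof.
case/and5P => d60 x60 y60 xd yd xa yb HI; have lt60 z : z < 60 -> z != 60 by lia.
apply: (@tri_mul _ _ _ _ _ _ _ b) => [|s' k' m'|s' k' m' E'].
- exact: lt60.
- by rewrite /= !k' // lt60.
- by apply: HI => // z z60 zd; apply: k' => //; apply: lt60.
Qed.

Lemma tri_powK a b d e1 e2 s (I : state -> Prop) : d < 60 ->
  (forall s', others d s s' -> eval s' e1 = a /\ eval s' e2 = b) ->
  (forall s', others d s s' -> smem s' = smem s -> regs s' d = a ^ b -> I s') ->
  tri eps (Pow d e1 e2) s (t_pow a b) I.
Proof. by move=> d60 He HI; apply: tri_pow => // s' k' _; apply: He. Qed.

Ltac look := rewrite ?eval_dbl ?evalD ?eval_dbl /=; repeat match goal with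
  | E : regs ?s ?d = _ |- context [regs ?s ?d] => rewrite E
  | K : others _ ?s' ?s |- context [regs ?s ?y] => rewrite (K y isT isT)
  | K : keep _ ?s' ?s |- context [regs ?s ?y] => rewrite (K y isT)
  end.

Lemma tri_init (I : state -> Prop) :
  (forall s, Glob s -> regs s 15 = n * m + 1 -> I s) ->
  tri eps Init (init xs Rs) (t_init n m k Q E r) I.
Proof.
move=> HI; set s0 := init xs Rs.
have e0 : regs s0 0 = n by [].
have e1 : regs s0 1 = m by [].
have e2 : regs s0 2 = k by [].
have em : smem s0 = inp by [].
clearbody s0.
(* The time is left open, assembled by the rules along the execution, and compared with [t_init] at
   the very end. *)
refine (@tri_time _ _ _ _ _ _ _ _ _); last first.
apply: tri_seq; apply: tri_find => s1 k1 m1 r1.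
apply: tri_seq; apply: (tri_assignK (v := Q)) => [|s2 k2 m2 r2].
  by look.
apply: tri_seq; apply: (tri_mulK (a := Q) (b := Q)) => [//|||s3 k3 m3 r3]; try by look.
apply: tri_seq; apply: (tri_assignK (v := r)) => [|s4 k4 m4 r4].
  by look.
apply: tri_seq; apply: (tri_powK (a := 2) (b := k)) => [//|s' k'|s5 k5 m5 r5].
  by look.
apply: tri_seq; apply: (tri_powK (a := Q) (b := k + 4 * k)) => [//|s' k'|s6 k6 m6 r6].
  by look; rewrite !addnn -!mul2n mulnA.
apply: tri_seq; apply: (tri_mulK (a := k) (b := k)) => [//|||s7 k7 m7 r7]; try by look.
apply: tri_seq; apply: (tri_mulK (a := k * k) (b := k)) => [//|||s8 k8 m8 r8]; try by look.
apply: tri_seq; apply: (tri_mulK (a := k * k * k) (b := r)) => [//|||s9 k9 m9 r9]; try by look.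
apply: tri_seq; apply: (tri_powK (a := Q) (b := 64 * (k * k * k * r))) => [//|s' k'|s10 k10 m10 r10].
  by look.
apply: tri_seq; apply: (tri_mulK (a := n) (b := m)) => [//|||s11 k11 m11 r11]; try by look.
apply: tri_seq; apply: (tri_mulK (a := m) (b := 2 ^ k)) => [//|||s12 k12 m12 r12]; try by look.
apply: tri_seq; apply: (tri_mulK (a := k) (b := m)) => [//|||s13 k13 m13 r13]; try by look.
apply: tri_seq; apply: (tri_assignK (v := cb n m k)) => [|s14 k14 m14 r14]; first by look.
apply: tri_seq; apply: (tri_assignK (v := bb n m k)) => [|s15 k15 m15 r15]; first by look.
apply: tri_seq; apply: (tri_assignK (v := ub n m k)) => [|s16 k16 m16 r16].
  by look; rewrite /bb /ub; lia.
apply: tri_seq; apply: (tri_assignK (v := vb n m k)) => [|s17 k17 m17 r17].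
  by look; rewrite /ub /vb; lia.
apply: tri_seq; apply: (tri_assignK (v := ab n m k)) => [|s18 k18 m18 r18].
  by look; rewrite /vb /ab; lia.
apply: tri_seq; apply: (tri_assignK (v := hb n m k)) => [|s19 k19 m19 r19].
  by look; rewrite /hb; lia.
apply: (tri_assignK (v := n * m + 1)) => [|s20 k20 m20 r20]; first by look.
apply: HI => //; split; last first.
  split; first by split; look.
  by move=> a _; rewrite m20 m19 m18 m17 m16 m15 m14 m13 m12 m11 m10 m9 m8 m7 m6 m5 m4 m3 m2 m1 em.
by split; split; look.
rewrite /t_init; lia.
Qed.

Definition t_main n m k Q E r M N :=
  t_init n m k Q E r + t_for N (t_trial n m k Q r M) + 3.

Local Notation tT := (t_trial n m k Q r M).
Local Notation good c := (goal_cost X Rs E c).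

Let sat_post s := feas Rs -> satisfies Rs (output m k s).
Let won s : R := ((good (cost X (entries (output m k s))))%:R)%R.

Lemma output_bb s : output m k (set_reg s 0 (bb n m k)) = rows_at m k s (bb n m k).
Proof.
apply: eq_from_tnth => j; rewrite !tnth_mktuple.
by apply: eq_from_tnth => i; rewrite !tnth_mktuple lt0n.
Qed.

Lemma Inv_16 s v : Inv s -> Inv (set_reg s 16 v).
Proof.
move=> [G H]; split; last exact: H.
by apply: (@Glob_keep n m k Q r M N inp 16 s) => //; apply: keep_set.
Qed.

(** Success is permanent, since register 15 never increases; while it is missing, each further trial
    succeeds with probability at least [p] whatever the state. The loop value is therefore 1, or
    [1 - (1 - p) ^ (N - i)]. *)
Lemma J_main (p : R) : (0 <= p <= 1)%R ->
  (forall s, Inv s -> J eps TrialC s tT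
     (fun s' => [/\ Inv s', regs s' 16 = regs s 16, regs s' 15 <= regs s 15 &
        regs s' 15 <= n * m])
     (fun s' => (good (regs s' 15))%:R)%R p) ->
  J eps Main (init xs Rs) (t_main n m k Q E r M N) sat_post won
    (1 - (1 - p) ^+ N)%R.
Proof.
move=> /andP [p0 p1] trial.
have q0 i : (0 <= (1 - p) ^+ i)%R by rewrite exprn_ge0 // subr_ge0.
have q1 i : ((1 - p) ^+ i <= 1)%R by rewrite exprn_ile1 ?subr_ge0 // lerBlDr lerDl.
have won0 s : (0 <= won s)%R by rewrite ler0n.
(* At least one trial runs, so at the end register 15 is at most [n * m] and the best block is
   valid. *)
have N0 : 0 < N by rewrite expn_gt0 muln_gt0 (ltnW E_gt1).
pose I i s := [/\ Inv s, regs s 16 = i & 0 < i -> regs s 15 <= n * m].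
pose f i s : R := (if good (regs s 15) then 1 else 1 - (1 - p) ^+ (N - i))%R.
have f_ge0 i s : (0 <= f i s)%R by rewrite /f; case: ifP => // _; rewrite subr_ge0.
have -> : t_main n m k Q E r M N =
  (t_init n m k Q E r + (t_for N tT + 1).+1).+1 by rewrite /t_main; lia.
pose Pi s := Inv s /\ regs s 15 = n * m + 1.
refine (@J_seq _ _ _ _ _ _ _ Pi _ (fun=> 1 - (1 - p) ^+ N)%R _ _ won0 _ _).
  refine (tri_J _ _) => [|//]; refine (tri_init _) => s G h15; split=> //; split=> //.
  by rewrite h15 addn1 ltnn.
move=> s [iv h15].
refine (@J_seq _ _ _ _ _ _ _ (I N) _ (f N) _ _ won0 _ _); last first.
  move=> s1 [[G1 h1] _ /(_ N0) h2]; have [hc hs] := h1 h2.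
  have e10 : eval s1 (Reg 10) = bb n m k by rewrite /= (GE G1).
  apply: J_assign; rewrite e10.
    by rewrite /sat_post output_bb.
  by rewrite /won output_bb hc /f subnn expr0 subrr; case: (good _).
have H := @J_for _ eps 16 (Reg 7) TrialC N s tT I f f_ge0.
refine (J_conseq (H _ _ _) (leqnn _) (f_ge0 _) _ _) => {H} //.
- by move=> i s1 _ [[G _] h _]; split=> //; rewrite /= (GE G).
- move=> i s1 hi [iv1 h16 _].
  have HI s' : [/\ Inv s', regs s' 16 = regs s1 16, regs s' 15 <= regs s1 15 &
      regs s' 15 <= n * m] -> I i.+1 (incr s' 16).
    move=> [a1 a2 a3 a4]; split; first exact: Inv_16.
      by rewrite regs_same a2 h16.
    by move=> _; rewrite regs_other.
  have f_ge0' s' : (0 <= f i.+1 (incr s' 16))%R by [].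
  case Eg: (good (regs s1 15)).
    refine (J_conseq (tri_J (f := fun=> 1%R) (v := 1%R) (trial_sure eps k0 xs_enum iv1) _)
      (leqnn _) f_ge0' _ _) => [//|s' h|]; last by rewrite /f Eg.
    split; first exact: HI.
    case: h => _ _ h _; rewrite /f regs_other // (_ : good _) //.
    by apply: leq_trans Eg; rewrite leq_mul2l h orbT.
  (* The next loop value is affine in the success indicator, [(1 - q) + q * good], with expectation
     at least [1 - q (1 - p)]. *)
  set q := ((1 - p) ^+ (N - i.+1))%R.
  refine (J_conseq (J_affine (a := (1 - q)%R) (b := q) (g := fun s' => f i.+1 (incr s' 16))
     (q0 _) (trial _ iv1) _) (leqnn _) f_ge0' _ _) => [s' _|s' h|].
  + rewrite /f regs_other // -/q; case: (good _) => /=; last by rewrite mulr0 addr0.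
    by rewrite mulr1 subrK.
  + by split; [exact: HI|].
  + rewrite /f Eg -(subnSK hi) exprS -/q le_eqVlt; apply/orP; left; apply/eqP; ring.
- rewrite /f; case: ifP => _; rewrite ?subn0 //.
  by rewrite gerBl.
Qed.

End Main.

(** * Amplification and the choice of exponents *)

Section MainBounds.

Variables (R : realType) (eps : R) (m k : nat) (X : {set m.-tuple bool}).
Variables (Rs : m.-tuple {set k.-tuple bool}) (xs : seq (m.-tuple bool)).
Variable E : nat.
Hypothesis k0 : 0 < k.
Hypothesis xs_enum : perm_eq xs (enum X).
Hypothesis E_gt1 : 1 < E.
Hypothesis E_eps : (1 <= E%:R * eps)%R.
Hypothesis E_min : forall e, 1 < e -> (1 <= e%:R * eps)%R -> E <= e.

Local Notation n := (size xs).
Local Notation inp := (nth 0 (encode xs Rs)).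
Local Notation Q := (64 * E).
Local Notation r := (2 * Q ^ 2).
Local Notation BI := (Q ^ (4 * k)).
Local Notation M := (Q ^ (k + 4 * k)).
Local Notation N := (Q ^ (64 * (k * k * k * r))).
Local Notation Glob := (Glob n m k Q r M N inp).
Local Notation Inv := (Inv X Rs xs Q r M N).

Lemma main_sure :
  always eps (fun s => feas Rs -> satisfies Rs (output m k s))
    (t_main n m k Q E r M N) ([:: Main], init xs Rs).
Proof.
have p01 : (0 <= (0 : R) <= 1)%R by rewrite lexx ler01.
refine (proj1 (J_main k0 xs_enum E_gt1 E_eps E_min (p := 0%R) p01 _)) => s iv.
by refine (tri_J (trial_sure eps k0 xs_enum iv) _) => s' _; exact: ler0n.
Qed.

Let Q2 : 2 * 6 <= Q.
Proof. by lia. Qed.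

Definition odds := 2 * 6 ^ k * BI ^ k * (M.+1 * BI) ^ (k.+2 * (k * r)).

Lemma ptrial_odds : ptrial R k r BI M = (odds%:R^-1)%R.
Proof.
rewrite /ptrial /pfinal /kappa /odds; set b := BI; set a := M.+1 * b.
set e := k.+2 * _; rewrite !exprVn -!natrX -!invfM -!natrM.
by congr ((_%:R)^-1)%R; lia.
Qed.

Lemma odds_le : odds <= N.
Proof.
have Q0 : 0 < Q by lia.
have le a b : a <= b -> Q ^ a <= Q ^ b by move=> h; rewrite leq_pexp2l.
have h6 : 2 * 6 ^ k <= Q ^ k.
  apply: (@leq_trans ((2 * 6) ^ k)); last by rewrite leq_exp2r.
  by rewrite expnMn leq_mul2r (@leq_pexp2l 2 1 k) // orbT.
have hM : M.+1 * BI <= Q ^ (10 * k).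
  apply: (@leq_trans (Q ^ 1 * M * BI)).
    have M0 : 0 < M by rewrite expn_gt0 Q0.
    by rewrite leq_mul2r expn1; apply/orP; right; nia.
  by rewrite -!expnD; apply: le; lia.
have r0 : 0 < r by rewrite muln_gt0 expn_gt0 Q0.
apply: (@leq_trans (Q ^ k * Q ^ (4 * k * k) * Q ^ (10 * k * (k.+2 * (k * r))))).
  rewrite [Q ^ (4 * k * k)]expnM [Q ^ (10 * k * _)]expnM; apply: leq_mul.
    by rewrite leq_mul2r h6 orbT.
  by rewrite leq_exp2r // muln_gt0 /= muln_gt0 k0 r0.
rewrite -!expnD; apply: le.
move: r0; move: (r) => r' r0.
have h1 : k * k <= k * k * (k * r') by rewrite leq_pmulr // muln_gt0 k0.
have h2 : k <= k * k by rewrite leq_pmulr.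
have h3 : k.+2 * (k * k * r') <= 3 * k * (k * k * r') by rewrite leq_mul2r; lia.
lia.
Qed.

Lemma goal_cost_eps c : goal_cost X Rs E c ->
  (c%:R <= (1 + eps) * (OPT X Rs)%:R)%R.
Proof.
rewrite /goal_cost; move: (OPT _ _) => o Ec.
have E0 : (0 < E%:R :> R)%R by rewrite ltr0n ltnW.
rewrite -(ler_pM2l E0) -natrM; apply: (@le_trans _ _ ((E + 1) * o)%:R%R).
  by rewrite ler_nat.
by rewrite natrM mulrA ler_wpM2r // mulrDr mulr1 natrD lerD2l.
Qed.

Lemma main_success : (exists C, satisfies Rs C) ->
  (1 - 1 / expR 1 <= prob eps
     (fun s => (cost X (entries (output m k s)))%:R <= (1 + eps) * (OPT X Rs)%:R)
     (t_main n m k Q E r M N) ([:: Main], init xs Rs))%R.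
Proof.
pose ok s := ((cost X (entries (output m k s)))%:R <= (1 + eps) * (OPT X Rs)%:R)%R.
have good_ok s : (0 + 1 * (goal_cost X Rs E (cost X (entries (output m k s))))%:R <= (ok s)%:R :> R)%R.
  rewrite add0r mul1r; case Eg: (goal_cost _ _ _ _); last exact: ler0n.
  rewrite (_ : ok s = true); [exact: lexx|exact: goal_cost_eps].
move=> hC; have [C0 sC0 oC0] := OPT_attained X hC.
have Q0 : 0 < Q by lia.
(* Here [216 <= 16 ^ 2 <= Q ^ 2] and [k ^ 2 <= 4 ^ (k - 1) <= Q ^ (k - 1)], a total exponent of
   [k + 3 <= 4 k]. *)
have h1 : 216 * Q ^ 2 * k ^ 2 <= BI.
  have hk : k <= 2 ^ k.-1.
    by case: (k) k0 => // k' _; exact: ltn_expl.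
  apply: (@leq_trans (Q ^ 2 * Q ^ 2 * Q ^ k.-1)).
    apply: leq_mul.
      rewrite leq_mul2r; apply/orP; right.
      by apply: (@leq_trans (16 ^ 2)) => //; rewrite leq_exp2r //; lia.
    apply: (@leq_trans ((2 ^ k.-1) ^ 2)); first by rewrite leq_exp2r.
    by rewrite -expnM mulnC expnM; case: (k.-1) => // k'; rewrite leq_exp2r //; lia.
  by rewrite -!expnD leq_pexp2l //; lia.
have h2 : Q * BI <= M.
  by rewrite -{1}(expn1 Q) -expnD leq_pexp2l //; lia.
have := @trial_success R eps m k X Rs xs E Q r BI M N k0 xs_enum C0 E_gt1 erefl erefl h1 h2 sC0 oC0.
rewrite ptrial_odds => trial.
have pos a b : 0 < a -> 0 < a ^ b by rewrite expn_gt0 => ->.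
have o0 : 0 < odds.
  rewrite /odds (muln_gt0 (2 * 6 ^ k * BI ^ k)) (muln_gt0 (2 * 6 ^ k)) muln_gt0.
  have BI0 : 0 < BI by apply: pos.
  by rewrite !pos // (muln_gt0 M.+1) BI0.
have oR : (0 < odds%:R :> R)%R by rewrite ltr0n.
have p01 : (0 <= (odds%:R^-1 : R) <= 1)%R.
  by rewrite invr_ge0 ler0n invf_le1 // ler1n.
have [ha hv] := J_main k0 xs_enum E_gt1 E_eps E_min p01 trial.
have he := expct_affine (g := fun s => (ok s)%:R%R) (fun s _ => good_ok s) ha.
rewrite add0r mul1r in he; rewrite probE; refine (le_trans _ (le_trans hv he)).
clear ha hv he trial.
rewrite lerD2l lerN2 div1r -expRN.
(* With [p = 1 / odds]: [(1 - p) ^ N <= exp (- p N) <= exp (- 1)], as [N >= odds]. *)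
apply: (@le_trans _ _ (expR (- odds%:R^-1) ^+ N)%R).
  case/andP: p01 => a b.
  by rewrite lerXn2r ?nnegrE ?subr_ge0 ?expR_ge0 ?expR_ge1Dx.
rewrite -expRM_natl ler_expR.
rewrite mulrN lerN2 ler_pdivlMr // mul1r ler_nat.
exact: odds_le.
Qed.

End MainBounds.

(** * Running time *)

Section Time.

Variables Z al be : nat.
Hypotheses (Z_ge : 128 <= Z) (al_gt0 : 0 < al) (be_gt0 : 0 < be).

(** Monomial bounds that compose along the syntax of a time expression. A base [Z >= 128] absorbs
    constants and sums, so that only the degrees in [n] and [m] have to be exact; positivity of [al]
    and [be] is what allows padding them. *)
Definition bounded p a b x := x <= Z ^ p * (al ^ a * be ^ b).

Let Z0 : 0 < Z. Proof. exact: leq_trans Z_ge. Qed.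

Lemma bounded_le p a b p' a' b' x : [&& p <= p', a <= a' & b <= b'] ->
  bounded p a b x -> bounded p' a' b' x.
Proof.
move=> /and3P [hp ha hb] /leq_trans; apply.
by rewrite !leq_mul ?leq_pexp2l.
Qed.

Let bound_gt0 p a b : 0 < Z ^ p * (al ^ a * be ^ b).
Proof. by rewrite !muln_gt0 !expn_gt0 Z0 al_gt0 be_gt0. Qed.

Lemma bounded_const x : x <= 128 -> bounded 1 0 0 x.
Proof. by rewrite /bounded expn1 !muln1 => h; apply: leq_trans h Z_ge. Qed.

Lemma bounded_scale c p a b x y : c <= 128 -> bounded p a b y -> x <= c * y ->
  bounded p.+1 a b x.
Proof.
move=> hc hy /leq_trans; apply; rewrite /bounded expnS -mulnA.
by apply: leq_mul => //; apply: leq_trans hc Z_ge.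
Qed.

Lemma bounded_add p a b q c d x y : bounded p a b x -> bounded q c d y ->
  bounded (maxn p q).+1 (maxn a c) (maxn b d) (x + y).
Proof.
move=> hx hy; set u := Z ^ maxn p q * (al ^ maxn a c * be ^ maxn b d).
have hx' : x <= u by apply: bounded_le hx; rewrite !leq_maxl.
have hy' : y <= u by apply: bounded_le hy; rewrite !leq_maxr.
by apply: (@bounded_scale 2 _ _ _ _ u) => //; [rewrite /bounded|lia].
Qed.

Lemma bounded_succ p a b x : bounded p a b x -> bounded p.+1 a b x.+1.
Proof.
move=> hx; apply: (@bounded_scale 2 _ _ _ _ (Z ^ p * (al ^ a * be ^ b))) => //.
  exact: leqnn.
move: hx (bound_gt0 p a b); rewrite /bounded; lia.
Qed.

Lemma bounded_mul p a b q c d x y : bounded p a b x -> bounded q c d y ->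
  bounded (p + q) (a + c) (b + d) (x * y).
Proof.
move=> hx hy; apply: (leq_trans (leq_mul hx hy)).
by rewrite !expnD mulnACA [X in _ * X <= _]mulnACA.
Qed.

Lemma bounded_for p a b q c d x t : bounded p a b x -> bounded q c d t ->
  bounded (p + q).+1 (a + c) (b + d) (t_for x t).
Proof.
move=> hx ht; set u := Z ^ p * (al ^ a * be ^ b); set v := Z ^ q * (al ^ c * be ^ d).
have h : bounded (p + q) (a + c) (b + d) (u * v).
  by apply: bounded_mul; exact: leqnn.
apply: (@bounded_scale 7 _ _ _ _ (u * v)) => //.
have u0 : 0 < u := bound_gt0 p a b; have v0 : 0 < v := bound_gt0 q c d.
move: hx ht; rewrite /bounded -/u -/v /t_for => hx ht; nia.
Qed.

Ltac bound := repeat match goal with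
  | H : is_true (bounded _ _ _ ?x) |- is_true (bounded _ _ _ ?x) => exact: H
  | |- is_true (bounded _ _ _ (t_for _ _)) => eapply bounded_for
  | |- is_true (bounded _ _ _ (_ + _)) => eapply bounded_add
  | |- is_true (bounded _ _ _ (_ * _)) => eapply bounded_mul
  | |- is_true (bounded _ _ _ _.+1) => eapply bounded_succ
  | |- is_true (bounded _ _ _ _) => apply: bounded_const => //
  end.

Variables n m k Q r M : nat.
Hypotheses (bn : bounded 0 1 0 n) (bm : bounded 0 0 1 m) (bk : bounded 1 0 0 k)
  (b2k : bounded 1 0 0 (2 ^ k)) (bQ : bounded 1 0 0 Q) (br : bounded 3 0 0 r)
  (bM : bounded 5 0 0 M).

(** The point is the degree 1 in both [n] and [m]; the exponent 100 of [Z = Q ^ k] is merely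
    generous. *)
Lemma bounded_trial : bounded 100 1 1 (t_trial n m k Q r M).
Proof.
rewrite /t_trial /t_anchors /t_thr /t_draws /t_draw /t_sampler /t_total /t_scan
  /t_pt /t_mindist /t_ham /t_acc /t_finish /t_choose /t_choose_at /t_decode
  /t_decode_body /t_evaluate /t_total /t_update /t_pt /t_mindist /t_ham
  /t_init_trial /t_pow /t_mul.
eapply bounded_le; last by bound.
by [].
Qed.

Lemma bounded_init E : bounded 1 0 0 E.-1 -> bounded 100 1 1 (t_init n m k Q E r).
Proof.
move=> bE; rewrite /t_init /t_find /t_pow /t_mul.
by eapply bounded_le; last by bound.
Qed.

End Time.

Lemma t_main_le n m k E (Q := 64 * E) (r := 2 * Q ^ 2) (e := k * k * k * r) :
  0 < k -> 1 < E ->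
  t_main n m k Q E r (Q ^ (k + 4 * k)) (Q ^ (64 * e)) <=
  Q ^ (200 * e) * (maxn 1 n * maxn 1 m).
Proof.
move=> k0 E1; set Z := Q ^ k.
have Q2 : 128 <= Q by rewrite /Q; lia.
have Q0 : 0 < Q by exact: leq_trans Q2.
have QZ : Q <= Z by rewrite -{1}(expn1 Q) leq_pexp2l.
have Z2 : 128 <= Z by exact: leq_trans QZ.
have n0 : 0 < maxn 1 n by rewrite leq_maxl.
have m0 : 0 < maxn 1 m by rewrite leq_maxl.
have small x : x <= Z -> bounded Z (maxn 1 n) (maxn 1 m) 1 0 0 x.
  by rewrite /bounded expn1 !muln1.
have b2k : 2 ^ k <= Z by rewrite leq_exp2r //; lia.
have bk : k <= Z by apply: leq_trans b2k; apply: ltnW; exact: ltn_expl.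
have bE : E.-1 <= Z by apply: leq_trans QZ; rewrite /Q; lia.
have bn : bounded Z (maxn 1 n) (maxn 1 m) 0 1 0 n.
  by rewrite /bounded expn0 expn1 mul1n muln1 leq_maxr.
have bm : bounded Z (maxn 1 n) (maxn 1 m) 0 0 1 m.
  by rewrite /bounded expn0 expn1 !mul1n leq_maxr.
have br : bounded Z (maxn 1 n) (maxn 1 m) 3 0 0 r.
  rewrite /bounded !muln1 /r (expnS Z 2); apply: leq_mul; first by lia.
  by rewrite leq_exp2r.
have bM : bounded Z (maxn 1 n) (maxn 1 m) 5 0 0 (Q ^ (k + 4 * k)).
  by rewrite /bounded !muln1 -expnM leq_pexp2l //; lia.
have ht := bounded_trial Z2 n0 m0 bn bm (small _ bk) (small _ b2k) (small _ QZ) br bM.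
have hi := bounded_init Z2 n0 m0 bn bm (small _ bk) (small _ QZ) br (small _ bE).
move: ht hi; rewrite /t_main /t_for /bounded !expn1.
set t1 := t_trial _ _ _ _ _ _; set t2 := t_init _ _ _ _ _ _.
set y := maxn 1 n * maxn 1 m; set N := Q ^ (64 * e) => ht hi.
have N0 : 0 < N by rewrite expn_gt0 Q0.
have y0 : 0 < y by rewrite muln_gt0 n0 m0.
have r0 : 0 < r by rewrite /r muln_gt0 expn_gt0 Q0.
have k3e : k <= e by rewrite /e -!mulnA leq_pmulr // muln_gt0 k0 muln_gt0 k0 r0.
(* Initialization, trials and loop overhead total at most [u + N (u + 3) + 6 <= 11 N u]. The
   exponents then add up to [64 e + 101 e <= 200 e]. *)
have h : 11 * Z ^ 100 <= Q ^ (101 * e).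
  rewrite -expnM mulnC; apply: (@leq_trans (Q ^ (k * 100) * Q ^ 1)).
    by rewrite leq_mul2l expn1; lia.
  by rewrite -expnD leq_pexp2l //; lia.
apply: (@leq_trans (N * (11 * Z ^ 100) * y)); last first.
  rewrite leq_mul2r; apply/orP; right; apply: (leq_trans (leq_mul (leqnn N) h)).
  by rewrite -expnD leq_pexp2l //; lia.
rewrite -mulnA -[11 * _ * y]mulnA; set u := Z ^ 100 * y in ht hi *.
have u0 : 0 < u by rewrite muln_gt0 expn_gt0 (leq_trans _ Z2).
move: N0 u0 ht hi; clearbody N u t1 t2; clear; nia.
Qed.

Local Open Scope ring_scope.

(** * Comparison with the claimed running time *)

Section TimeBound.

Variables (R : realType) (eps : R).
Hypothesis eps_gt0 : 0 < eps.

Local Notation scale_ok e := ((1 < e)%N && (1 <= e%:R * eps)).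

Lemma scale_exists : exists e : nat, scale_ok e.
Proof.
have h : 0 <= eps^-1 by rewrite invr_ge0 ltW.
exists (Num.bound eps^-1).+2 => /=.
rewrite -ler_pdivrMr // div1r; apply/ltW/(lt_le_trans (archi_boundP h)).
by rewrite ler_nat; lia.
Qed.

(** By minimality [(E - 1) eps < 1] when [E > 2], hence [E e < 1 + e]; for [E = 2] it suffices that
    [e <= 1 / 2]. *)
Lemma scale_le E (e := Num.min eps 2^-1) : (1 < E)%N ->
  (forall d : nat, (1 < d)%N -> 1 <= d%:R * eps -> (E <= d)%N) -> E%:R * e <= 2.
Proof.
move=> E1 Emin; have e2 : e <= 2^-1 by rewrite ge_min lexx orbT.
case: (ltngtP E 2) => [|E2|->]; first by lia.
  have h : E.-1%:R * eps < 1.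
    rewrite ltNge; apply/negP => /(Emin E.-1); lia.
  have ee : e <= eps by rewrite ge_min lexx.
  have : E.-1%:R * e <= E.-1%:R * eps by rewrite ler_wpM2l.
  rewrite -(prednK (ltnW E1)) -natr1 mulrDl; lra.
by lra.
Qed.

(** A crude bound, sufficient for changing the base from [exp] to 2 at the cost of a factor 2 in the
    exponent. *)
Lemma ln2_ge : 2^-1 <= ln 2 :> R.
Proof.
have h2 : (0 : R) < 2 by [].
have := @le_ln1Dx R (- 2^-1); rewrite (_ : 1 + - 2^-1 = 2^-1); last by field.
rewrite lnV ?posrE // lerN2; apply.
by lra.
Qed.

Lemma powR_exp (a x : R) : 0 < a -> a `^ x = expR (x * ln a).
Proof. by move=> a0; rewrite /powR gt_eqF. Qed.

(** Since [Q = O(1 / e)], taking logarithms reduces the claim to [k ^ 3 Q ^ 2 ln Q = O(k ^ 4 / e ^ 2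
    * ln (1 / e))]. The constant is [400 = 200 * 2] times [2 ^ 14] from [Q ^ 2], [2 ^ 3] from [ln Q]
    and 2 from [ln 2]. *)
Lemma time_bound_ge k n m E (Q := (64 * E)%N) : (1 < E)%N -> (0 < k)%N ->
  (forall d : nat, (1 < d)%N -> 1 <= d%:R * eps -> (E <= d)%N) ->
  (Q ^ (200 * (k * k * k * (2 * Q ^ 2))) * (maxn 1 n * maxn 1 m))%:R <=
  time_bound (400 * 2 ^ 18) 0 eps k n m.
Proof.
move=> E1 k0 Emin; have := scale_le E1 Emin; rewrite /time_bound.
set e := Num.min _ _ => Ee.
have e0 : 0 < e by rewrite lt_min eps_gt0 invr_gt0 ltr0n.
have e2 : e <= 2^-1 by rewrite ge_min lexx orbT.
rewrite [0%:R * _]mul0r powRr0 mulr1 natrM [(maxn 1 n * _)%:R]natrM mulrA.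
rewrite !ler_wpM2r // natrX powR_exp ?ltr0n //.
have q0 : 0 < Q%:R :> R by rewrite ltr0n muln_gt0; lia.
have -> : Q%:R ^+ (200 * (k * k * k * (2 * Q ^ 2))) =
  expR ((200 * (k * k * k * (2 * Q ^ 2)))%:R * ln Q%:R) :> R.
  by rewrite expRM_natl lnK.
rewrite ler_expR.
set L := ln e^-1.
have ei : 2 <= e^-1 by rewrite -[leLHS]invrK lef_pV2 ?posrE ?invr_gt0.
have L0 : 0 <= L by rewrite ln_ge0 //; apply: le_trans ei; rewrite ler1n.
have Qe : Q%:R * e <= 128 by rewrite /Q natrM -mulrA; lra.
have Qi : Q%:R <= 128 * e^-1 by rewrite ler_pdivlMr.
(* From [1 / e >= 2] one gets [Q <= 2 ^ 7 / e <= (1 / e) ^ 8]. *)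
have lnQ : ln Q%:R <= 8 * L.
  rewrite [8 * _]mulr_natl -lnXn ?invr_gt0 // ler_ln ?posrE ?exprn_gt0 ?invr_gt0 //.
  apply: le_trans Qi _; rewrite exprSr; apply: ler_wpM2r; first by rewrite invr_ge0 ltW.
  have -> : 128 = 2 ^+ 7 :> R by ring.
  by rewrite lerXn2r ?nnegrE // ltW // invr_gt0.
have Q2 : Q%:R ^+ 2 <= (128 * e^-1) ^+ 2.
  by rewrite lerXn2r ?nnegrE ?mulr_ge0 ?invr_ge0 // ltW.
set w := e^-1 ^+ 2.
have w0 : 0 <= w by rewrite exprn_ge0 // invr_ge0 ltW.
have -> : k%:R ^+ 4 / e ^+ 2 = k%:R ^+ 4 * w by rewrite /w exprVn.
have k34 : k%:R ^+ 3 <= k%:R ^+ 4 :> R by rewrite ler_weXn2l ?ler1n.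
have k3 : 0 <= k%:R ^+ 3 :> R by rewrite exprn_ge0.
have l2 := ln2_ge.
have l0 : 0 <= ln Q%:R :> R by rewrite ln_ge0 // ler1n -(ltr0n R).
have qw : Q%:R ^+ 2 <= 2 ^+ 14 * w.
  by apply: le_trans Q2 _; rewrite exprMn -/w -[128 ^+ 2](_ : 2 ^+ 14 = _) //; ring.
set a := k%:R ^+ 3 in k34 k3 *; set b := k%:R ^+ 4 in k34 *.
clearbody Q.
have -> : (200 * (k * k * k * (2 * Q ^ 2)))%:R = 400 * a * Q%:R ^+ 2 :> R.
  rewrite !natrM /a; ring.
rewrite natrM natrX.
have step : a * Q%:R ^+ 2 * ln Q%:R <= b * (2 ^+ 14 * w) * (8 * L).
  have q20 : 0 <= Q%:R ^+ 2 :> R by rewrite exprn_ge0.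
  by apply: ler_pM lnQ => //; [exact: mulr_ge0|exact: ler_pM].
have half : b * w * L * 2^-1 <= b * w * L * ln 2.
  have bwL : 0 <= b * w * L by do 2 (apply: mulr_ge0 => //); exact: le_trans k34.
  exact: ler_wpM2l bwL _ _ l2.
have -> : 400 * a * Q%:R ^+ 2 * ln Q%:R = 400 * (a * Q%:R ^+ 2 * ln Q%:R) by ring.
have -> : 400 * 2 ^+ 18 * (b * w * L) * ln 2 = (400 * 2 ^+ 18) * (b * w * L * ln 2) by ring.
apply: (@le_trans _ _ (400 * 2 ^+ 18 * (b * w * L * 2^-1))).
  rewrite (_ : 400 * 2 ^+ 18 * (b * w * L * 2^-1) = 400 * (b * (2 ^+ 14 * w) * (8 * L))); last by field.
  by rewrite ler_pM2l.
by apply: ler_wpM2l half; rewrite mulr_ge0 // exprn_ge0.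
Qed.

End TimeBound.

Unset Implicit Arguments.
Set Strict Implicit.
Set Printing Implicit Defensive.

Theorem theorem2 (R : realType) :
  exists (p : cmd) (c1 c2 : nat),
  forall (m k : nat) (X : {set m.-tuple bool})
         (Rs : m.-tuple {set k.-tuple bool})
         (xs : seq (m.-tuple bool)) (eps : R),
    (0 < k)%N -> perm_eq xs (enum X) -> 0 < eps ->
  exists t : nat,
    [/\ t%:R <= time_bound c1 c2 eps k #|X| m,
        always eps
          (fun s => (exists C, satisfies Rs C) -> satisfies Rs (output m k s))
          t ([:: p], init xs Rs)
      & (exists C, satisfies Rs C) ->
        1 - 1 / expR 1 <=
        prob eps
          (fun s => (cost X (entries (output m k s)))%:R
                    <= (1 + eps) * (OPT X Rs)%:R)
          t ([:: p], init xs Rs)].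
Proof.
(* The first factor of the bound already accommodates the whole running time, hence the witness 0
   for [c2]. *)
exists Main, (400 * 2 ^ 18)%N, 0%N => m k X Rs xs eps k0 xs_enum eps0.
have exE := scale_exists eps0.
case: (ex_minnP exE) => E /andP [E1 E_eps] min.
have Emin d : (1 < d)%N -> 1 <= d%:R * eps -> (E <= d)%N.
  by move=> d1 d_eps; apply: min; rewrite d1.
have nX : #|X| = size xs by rewrite cardE (perm_size xs_enum).
exists (t_main (size xs) m k (64 * E) E (2 * (64 * E) ^ 2) ((64 * E) ^ (k + 4 * k))
  ((64 * E) ^ (64 * (k * k * k * (2 * (64 * E) ^ 2))))); split.
- refine (le_trans _ (time_bound_ge _ _ _ _ _ _)); [|exact: eps0|exact: E1|exact: k0|exact: Emin].
  by rewrite ler_nat nX; apply: t_main_le.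
- refine (always_weaken _ (leqnn _) (main_sure _ k0 xs_enum E1 E_eps Emin)) => // s h [C sC].
  by apply: h; apply/existsP; exists C.
- exact: main_success.
Qed.
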